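(* Let $H=H_\omega$ be a weighted analytic Hilbert space and $\varphi\colon\mathbb{D}\to\mathbb{D}$ a symbol for $H$ (i.e. inducing a bounded composition operator $C_\varphi\colon H\to H$) with $\|\varphi\|_\infty<1$. Then $$\limsup_{n\to\infty}[a_n(C_\varphi)]^{1/n}\le \exp\big(-1/\operatorname{Cap}[\overline{\varphi(\mathbb{D})}]\big).$$
   Context: Weighted analytic Hilbert space: $\omega\colon[0,1)\to(0,\infty)$ continuous, positive, integrable, extended radially; $H_\omega$ is the space of analytic $f$ on $\mathbb{D}$ with $\|f\|_\omega^2=|f(0)|^2+\int_{\mathbb{D}}|f'|^2\omega\,dA<\infty$ ($dA$ normalized area measure). $a_n(T)=\inf\{\|T-R\|:\operatorname{rank}R<n\}$. Green capacity: $g(z,w)=\log\left|\frac{1-\bar wz}{z-w}\right|$, $I(\mu)=\iint g\,d\mu\,d\mu$, $V(E)=\inf I(\mu)$ over probability measures supported by a compact subset of $E$, $\operatorname{Cap}(E)=1/V(E)$. *)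

(* Defs.v *)
From HB Require Import structures.
From mathcomp Require Import all_boot all_order all_algebra.
From mathcomp Require Import complex.
From mathcomp Require Import all_classical all_reals all_analysis.
Set Implicit Arguments.
Unset Strict Implicit.
Unset Printing Implicit Defensive.
Import Order.TTheory GRing.Theory Num.Theory.
Import numFieldNormedType.Exports.
Local Open Scope classical_set_scope.
Local Open Scope ring_scope.

Section WeightedSpace.
Variable R : realType.

Definition cmod (z : R[i]) : R :=
  Num.sqrt (complex.Re z ^+ 2 + complex.Im z ^+ 2).

Definition toC (p : R * R) : R[i] := Complex p.1 p.2.
Definition toRR (z : R[i]) : R * R := (complex.Re z, complex.Im z).

Definition Dset : set R[i] := [set z | cmod z < 1].

Definition analytic_on_D (f : R[i] -> R[i]) : Prop :=
  forall z, Dset z -> @derivable _ (R[i]^o) (R[i]^o) f z 1.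

Definition area := ((@lebesgue_measure R) \x (@lebesgue_measure R))%E.

(* the (unnormalized) weighted Dirichlet integral  int_D |f'|^2 omega dx dy,
   with omega extended radially: omega(z) = omega(|z|) *)
Definition dirichlet (omega : R -> R) (f : R[i] -> R[i]) : \bar R :=
  (\int[area]_(p in [set p | Dset (toC p)])
     ((cmod (@derive1 _ (R[i]^o) f (toC p))) ^+ 2 * omega (cmod (toC p)))%:E)%E.

Definition inH (omega : R -> R) (f : R[i] -> R[i]) : Prop :=
  analytic_on_D f /\ (dirichlet omega f < +oo)%E.

(* ||f||_omega, with dA = dx dy / pi the normalized area measure *)
Definition Hnorm (omega : R -> R) (f : R[i] -> R[i]) : R :=
  Num.sqrt (cmod (f 0) ^+ 2 + pi^-1 * fine (dirichlet omega f)).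

Definition admissible_weight (omega : R -> R) : Prop :=
  {within `[0, 1[, continuous omega} /\
  (forall r, 0 <= r < 1 -> 0 < omega r) /\
  (@lebesgue_measure R).-integrable `[0, 1[ (EFin \o omega).

Definition compo (phi : R[i] -> R[i]) (f : R[i] -> R[i]) : R[i] -> R[i] :=
  f \o phi.

Definition symbol (omega : R -> R) (phi : R[i] -> R[i]) : Prop :=
  analytic_on_D phi /\ (forall z, Dset z -> Dset (phi z)) /\
  (forall f, inH omega f -> inH omega (compo phi f)) /\
  exists M : R, forall f, inH omega f ->
    Hnorm omega (compo phi f) <= M * Hnorm omega f.

Definition opnorm (omega : R -> R)
    (S : (R[i] -> R[i]) -> (R[i] -> R[i])) : \bar R :=
  ereal_sup [set (Hnorm omega (S f))%:E | f in
               [set f | inH omega f /\ Hnorm omega f <= 1]].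

Definition rank_lt (omega : R -> R) (n : nat)
    (Rop : (R[i] -> R[i]) -> (R[i] -> R[i])) : Prop :=
  (0 < n)%N /\
  (forall f, inH omega f -> inH omega (Rop f)) /\
  (forall f g (a b : R[i]), inH omega f -> inH omega g ->
     forall z, Dset z ->
       Rop (fun w => a * f w + b * g w) z = a * Rop f z + b * Rop g z) /\
  exists g : 'I_n.-1 -> (R[i] -> R[i]),
    (forall i, inH omega (g i)) /\
    forall f, inH omega f -> exists c : 'I_n.-1 -> R[i],
      forall z, Dset z -> Rop f z = \sum_(i < n.-1) c i * g i z.

Definition approx_num (omega : R -> R) (n : nat)
    (T : (R[i] -> R[i]) -> (R[i] -> R[i])) : \bar R :=
  ereal_inf [set opnorm omega (fun f => T f \- Rop f) | Rop in
               [set Rop | rank_lt omega n Rop]].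

Definition green (z w : R[i]) : \bar R :=
  if z == w then +oo%E
  else (ln (cmod ((1 - conjc w * z) / (z - w))))%:E.

Definition energy (mu : probability (R * R)%type R) : \bar R :=
  (\int[mu]_p \int[mu]_q green (toC p) (toC q))%E.

Definition Vgreen (E : set (R * R)) : \bar R :=
  ereal_inf [set energy mu | mu in
    [set mu : probability (R * R)%type R |
       exists K : set (R * R), compact K /\ K `<=` E /\ mu (~` K) = 0%E]].

Definition Cap (E : set (R * R)) : \bar R := ((Vgreen E)^-1)%E.

Definition closure_image (phi : R[i] -> R[i]) : set (R * R) :=
  closure (toRR @` (phi @` Dset)).

End WeightedSpace.

(* Main.v *)
Require Import Defs.
From HB Require Import structures.
From mathcomp Require Import all_boot all_order all_algebra.
From mathcomp Require Import complex perm ring lra zify.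
From mathcomp Require Import all_classical all_reals all_analysis.
From mathcomp Require Import measurable_realfun.
Import Order.TTheory GRing.Theory Num.Theory.
Import numFieldNormedType.Exports.
Local Open Scope classical_set_scope.
Local Open Scope ring_scope.

(** Let [V] be the minimal Green energy of the closure of [phi(D)] and [v < V].  A nearly
    energy-minimising system of [N] points in a neighbourhood of [phi(D)] has a Blaschke
    product of size at most [2 exp(-N v)] there: otherwise such systems would have energy at
    most [v], and a limit of their normalised counting measures would contradict [v < V].
    An Auerbach-type choice of [N] functions in the unit ball of [H], nearly maximising the
    determinant of their values at the points, gives an interpolation operator [P] of rank [N]
    with coefficients bounded by 2.  For [f] in the unit ball, [f - P f] is bounded by
    [O(N)] on a disc of radius less than 1 and vanishes at the points, hence the maximum
    principle bounds it by [O(N) (exp(-v) / k)^N] near [phi(D)] for each [k < 1].  Cauchy's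
    estimate carries this over to the derivative, and then to the norm of
    [(f - P f) o phi], because [phi] itself lies in [H]. *)

Set Implicit Arguments.
Unset Strict Implicit.
Unset Printing Implicit Defensive.

Local Notation Re := complex.Re.
Local Notation Im := complex.Im.

(** * Moduli and complex derivatives *)

Section ComplexModulus.
Variable R : realType.
Implicit Types (z w : R[i]) (x y : R).

(** The extremal problem is posed on neighbourhoods of [phi(D)] for two reasons: Cauchy's estimate
    needs room around each value of [phi], and [phi] may be constant, so that [phi(D)] need not
    contain N points. The radii shrink, so the limit measure still lives on the closure. Neither the
    minimal energy nor the maximal determinant is claimed to be attained; near-optimal choices cost
    constant factors 2, which n-th roots do not see. Dividing by Blaschke factors costs k^N, because
    the maximum principle is applied on a circle of radius less than 1, where the unit ball of [H]
    is bounded; the gap between v and V pays for this and for the factor O(N). The limit measure is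
    realised as the law of a limit of quantile maps. Its energy is bounded by Fatou's lemma, the
    diagonal t = u, where the discrete energies omit the singularity, being a null set. The Cauchy
    theory runs on squares, where the contour integral of 1/z, of modulus at least 4, stands for 2
    pi i. *)

Lemma normcE_cmod z : `|z| = (cmod z)%:C%C.
Proof. by rewrite normc_def. Qed.

Lemma cmod_ge0 z : 0 <= cmod z.
Proof. exact: sqrtr_ge0. Qed.

Lemma cmodM z w : cmod (z * w) = cmod z * cmod w.
Proof.
apply: (@complexI R); rewrite -normcE_cmod normrM !normcE_cmod.
by rewrite -rmorphM.
Qed.

Lemma cmodV z : cmod z^-1 = (cmod z)^-1.
Proof.
by apply: (@complexI R); rewrite -normcE_cmod normfV normcE_cmod -fmorphV.
Qed.

Lemma cmodD z w : cmod (z + w) <= cmod z + cmod w.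
Proof.
by rewrite -lecR rmorphD /= -!normcE_cmod ler_normD.
Qed.

Lemma cmodN z : cmod (- z) = cmod z.
Proof. by apply: (@complexI R); rewrite -!normcE_cmod normrN. Qed.

Lemma cmodB z w : cmod (z - w) = cmod (w - z).
Proof. by rewrite -cmodN opprB. Qed.

Lemma cmodX z n : cmod (z ^+ n) = cmod z ^+ n.
Proof.
elim: n => [|n IH]; last by rewrite !exprS cmodM IH.
by rewrite !expr0 /cmod /= expr1n expr0n addr0 sqrtr1.
Qed.

Lemma cmod0 : cmod (0 : R[i]) = 0.
Proof. by rewrite /cmod /= expr0n addr0 sqrtr0. Qed.

Lemma cmod1 : cmod (1 : R[i]) = 1.
Proof. by rewrite -(expr0 0) cmodX expr0. Qed.

Lemma cmod_eq0 z : (cmod z == 0) = (z == 0).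
Proof. by rewrite -(normr_eq0 z) normcE_cmod eq_complex /= eqxx andbT. Qed.

Lemma cmod_gt0 z : (0 < cmod z) = (z != 0).
Proof. by rewrite lt_def cmod_eq0 cmod_ge0 andbT. Qed.

Lemma cmodBD z w : cmod z - cmod w <= cmod (z + w).
Proof. by have := cmodD (z + w) (- w); rewrite addrK cmodN; lra. Qed.

Lemma cmod_sqr z : cmod z ^+ 2 = Re z ^+ 2 + Im z ^+ 2.
Proof. by rewrite sqr_sqrtr// addr_ge0// sqr_ge0. Qed.

Lemma normr_Re_le z : `|Re z| <= cmod z.
Proof.
rewrite -[`|_|]ger0_norm// -sqrtr_sqr real_normK ?num_real// ler_wsqrtr//.
by rewrite lerDl sqr_ge0.
Qed.

Lemma normr_Im_le z : `|Im z| <= cmod z.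
Proof.
rewrite -[`|_|]ger0_norm// -sqrtr_sqr real_normK ?num_real// ler_wsqrtr//.
by rewrite lerDr sqr_ge0.
Qed.

Lemma cmod_le_ReIm z : cmod z <= `|Re z| + `|Im z|.
Proof.
rewrite -(@ler_pXn2r _ 2)// ?nnegrE ?cmod_ge0 ?addr_ge0//.
rewrite cmod_sqr sqrrD !real_normK ?num_real//.
have : 0 <= `|Re z| * `|Im z| by rewrite mulr_ge0.
lra.
Qed.

Lemma cmod_real x : cmod (x%:C%C) = `|x|.
Proof. by rewrite /cmod /= expr0n addr0 sqrtr_sqr. Qed.

Lemma cmod_nat n : cmod (n%:R : R[i]) = n%:R.
Proof.
have -> : (n%:R : R[i]) = (n%:R : R)%:C%C by rewrite rmorph_nat.
by rewrite cmod_real normr_nat.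
Qed.

Lemma cmod_conj z : cmod (conjc z) = cmod z.
Proof. by case: z => a b; rewrite /cmod /= sqrrN. Qed.

Lemma cmod_sum (I : finType) (F : I -> R[i]) : cmod (\sum_i F i) <= \sum_i cmod (F i).
Proof.
elim/big_ind2 : _ => //; first by rewrite cmod0.
by move=> x1 x2 y1 y2 h1 h2; apply: le_trans (cmodD _ _) (lerD _ _).
Qed.

Lemma cmod_prod (I : Type) (s : seq I) (F : I -> R[i]) :
  cmod (\prod_(i <- s) F i) = \prod_(i <- s) cmod (F i).
Proof.
by elim: s => [|a s IH]; rewrite ?big_nil ?cmod1// !big_cons cmodM IH.
Qed.

End ComplexModulus.

Section ComplexDerivative.
Variable R : realType.
Local Notation C := R[i].
Implicit Types (f g q : C -> C) (z w l : C).

(** Phrased with the real modulus [cmod], because the norm of [R[i]] takes its values in [R[i]]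
    itself. *)
Definition ccont f z := forall e : R, 0 < e ->
  exists2 d : R, 0 < d & forall w, cmod (w - z) < d -> cmod (f w - f z) < e.

(** Caratheodory's form of differentiability: a slope [q], continuous at [z] with value [l] there.
    Product, inverse and chain rules become algebraic identities between slopes. *)
Definition cder f z l := exists q (d : R), [/\ 0 < d,
  forall w, cmod (w - z) < d -> f w - f z = q w * (w - z),
  q z = l & ccont q z].

Lemma ccont_cst l z : ccont (fun=> l) z.
Proof. by move=> e e0; exists 1 => // w _; rewrite subrr cmod0. Qed.

Lemma ccont_id z : ccont id z.
Proof. by move=> e e0; exists e. Qed.

Lemma ccont_near f g z (d : R) : 0 < d ->
  (forall w, cmod (w - z) < d -> f w = g w) -> ccont f z -> ccont g z.
Proof.
move=> d0 fg cf e e0; have [d' d'0 h] := cf e e0.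
exists (Num.min d d'); first by rewrite lt_min d0.
move=> w; rewrite lt_min => /andP[wd wd'].
by rewrite -!fg ?subrr ?cmod0//; exact: h.
Qed.

Lemma ccontD f g z : ccont f z -> ccont g z -> ccont (fun w => f w + g w) z.
Proof.
move=> cf cg e e0.
have [d d0 hd] := cf _ (divr_gt0 e0 (ltr0n R 2)).
have [k k0 hk] := cg _ (divr_gt0 e0 (ltr0n R 2)).
exists (Num.min d k); first by rewrite lt_min d0.
move=> w; rewrite lt_min => /andP[/hd h1 /hk h2].
rewrite opprD addrACA; apply: le_lt_trans (cmodD _ _) _; lra.
Qed.

Lemma ccontM f g z : ccont f z -> ccont g z -> ccont (fun w => f w * g w) z.
Proof.
move=> cf cg e e0.
pose M := cmod (f z) + cmod (g z) + 1.
have M0 : 0 < M by rewrite /M; have := cmod_ge0 (f z); have := cmod_ge0 (g z); lra.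
have eM : 0 < Num.min 1 (e / (2 * M)).
  by rewrite lt_min ltr01 divr_gt0// mulr_gt0.
have [d d0 hd] := cf _ eM; have [k k0 hk] := cg _ eM.
exists (Num.min d k); first by rewrite lt_min d0.
move=> w; rewrite lt_min => /andP[/hd + /hk].
rewrite !lt_min => /andP[h1 h1'] /andP[h2 h2'].
have -> : f w * g w - f z * g z =
  (f w - f z) * (g w - g z) + (f w - f z) * g z + f z * (g w - g z) by ring.
have h : e = e / (2 * M) * (2 * M) by rewrite divfK// gt_eqF// mulr_gt0.
have e'0 : 0 < e / (2 * M) by rewrite divr_gt0// mulr_gt0.
apply: le_lt_trans (cmodD _ _) _.
apply: (@le_lt_trans _ _ (cmod ((f w - f z) * (g w - g z)) +
  cmod ((f w - f z) * g z) + cmod (f z * (g w - g z)))).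
  by rewrite lerD2r cmodD.
rewrite !cmodM [X in _ < X]h.
have F1 := cmod_ge0 (f w - f z); have F2 := cmod_ge0 (g w - g z).
have F3 := cmod_ge0 (f z); have F4 := cmod_ge0 (g z).
rewrite /M; set t := e / (2 * M) in h1' h2' e'0 *.
nra.
Qed.

Lemma ccont_sub f z : ccont f z -> f z != 0 ->
  exists2 d : R, 0 < d & forall w, cmod (w - z) < d -> cmod (f z) / 2 < cmod (f w).
Proof.
move=> cf fz; have f0 : 0 < cmod (f z) by rewrite cmod_gt0.
have [d d0 h] := cf _ (divr_gt0 f0 (ltr0n R 2)).
exists d => // w /h; have := cmodBD (f z) (f w - f z).
have -> : f z + (f w - f z) = f w by ring.
lra.
Qed.

Lemma ccontV f z : ccont f z -> f z != 0 -> ccont (fun w => (f w)^-1) z.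
Proof.
move=> cf fz e e0; have f0 : 0 < cmod (f z) by rewrite cmod_gt0.
have [d d0 hd] := ccont_sub cf fz.
have e'0 : 0 < e * (cmod (f z) ^+ 2 / 2) by rewrite !mulr_gt0// ?exprn_gt0 ?invr_gt0.
have [k k0 hk] := cf _ e'0.
exists (Num.min d k); first by rewrite lt_min d0.
move=> w; rewrite lt_min => /andP[/hd h1 /hk h2].
have fw : f w != 0 by rewrite -cmod_gt0; lra.
have -> : (f w)^-1 - (f z)^-1 = - (f w - f z) * ((f w)^-1 * (f z)^-1).
  by field; rewrite fw fz.
rewrite !cmodM cmodN !cmodV -invfM ltr_pdivrMr; last by rewrite mulr_gt0//; lra.
apply: lt_le_trans h2 _.
rewrite -mulrA; apply: ler_wpM2l; [lra|nra].
Qed.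

Lemma ccont_comp f g z : ccont f z -> ccont g (f z) -> ccont (g \o f) z.
Proof.
move=> cf cg e e0; have [d d0 hd] := cg e e0; have [k k0 hk] := cf d d0.
by exists k => // w /hk /hd.
Qed.

Lemma ccontX f n z : ccont f z -> ccont (fun w => f w ^+ n) z.
Proof.
move=> cf; elim: n => [|n IH]; first exact: ccont_cst.
have := ccontM cf IH; apply: (ccont_near ltr01) => w _.
by rewrite exprS.
Qed.

Lemma cder_cont f z l : cder f z l -> ccont f z.
Proof.
move=> [q [d [d0 hq _ cq]]].
have c1 : ccont (fun w => f z + q w * (w - z)) z.
  apply: ccontD; first exact: ccont_cst.
  by apply: ccontM => //; apply: ccontD; [exact: ccont_id|exact: ccont_cst].
by apply: (ccont_near d0 _ c1) => w wd; rewrite -hq// addrC subrK.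
Qed.

Lemma cder_near f g z l (d : R) : 0 < d ->
  (forall w, cmod (w - z) < d -> f w = g w) -> cder f z l -> cder g z l.
Proof.
move=> d0 fg [q [k [k0 h qz cq]]]; exists q, (Num.min d k); split => //.
  by rewrite lt_min d0.
move=> w; rewrite lt_min => /andP[wd wk].
by rewrite -!fg ?subrr ?cmod0//; exact: h.
Qed.

Lemma cder_cst l z : cder (fun=> l) z 0.
Proof.
exists (fun=> 0), 1; split=> //; last exact: ccont_cst.
by move=> w _; rewrite subrr mul0r.
Qed.

Lemma cder_id z : cder id z 1.
Proof.
exists (fun=> 1), 1; split=> //; last exact: ccont_cst.
by move=> w _; rewrite mul1r.
Qed.

Lemma cderD f g z l m : cder f z l -> cder g z m ->
  cder (fun w => f w + g w) z (l + m).
Proof.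
move=> [q [d [d0 hq qz cq]]] [p [k [k0 hp pz cp]]].
exists (fun w => q w + p w), (Num.min d k); split; rewrite ?qz ?pz//.
- by rewrite lt_min d0.
- move=> w; rewrite lt_min => /andP[/hq h1 /hp h2].
  by rewrite mulrDl -h1 -h2; ring.
- exact: ccontD.
Qed.

Lemma cderM f g z l m : cder f z l -> cder g z m ->
  cder (fun w => f w * g w) z (l * g z + f z * m).
Proof.
move=> df dg; have cf := cder_cont df; have cg := cder_cont dg.
move: df dg => [q [d [d0 hq qz cq]]] [p [k [k0 hp pz cp]]].
exists (fun w => q w * g w + f z * p w), (Num.min d k); split; rewrite ?qz ?pz//.
- by rewrite lt_min d0.
- move=> w; rewrite lt_min => /andP[/hq h1 /hp h2].
  have -> : f w * g w - f z * g z = (f w - f z) * g w + f z * (g w - g z) by ring.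
  by rewrite h1 h2; ring.
- by apply: ccontD; apply: ccontM => //; exact: ccont_cst.
Qed.

Lemma cderV f z l : cder f z l -> f z != 0 ->
  cder (fun w => (f w)^-1) z (- l / f z ^+ 2).
Proof.
move=> df fz; have cf := cder_cont df; move: df => [q [d [d0 hq qz cq]]].
have [k k0 hk] := ccont_sub cf fz.
exists (fun w => - q w * ((f w)^-1 * (f z)^-1)), (Num.min d k); split.
- by rewrite lt_min d0.
- move=> w; rewrite lt_min => /andP[/hq h1 /hk h2].
  have fw : f w != 0 by rewrite -cmod_gt0; have := cmod_ge0 (f z); lra.
  have -> : (f w)^-1 - (f z)^-1 = - (f w - f z) * ((f w)^-1 * (f z)^-1).
    by field; rewrite fw fz.
  by rewrite h1; ring.
- by rewrite qz; field.
- apply: ccontM.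
    have := ccontM (ccont_cst (-1) z) cq; apply: (ccont_near ltr01) => w _.
    by rewrite mulN1r.
  by apply: ccontM; [exact: ccontV|exact: ccont_cst].
Qed.

Lemma cder_comp f g z l m : cder f z l -> cder g (f z) m ->
  cder (g \o f) z (m * l).
Proof.
move=> df; have cf := cder_cont df; move: df => [q [d [d0 hq qz cq]]].
move=> [p [k [k0 hp pz cp]]]; have [d' d'0 hd'] := cf k k0.
exists (fun w => p (f w) * q w), (Num.min d d'); split; rewrite ?qz ?pz//.
- by rewrite lt_min d0.
- move=> w; rewrite lt_min => /andP[/hq h1 /hd' h2] /=.
  by rewrite hp// h1; ring.
- by apply: ccontM => //; exact: (ccont_comp cf cp).
Qed.

Lemma cder_unique f z l m : cder f z l -> cder f z m -> l = m.
Proof.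
move=> [q [d [d0 hq <- cq]]] [p [k [k0 hp <- cp]]].
apply/eqP; rewrite -subr_eq0 -cmod_eq0 eq_le cmod_ge0 andbT.
apply/ler_addgt0Pl => e e0; rewrite addr0.
have e2 : 0 < e / 2 by rewrite divr_gt0.
have [d1 d10 h1] := cq _ e2; have [k1 k10 h2] := cp _ e2.
pose t := Num.min (Num.min d k) (Num.min d1 k1).
have t0 : 0 < t by rewrite !lt_min d0 k0 d10.
have tm : cmod ((t / 2)%:C%C : C) < t by rewrite cmod_real gtr0_norm; lra.
have := tm; rewrite {2}/t !lt_min => /andP[/andP[A1 A2] /andP[A3 A4]].
have tn : ((t / 2)%:C%C : C) != 0 by rewrite -cmod_gt0 cmod_real gtr0_norm; lra.
pose w := z + (t / 2)%:C%C.
have wz : w - z = (t / 2)%:C%C by rewrite /w addrAC subrr add0r.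
have : q w = p w.
  have := hq w; have := hp w; rewrite wz => /(_ A2) E2 /(_ A1) E1.
  by apply: (mulIf tn); rewrite -E1 -E2.
move=> qp; have := h1 w; have := h2 w; rewrite wz => /(_ A4) B1 /(_ A3) B2.
have -> : q z - p z = (p w - p z) - (q w - q z) by rewrite qp; ring.
apply: le_trans (cmodD _ _) _; rewrite cmodN; lra.
Qed.

Lemma derivable_cder f z : @derivable _ (C^o) (C^o) f z 1 ->
  cder f z (@derive1 _ (C^o) f z).
Proof.
move=> df; have := df; rewrite /derivable => cv.
rewrite derive1E.
pose l : C := @derive _ (C^o) (C^o) f z 1; rewrite -/l.
have /cvgrPdist_lt cvl : (fun h : C^o => h^-1 *: ((f : C^o -> C^o) (h *: 1 + z) - f z))
  @ 0^' --> (l : C^o) by exact: cv.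
exists (fun w => if w == z then l else (f w - f z) / (w - z)), 1; split => //.
- move=> w _; case: eqP => [->|/eqP wz]; first by rewrite !subrr mulr0.
  by rewrite divfK// subr_eq0.
- by rewrite eqxx.
- move=> e e0.
  have eC : 0 < (e%:C%C : C) by rewrite ltcR.
  have := cvl _ eC; rewrite ?near_simpl.
  move=> /nbhs_ballP[d /=]; rewrite ltcE /= => /andP[/eqP d1 d0] h.
  exists (Re d) => // w wd; rewrite eqxx.
  case: eqP => [_|/eqP wz]; first by rewrite subrr cmod0.
  have wz0 : w - z != 0 by rewrite subr_eq0.
  have := h (w - z); rewrite /ball /= => /(_ _ wz0).
  rewrite sub0r normrN normcE_cmod ltcE /= -d1 eqxx /= => /(_ wd).
  rewrite normcE_cmod ltcR cmodB /GRing.scale /= mulr1 subrK.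
  by rewrite [_^-1 * _]mulrC.
Qed.

Lemma cder_derivable f z l : cder f z l ->
  @derivable _ (C^o) (C^o) f z 1 /\ @derive1 _ (C^o) f z = l.
Proof.
move=> [q [d [d0 hq qz cq]]].
have cv : (fun h : C^o => h^-1 *: ((f : C^o -> C^o) (h *: 1 + z) - f z))
    @ 0^' --> (l : C^o).
  apply/cvgrPdist_lt => e; rewrite ltcE /= => /andP[/eqP e1 e0].
  rewrite ?near_simpl; have [k k0 hk] := cq _ e0.
  apply/nbhs_ballP; exists ((Num.min d k)%:C%C); first by rewrite /= ltcR lt_min d0.
  move=> h; rewrite /ball /= sub0r normrN normcE_cmod ltcR lt_min => /andP[hd hk'] h0.
  rewrite normcE_cmod ltcE /= -e1 eqxx /= /GRing.scale /= mulr1.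
  have e2 : h + z - z = h by rewrite addrK.
  by rewrite hq e2// mulrCA mulVf// mulr1 cmodB -qz hk// e2.
have df : @derivable _ (C^o) (C^o) f z 1 by apply/cvg_ex; exists l.
split => //; rewrite derive1E /derive.
by apply: (@cvg_lim _ (@norm_hausdorff _ (C^o))); exact: cv.
Qed.

Lemma analytic_cder f z : analytic_on_D f -> Dset z ->
  cder f z (@derive1 _ (C^o) f z).
Proof. by move=> af Dz; exact/derivable_cder/af. Qed.

Lemma cder_analytic f (g : C -> C) : (forall z, Dset z -> cder f z (g z)) ->
  analytic_on_D f.
Proof. by move=> h z Dz; have [] := cder_derivable (h z Dz). Qed.

End ComplexDerivative.

(** * Rectangle integrals and the Cauchy formula *)

Section RectangleIntegral.
Variable R : realType.
Local Notation C := R[i].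
Local Notation mu := (@lebesgue_measure R).
Implicit Types (a b c d m : R) (f g : C -> C) (u v : R -> C).

Definition pcont u (t : R) := forall e : R, 0 < e ->
  exists2 d : R, 0 < d & forall s, `|s - t| < d -> cmod (u s - u t) < e.

(** Continuity is two-sided even at the end points; this is available because the integrands are
    continuous in the plane at every point of the contour. *)
Definition pcont_on a b u := forall t, a <= t <= b -> pcont u t.

Definition cint a b u : C :=
  Complex (\int[mu]_(x in `[a, b]) Re (u x)) (\int[mu]_(x in `[a, b]) Im (u x)).

Lemma cont_itv_integrable a b (h : R -> R) :
  (forall t, a <= t <= b -> {for t, continuous h}) ->
  mu.-integrable `[a, b] (EFin \o h).
Proof.
move=> ch; apply: continuous_compact_integrable; first exact: segment_compact.
apply: continuous_in_subspaceT => t; rewrite inE /= in_itv /= => tab.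
exact: ch.
Qed.

Lemma pcont_Re u t : pcont u t -> {for t, continuous (fun s => Re (u s))}.
Proof.
move=> cu; apply/cvgrPdist_lt => e e0; have [d d0 h] := cu e e0.
near=> s; rewrite distrC; apply: le_lt_trans (h s _); last first.
  by near: s; apply/nbhs_ballP; exists d => //= s; rewrite /ball /= distrC.
have -> : Re (u s) - Re (u t) = Re (u s - u t) by case: (u s) (u t) => ? ? [].
exact: normr_Re_le.
Unshelve. all: by end_near. Qed.

Lemma pcont_Im u t : pcont u t -> {for t, continuous (fun s => Im (u s))}.
Proof.
move=> cu; apply/cvgrPdist_lt => e e0; have [d d0 h] := cu e e0.
near=> s; rewrite distrC; apply: le_lt_trans (h s _); last first.
  by near: s; apply/nbhs_ballP; exists d => //= s; rewrite /ball /= distrC.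
have -> : Im (u s) - Im (u t) = Im (u s - u t) by case: (u s) (u t) => ? ? [].
exact: normr_Im_le.
Unshelve. all: by end_near. Qed.

Lemma pcont_on_Re a b u : pcont_on a b u ->
  mu.-integrable `[a, b] (EFin \o (fun s => Re (u s))).
Proof. by move=> cu; apply: cont_itv_integrable => t /cu/pcont_Re. Qed.

Lemma pcont_on_Im a b u : pcont_on a b u ->
  mu.-integrable `[a, b] (EFin \o (fun s => Im (u s))).
Proof. by move=> cu; apply: cont_itv_integrable => t /cu/pcont_Im. Qed.

Lemma cint_eq a b u v : (forall t, a <= t <= b -> u t = v t) ->
  cint a b u = cint a b v.
Proof.
by move=> uv; rewrite /cint; congr Complex; apply: eq_Rintegral => t;
  rewrite inE /= in_itv /= => /uv ->.
Qed.

Lemma cintD a b u v : pcont_on a b u -> pcont_on a b v ->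
  cint a b (fun t => u t + v t) = cint a b u + cint a b v.
Proof.
move=> cu cv; rewrite /cint.
transitivity (Complex (\int[mu]_(x in `[a, b]) (Re (u x) + Re (v x)))
   (\int[mu]_(x in `[a, b]) (Im (u x) + Im (v x)))).
  by congr Complex; apply: eq_Rintegral => t _; case: (u t) (v t) => ? ? [].
rewrite !RintegralD//.
all: by [apply: pcont_on_Re|apply: pcont_on_Im].
Qed.

Lemma cintZ a b (k : C) u : pcont_on a b u ->
  cint a b (fun t => k * u t) = k * cint a b u.
Proof.
move=> cu; case: k => k1 k2; rewrite /cint.
transitivity (Complex
   (\int[mu]_(x in `[a, b]) (k1 * Re (u x) - k2 * Im (u x)))
   (\int[mu]_(x in `[a, b]) (k1 * Im (u x) + k2 * Re (u x)))).
  by congr Complex; apply: eq_Rintegral => t _; case: (u t).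
have i1 := pcont_on_Re cu; have i2 := pcont_on_Im cu.
have iZ k (h : R -> R) : mu.-integrable `[a, b] (EFin \o h) ->
    mu.-integrable `[a, b] (EFin \o (fun t => k * h t)).
  move=> ih; have := @integrableZl _ _ _ mu _ (measurable_itv _) k _ ih.
  by apply: eq_integrable => // t _; rewrite /= EFinM.
rewrite RintegralB// ?RintegralD// ?RintegralZl//; by [apply: iZ|].
Qed.

Lemma cint_cst a b (k : C) : a <= b -> cint a b (fun=> k) = k * (b - a)%:C%C.
Proof.
move=> ab; rewrite /cint !Rintegral_cst//= lebesgue_measure_itv /= lte_fin.
have -> : fine (if a < b then (b%:E - a%:E)%E else 0%E) = b - a.
  by case: ltP => [//|ba] /=; lra.
by case: k => k1 k2; rewrite /GRing.mul /= !mulr0 subr0 add0r.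
Qed.

Lemma normr_Rint_le a b (M : R) (h : R -> R) : a <= b ->
  (forall t, a <= t <= b -> {for t, continuous h}) ->
  (forall t, a <= t <= b -> `|h t| <= M) ->
  `|\int[mu]_(x in `[a, b]) h x| <= M * (b - a).
Proof.
move=> ab ch hM; have ih := cont_itv_integrable ch.
apply: le_trans (le_normr_Rintegral _ _) _ => //.
have -> : M * (b - a) = \int[mu]_(x in `[a, b]) M.
  rewrite Rintegral_cst//= lebesgue_measure_itv /= lte_fin.
  case: ltP => //= ba; have -> : b = a by lra.
  by rewrite subrr.
apply: le_Rintegral => //.
- apply: cont_itv_integrable => t /ch cht.
  exact: (cvg_norm cht).
- by apply: cont_itv_integrable => t _; exact: cst_continuous.
Qed.

(** Real and imaginary parts are bounded separately, which is the source of the factor 2. *)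
Lemma cint_le a b (M : R) u : a <= b -> pcont_on a b u ->
  (forall t, a <= t <= b -> cmod (u t) <= M) ->
  cmod (cint a b u) <= 2 * M * (b - a).
Proof.
move=> ab cu uM; apply: le_trans (cmod_le_ReIm _) _ => /=.
have -> : 2 * M * (b - a) = M * (b - a) + M * (b - a) by ring.
apply: lerD; apply: normr_Rint_le => // t tab.
- exact: pcont_Re (cu _ tab).
- exact: le_trans (normr_Re_le _) (uM _ tab).
- exact: pcont_Im (cu _ tab).
- exact: le_trans (normr_Im_le _) (uM _ tab).
Qed.

Lemma Rint_split a m b (h : R -> R) : a <= m <= b ->
  mu.-integrable `[a, b] (EFin \o h) ->
  \int[mu]_(x in `[a, b]) h x =
  \int[mu]_(x in `[a, m]) h x + \int[mu]_(x in `[m, b]) h x.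
Proof.
move=> /andP[am mb] ih.
have := @Rintegral_itvB _ h (BLeft a) (BRight b) m ih.
rewrite !bnd_simp => /(_ am mb) E.
rewrite -[X in _ = _ + X]Rintegral_itv_obnd_cbnd -?E; first by ring.
by apply: integrableS ih => //; apply: subset_itvr; rewrite bnd_simp.
Qed.

Lemma cint_split a m b u : a <= m <= b -> pcont_on a b u ->
  cint a b u = cint a m u + cint m b u.
Proof.
move=> amb cu; rewrite /cint.
by rewrite (Rint_split amb (pcont_on_Re cu)) (Rint_split amb (pcont_on_Im cu)).
Qed.

Lemma pcontD u v t : pcont u t -> pcont v t -> pcont (fun s => u s + v s) t.
Proof.
move=> cf cg e e0.
have [d d0 hd] := cf _ (divr_gt0 e0 (ltr0n R 2)).
have [k k0 hk] := cg _ (divr_gt0 e0 (ltr0n R 2)).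
exists (Num.min d k); first by rewrite lt_min d0.
move=> w; rewrite lt_min => /andP[/hd h1 /hk h2].
rewrite opprD addrACA; apply: le_lt_trans (cmodD _ _) _; lra.
Qed.

Lemma pcont_h f x c : ccont f (Complex x c) -> pcont (fun s => f (Complex s c)) x.
Proof.
move=> cf e e0; have [d d0 h] := cf e e0; exists d => // s sx; apply: h.
have -> : Complex s c - Complex x c = (s - x)%:C%C by rewrite /GRing.add /= subrr.
by rewrite cmod_real.
Qed.

Lemma pcont_v f c y : ccont f (Complex c y) -> pcont (fun s => f (Complex c s)) y.
Proof.
move=> cf e e0; have [d d0 h] := cf e e0; exists d => // s sx; apply: h.
have -> : Complex c s - Complex c y = Complex 0 (s - y).
  by rewrite /GRing.add /= subrr.
by rewrite /cmod /= expr0n add0r sqrtr_sqr.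
Qed.

(** The counterclockwise contour integral over the boundary of [a, b] x [c, d]: opposite sides are
    paired with opposite signs, and dz = i dy on the vertical ones. *)
Definition rect f a b c d : C :=
  cint a b (fun x => f (Complex x c) - f (Complex x d)) +
  Complex 0 1 * cint c d (fun y => f (Complex b y) - f (Complex a y)).

Definition inrect a b c d (z : C) := (a <= Re z <= b) && (c <= Im z <= d).

Definition bdry a b c d (z : C) := inrect a b c d z &&
  [|| Re z == a, Re z == b, Im z == c | Im z == d].

Definition cont_bdry f a b c d := forall z, bdry a b c d z -> ccont f z.

Lemma cont_bdry_h f a b c d : c <= d -> cont_bdry f a b c d ->
  pcont_on a b (fun x => f (Complex x c)) /\ pcont_on a b (fun x => f (Complex x d)).
Proof.
move=> cd cf; split=> t tab; apply/pcont_h/cf;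
by rewrite /bdry /inrect /= tab !lexx cd eqxx !orbT.
Qed.

Lemma cont_bdry_v f a b c d : a <= b -> cont_bdry f a b c d ->
  pcont_on c d (fun x => f (Complex b x)) /\ pcont_on c d (fun x => f (Complex a x)).
Proof.
move=> ab cf; split=> t tab; apply/pcont_v/cf;
by rewrite /bdry /inrect /= tab !lexx ab eqxx ?orbT.
Qed.

Lemma pcontN u t : pcont u t -> pcont (fun s => - u s) t.
Proof.
move=> cu e e0; have [d d0 h] := cu e e0; exists d => // s /h.
by rewrite -opprD cmodN.
Qed.

Lemma pcont_onB a b u v : pcont_on a b u -> pcont_on a b v ->
  pcont_on a b (fun s => u s - v s).
Proof. by move=> cu cv t tab; apply: pcontD; [exact: cu|apply/pcontN/cv]. Qed.

Lemma rect_eq f g a b c d : a <= b -> c <= d ->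
  (forall z, bdry a b c d z -> f z = g z) -> rect f a b c d = rect g a b c d.
Proof.
move=> ab cd fg; rewrite /rect; congr (_ + _ * _); apply: cint_eq => t tab;
by rewrite !fg// /bdry /inrect /= tab ?ab ?cd ?lexx ?eqxx ?orbT.
Qed.

Lemma rectD f g a b c d : a <= b -> c <= d ->
  cont_bdry f a b c d -> cont_bdry g a b c d ->
  rect (fun z => f z + g z) a b c d = rect f a b c d + rect g a b c d.
Proof.
move=> ab cd cf cg.
have [f1 f2] := cont_bdry_h cd cf; have [f3 f4] := cont_bdry_v ab cf.
have [g1 g2] := cont_bdry_h cd cg; have [g3 g4] := cont_bdry_v ab cg.
rewrite /rect.
rewrite (@cint_eq a b _ (fun x => (f (Complex x c) - f (Complex x d)) +
  (g (Complex x c) - g (Complex x d)))); last by move=> t _; ring.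
rewrite (@cint_eq c d _ (fun x => (f (Complex b x) - f (Complex a x)) +
  (g (Complex b x) - g (Complex a x)))); last by move=> t _; ring.
rewrite (cintD (pcont_onB f1 f2) (pcont_onB g1 g2)).
by rewrite (cintD (pcont_onB f3 f4) (pcont_onB g3 g4)); ring.
Qed.

Lemma rectZ k f a b c d : a <= b -> c <= d -> cont_bdry f a b c d ->
  rect (fun z => k * f z) a b c d = k * rect f a b c d.
Proof.
move=> ab cd cf.
have [f1 f2] := cont_bdry_h cd cf; have [f3 f4] := cont_bdry_v ab cf.
rewrite /rect.
rewrite (@cint_eq a b _ (fun x => k * (f (Complex x c) - f (Complex x d))));
  last by move=> t _; ring.
rewrite (@cint_eq c d _ (fun x => k * (f (Complex b x) - f (Complex a x))));
  last by move=> t _; ring.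
by rewrite (cintZ k (pcont_onB f1 f2)) (cintZ k (pcont_onB f3 f4)); ring.
Qed.

Lemma rect_le f a b c d (M : R) : a <= b -> c <= d -> cont_bdry f a b c d ->
  (forall z, bdry a b c d z -> cmod (f z) <= M) ->
  cmod (rect f a b c d) <= 4 * M * ((b - a) + (d - c)).
Proof.
move=> ab cd cf fM.
have [f1 f2] := cont_bdry_h cd cf; have [f3 f4] := cont_bdry_v ab cf.
apply: le_trans (cmodD _ _) _; rewrite cmodM.
have -> : cmod (Complex 0 1 : C) = 1.
  by rewrite /cmod /= expr0n expr1n add0r sqrtr1.
rewrite mul1r.
have -> : 4 * M * (b - a + (d - c)) = 2 * (2 * M) * (b - a) + 2 * (2 * M) * (d - c).
  by ring.
apply: lerD; apply: cint_le => //; try exact: pcont_onB.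
- move=> t tab; apply: le_trans (cmodD _ _) _; rewrite cmodN.
  have -> : 2 * M = M + M by ring.
  by apply: lerD; apply: fM; rewrite /bdry /inrect /= tab ?ab ?cd ?lexx ?eqxx ?orbT.
- move=> t tab; apply: le_trans (cmodD _ _) _; rewrite cmodN.
  have -> : 2 * M = M + M by ring.
  by apply: lerD; apply: fM; rewrite /bdry /inrect /= tab ?ab ?cd ?lexx ?eqxx ?orbT.
Qed.

Lemma rect_split_v f a m b c d : a <= m <= b -> c <= d ->
  cont_bdry f a b c d -> (forall y, c <= y <= d -> ccont f (Complex m y)) ->
  rect f a b c d = rect f a m c d + rect f m b c d.
Proof.
move=> amb cd cf cm; have ab : a <= b by lra.
have [f1 f2] := cont_bdry_h cd cf; have [f3 f4] := cont_bdry_v ab cf.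
have f5 : pcont_on c d (fun y => f (Complex m y)) by move=> t /cm/pcont_v.
rewrite /rect (cint_split amb); last exact: pcont_onB.
rewrite (@cint_eq c d _ (fun x => (f (Complex b x) - f (Complex m x)) +
  (f (Complex m x) - f (Complex a x)))); last by move=> t _; ring.
by rewrite (cintD (pcont_onB f3 f5) (pcont_onB f5 f4)); ring.
Qed.

Lemma rect_split_h f a b c m d : a <= b -> c <= m <= d ->
  cont_bdry f a b c d -> (forall x, a <= x <= b -> ccont f (Complex x m)) ->
  rect f a b c d = rect f a b c m + rect f a b m d.
Proof.
move=> ab cmd cf cm; have cd : c <= d by lra.
have [f1 f2] := cont_bdry_h cd cf; have [f3 f4] := cont_bdry_v ab cf.
have f5 : pcont_on a b (fun x => f (Complex x m)) by move=> t /cm/pcont_h.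
rewrite /rect (cint_split cmd); last exact: pcont_onB.
rewrite (@cint_eq a b _ (fun x => (f (Complex x c) - f (Complex x m)) +
  (f (Complex x m) - f (Complex x d)))); last by move=> t _; ring.
by rewrite (cintD (pcont_onB f1 f5) (pcont_onB f5 f2)); ring.
Qed.

(** The values on opposite sides differ by [l] times the translation between them, a constant, and
    the two resulting products cancel; no primitive is involved. *)
Lemma rect_affine a b c d (k l : C) : a <= b -> c <= d ->
  rect (fun z => k + l * z) a b c d = 0.
Proof.
move=> ab cd; rewrite /rect.
rewrite (@cint_eq a b _ (fun=> l * Complex 0 (c - d))); last first.
  move=> t _; transitivity (l * (Complex t c - Complex t d)); first by ring.
  by congr (_ * _); rewrite /GRing.add /= subrr.
rewrite (@cint_eq c d _ (fun=> l * (b - a)%:C%C)); last first.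
  move=> t _; transitivity (l * (Complex b t - Complex a t)); first by ring.
  by congr (_ * _); rewrite /GRing.add /= subrr.
rewrite !cint_cst//; case: l => l1 l2.
by apply/eqP; rewrite eq_complex /=; apply/andP; split; apply/eqP; ring.
Qed.

End RectangleIntegral.

(** * Goursat's theorem by bisection *)

Section Goursat.
Variable R : realType.
Local Notation C := R[i].
Local Notation mu := (@lebesgue_measure R).
Implicit Types (a b c d m : R) (f g : C -> C) (p z w l : C).

Lemma nested_intervals (an bn : nat -> R) :
  (forall n, an n <= an n.+1) -> (forall n, bn n.+1 <= bn n) ->
  (forall n, an n <= bn n) -> exists x, forall n, an n <= x <= bn n.
Proof.
move=> ia ib ab.
have ha : {homo an : n m / (n <= m)%N >-> n <= m} by apply: homo_leq => // x y z; exact: le_trans.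
have hb : {homo bn : n m / (n <= m)%N >-> m <= n}.
  by apply: homo_leq => // x y z h1 h2; exact: le_trans h2 h1.
have abn n k : an n <= bn k.
  case: (leqP n k) => nk; first exact: le_trans (ha _ _ nk) (ab k).
  exact: le_trans (ab n) (hb _ _ (ltnW nk)).
have hs : has_sup (range an).
  split; first by exists (an 0%N), 0%N.
  by exists (bn 0%N) => _ [n _ <-]; exact: abn.
exists (sup (range an)) => n; apply/andP; split.
  by apply: ub_le_sup; [case: hs|exists n].
by apply: ge_sup; [case: hs|move=> _ [k _ <-]; exact: abn].
Qed.

(** Cousin's lemma: if the property failed, some quarter would fail again, and the nested bad
    rectangles would shrink to a point where the local hypothesis applies. It serves as the
    compactness argument for Goursat's theorem, for boundedness, for maxima on discs and, with a
    degenerate rectangle, for segments. *)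
Lemma rect_cousin (P : R -> R -> R -> R -> Prop) a b c d : a <= b -> c <= d ->
  (forall a b c d, a <= b -> c <= d ->
    P a ((a + b) / 2) c ((c + d) / 2) -> P ((a + b) / 2) b c ((c + d) / 2) ->
    P a ((a + b) / 2) ((c + d) / 2) d -> P ((a + b) / 2) b ((c + d) / 2) d ->
    P a b c d) ->
  (forall z, inrect a b c d z -> exists2 e : R, 0 < e &
    forall a' b' c' d', a <= a' -> b' <= b -> c <= c' -> d' <= d ->
      inrect a' b' c' d' z -> b' - a' < e -> d' - c' < e -> P a' b' c' d') ->
  P a b c d.
Proof.
move=> ab cd P4 Ploc; apply: contrapT => nP.
pose T := (R * R * (R * R))%type.
(* [ok] marks a subrectangle on which the property fails; iterating the chosen bad quarter produces
   the nested sequence. *)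
pose ok (s : T) := [/\ a <= s.1.1 <= s.1.2, s.1.2 <= b, c <= s.2.1 <= s.2.2 &
  s.2.2 <= d] /\ ~ P s.1.1 s.1.2 s.2.1 s.2.2.
pose half (i j : R * R) := [/\ i.1 <= j.1, j.2 <= i.2 & j.2 - j.1 = (i.2 - i.1) / 2].
have step (s : T) : exists s', ok s -> [/\ ok s', half s.1 s'.1 & half s.2 s'.2].
  have [oks|?] := pselect (ok s); last by exists s.
  move: s oks => [[x1 x2] [y1 y2]] [[/= h1 h2 h3 h4] h5].
  have x12 : x1 <= x2 by lra. have y12 : y1 <= y2 by lra.
  apply: contrapT => /forallNP nex; apply: h5; apply: P4 => //;
  apply: contrapT => nQ.
  - apply: (nex ((x1, (x1 + x2) / 2), (y1, (y1 + y2) / 2))) => _.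
    by split; split => //=; try split => //=; lra.
  - apply: (nex (((x1 + x2) / 2, x2), (y1, (y1 + y2) / 2))) => _.
    by split; split => //=; try split => //=; lra.
  - apply: (nex ((x1, (x1 + x2) / 2), ((y1 + y2) / 2, y2))) => _.
    by split; split => //=; try split => //=; lra.
  - apply: (nex (((x1 + x2) / 2, x2), ((y1 + y2) / 2, y2))) => _.
    by split; split => //=; try split => //=; lra.
have [F hF] := choice step.
pose s n := iter n F ((a, b), (c, d)).
have oks n : ok (s n).
  elim: n => [|n IH]; last by have [] := hF _ IH.
  by split => //=; split => //=; rewrite ?lexx ?ab ?cd.
have hs n : half (s n).1 (s n.+1).1 /\ half (s n).2 (s n.+1).2.
  by have [] := hF _ (oks n).
have [x hx] : exists x, forall n, (s n).1.1 <= x <= (s n).1.2.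
  apply: nested_intervals => n; have [[? ? ?] _] := hs n => //.
  by have [[/andP[]]] := oks n.
have [y hy] : exists y, forall n, (s n).2.1 <= y <= (s n).2.2.
  apply: nested_intervals => n; have [_ [? ? ?]] := hs n => //.
  by have [[_ _ /andP[]]] := oks n.
have lx n : (s n).1.2 - (s n).1.1 = (b - a) / 2 ^+ n.
  elim: n => [|n IH]; first by rewrite expr0 divr1.
  by have [[_ _ ->] _] := hs n; rewrite IH exprS invfM; ring.
have ly n : (s n).2.2 - (s n).2.1 = (d - c) / 2 ^+ n.
  elim: n => [|n IH]; first by rewrite expr0 divr1.
  by have [_ [_ _ ->]] := hs n; rewrite IH exprS invfM; ring.
have zin : inrect a b c d (Complex x y).
  have := hx 0%N; have := hy 0%N; rewrite /= /inrect /= => -> ->; done.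
have [e e0 He] := Ploc _ zin.
have [n hn] : exists n, ((b - a) + (d - c)) / 2 ^+ n < e.
  pose N := Num.truncn (((b - a) + (d - c)) / e).
  exists N.+1; rewrite ltr_pdivrMr ?exprn_gt0// mulrC -ltr_pdivrMr//.
  apply: lt_le_trans (_ : N.+1%:R <= _).
    by rewrite truncnS_gt.
  by rewrite -natrX ler_nat ltnW// ltn_expl.
have p2 : 0 < (2 ^+ n : R)^-1 by rewrite invr_gt0 exprn_gt0.
have [[h1 h2 h3 h4] []] := oks n; apply: He.
- by case/andP: h1.
- by [].
- by case/andP: h3.
- by [].
- by rewrite /inrect /= hx hy.
- rewrite lx; apply: le_lt_trans hn; rewrite ler_pM2r//; lra.
- rewrite ly; apply: le_lt_trans hn; rewrite ler_pM2r//; lra.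
Qed.

Lemma cder_eps f z l : (forall e : R, 0 < e -> exists2 d : R, 0 < d &
    forall w, cmod (w - z) < d -> cmod (f w - f z - l * (w - z)) <= e * cmod (w - z)) ->
  cder f z l.
Proof.
move=> h; exists (fun w => if w == z then l else (f w - f z) / (w - z)), 1; split => //.
- move=> w _; case: eqP => [->|/eqP wz]; first by rewrite !subrr mulr0.
  by rewrite divfK// subr_eq0.
- by rewrite eqxx.
- move=> e e0; have [d d0 hd] := h _ (divr_gt0 e0 (ltr0n R 2)).
  exists d => // w wd; rewrite eqxx.
  case: eqP => [_|/eqP wz]; first by rewrite subrr cmod0.
  have wz0 : w - z != 0 by rewrite subr_eq0.
  have m0 : 0 < cmod (w - z) by rewrite cmod_gt0.
  have -> : (f w - f z) / (w - z) - l = (f w - f z - l * (w - z)) / (w - z).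
    by field.
  rewrite cmodM cmodV ltr_pdivrMr//; apply: le_lt_trans (hd _ wd) _.
  by rewrite ltr_pM2r//; lra.
Qed.

Lemma cder_epsE f z l : cder f z l -> forall e : R, 0 < e -> exists2 d : R, 0 < d &
  forall w, cmod (w - z) < d -> cmod (f w - f z - l * (w - z)) <= e * cmod (w - z).
Proof.
move=> [q [d [d0 hq <- cq]]] e e0; have [k k0 hk] := cq _ e0.
exists (Num.min d k); first by rewrite lt_min d0.
move=> w; rewrite lt_min => /andP[/hq -> /hk h].
by rewrite -mulrBl cmodM ler_wpM2r ?cmod_ge0// ltW.
Qed.

Lemma cder_quad f z l (K r : R) : 0 < r -> (forall h, cmod h < r ->
    cmod (f (z + h) - f z - l * h) <= K * cmod h ^+ 2) -> cder f z l.
Proof.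
move=> r0 H; apply: cder_eps => e e0.
have K1 : 0 < `|K| + 1 by have := normr_ge0 K; lra.
exists (Num.min r (e / (`|K| + 1))); first by rewrite lt_min r0 divr_gt0.
move=> w; rewrite lt_min => /andP[wr we].
have := H (w - z) wr; rewrite subrKC => /le_trans; apply.
rewrite expr2 mulrA; apply: ler_wpM2r; first exact: cmod_ge0.
move: we; rewrite ltr_pdivlMr// => we; have m0 := cmod_ge0 (w - z).
have := ler_norm K; nra.
Qed.

Definition cdiff_at f z := exists l, cder f z l.

Lemma cdiff_cont f z : cdiff_at f z -> ccont f z.
Proof. by move=> [l /cder_cont]. Qed.

Lemma bdry_inrect a b c d z : bdry a b c d z -> inrect a b c d z.
Proof. by case/andP. Qed.

Lemma inrect_sub a b c d a' b' c' d' z : a <= a' -> b' <= b -> c <= c' -> d' <= d ->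
  inrect a' b' c' d' z -> inrect a b c d z.
Proof. by rewrite /inrect => ? ? ? ? h; lra. Qed.

(** The integral is shown to be at most a small constant times the squared half-perimeter, a bound
    compatible with quartering and true locally by differentiability. *)
Lemma goursat f a b c d : a <= b -> c <= d ->
  (forall z, inrect a b c d z -> cdiff_at f z) -> rect f a b c d = 0.
Proof.
move=> ab cd df; apply/eqP; rewrite -cmod_eq0 eq_le cmod_ge0 andbT.
pose S := (b - a) + (d - c).
have S0 : 0 <= S by rewrite /S; lra.
apply/ler_addgt0Pl => e e0; rewrite addr0.
(* Quartering halves the half-perimeter, so the four quarter bounds add up exactly to the whole one.
   The [+ 1] in the denominator covers a rectangle reduced to a point. *)
pose P a' b' c' d' := a <= a' -> b' <= b -> c <= c' -> d' <= d ->
  cmod (rect f a' b' c' d') <= e / (S ^+ 2 + 1) * ((b' - a') + (d' - c')) ^+ 2.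
have k0 : 0 < e / (S ^+ 2 + 1) by rewrite divr_gt0// ltr_wpDl// sqr_ge0.
have PP : P a b c d.
  apply: rect_cousin => //.
    move=> x1 x2 y1 y2 x12 y12 H1 H2 H3 H4 l1 l2 l3 l4.
    pose m := (x1 + x2) / 2; pose k := (y1 + y2) / 2.
    have xm : x1 <= m <= x2 by rewrite /m; lra.
    have yk : y1 <= k <= y2 by rewrite /k; lra.
    have am : a <= m by lra.
    have mb : m <= b by lra.
    have ck : c <= k by lra.
    have kd : k <= d by lra.
    have cf z : inrect x1 x2 y1 y2 z -> ccont f z.
      by move=> zi; apply/cdiff_cont/df; exact: inrect_sub zi.
    rewrite (rect_split_v xm y12); last 2 first.
      by move=> z /bdry_inrect/cf.
      by move=> y yy; apply: cf; rewrite /inrect /= yy andbT.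
    rewrite (@rect_split_h _ _ _ _ _ k)//; last 3 first.
      by lra.
      by move=> z /bdry_inrect; rewrite /inrect => h; apply: cf; rewrite /inrect; lra.
      by move=> x xx; apply: cf; rewrite /inrect /= yk; lra.
    rewrite (@rect_split_h _ f m _ _ k)//; last 3 first.
      by lra.
      by move=> z /bdry_inrect; rewrite /inrect => h; apply: cf; rewrite /inrect; lra.
      by move=> x xx; apply: cf; rewrite /inrect /= yk; lra.
    have := H1 l1 mb l3 kd; have := H2 am l2 l3 kd; have := H3 l1 mb ck l4.
    have := H4 am l2 ck l4; rewrite -/m -/k.
    have -> : (m - x1 + (k - y1)) ^+ 2 = (x2 - x1 + (y2 - y1)) ^+ 2 / 4.
      by rewrite /m /k; field.
    have -> : (x2 - m + (k - y1)) ^+ 2 = (x2 - x1 + (y2 - y1)) ^+ 2 / 4.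
      by rewrite /m /k; field.
    have -> : (m - x1 + (y2 - k)) ^+ 2 = (x2 - x1 + (y2 - y1)) ^+ 2 / 4.
      by rewrite /m /k; field.
    have -> : (x2 - m + (y2 - k)) ^+ 2 = (x2 - x1 + (y2 - y1)) ^+ 2 / 4.
      by rewrite /m /k; field.
    set E := e / _; set Q := (_ ^+ 2).
    move=> {am mb ck kd l1 l2 l3 l4 x12 y12 xm yk H1 H2 H3 H4} B4 B3 B2 B1.
    have T1 := cmodD (rect f x1 m y1 k + rect f x1 m k y2)
                     (rect f m x2 y1 k + rect f m x2 k y2).
    have T2 := cmodD (rect f x1 m y1 k) (rect f x1 m k y2).
    have T3 := cmodD (rect f m x2 y1 k) (rect f m x2 k y2).
    lra.
  move=> z zi; have [l dl] := df z zi.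
  have [r r0 hr] := cder_epsE dl (divr_gt0 k0 (ltr0n R 4)).
  exists (r / 2); first by rewrite divr_gt0.
  move=> x1 x2 y1 y2 l1 l2 l3 l4 zi' dx dy _ _ _ _.
  have x12 : x1 <= x2 by move: zi'; rewrite /inrect; lra.
  have y12 : y1 <= y2 by move: zi'; rewrite /inrect; lra.
  have cf w : inrect x1 x2 y1 y2 w -> ccont f w.
    by move=> wi; apply/cdiff_cont/df; exact: inrect_sub wi.
  (* [A] is the first-order expansion of [f] at [z]. Its integral vanishes, so only the remainder is
     integrated: it is small compared with [s], on a boundary of length proportional to [s]. *)
  pose A w := (f z - l * z) + l * w.
  have cA w : ccont A w.
    by apply: ccontD; [exact: ccont_cst|apply: ccontM; [exact: ccont_cst|exact: ccont_id]].
  have -> : rect f x1 x2 y1 y2 = rect (fun w => f w + (-1) * A w) x1 x2 y1 y2.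
    rewrite rectD// ?rectZ//.
    - by rewrite rect_affine// mulr0 addr0.
    - by move=> w /bdry_inrect/cf.
    - by move=> w _; apply: ccontM => //; exact: ccont_cst.
  set s := (x2 - x1) + (y2 - y1).
  have s0 : 0 <= s by rewrite /s; lra.
  have -> : e / (S ^+ 2 + 1) * s ^+ 2 = 4 * (e / (S ^+ 2 + 1) / 4 * s) * s.
    by field; rewrite gt_eqF// ltr_wpDl// sqr_ge0.
  apply: rect_le => // [w /bdry_inrect wi|w /bdry_inrect wi].
    apply: ccontD; first exact: cf.
    by apply: ccontM => //; exact: ccont_cst.
  have ws : cmod (w - z) <= s.
    apply: le_trans (cmod_le_ReIm _) _.
    have -> : Re (w - z) = Re w - Re z by case: (w) (z) => ? ? [].
    have -> : Im (w - z) = Im w - Im z by case: (w) (z) => ? ? [].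
    move: wi zi'; rewrite /inrect /s => wi zi'.
    by apply: lerD; rewrite ler_norml; lra.
  have -> : f w + -1 * A w = f w - f z - l * (w - z) by rewrite /A; ring.
  apply: le_trans (hr _ _) _; first by apply: le_lt_trans ws _; rewrite /s; lra.
  by apply: ler_wpM2l => //; lra.
have := PP (lexx _) (lexx _) (lexx _) (lexx _); rewrite -/S => /le_trans; apply.
rewrite -mulrA ler_piMr ?ltW// mulrC ltr_pdivrMr ?mul1r; last first.
  by rewrite ltr_wpDl// sqr_ge0.
by rewrite ltrDl.
Qed.

End Goursat.

(** * Cauchy's formula on squares *)

Section CauchyFormula.
Variable R : realType.
Local Notation C := R[i].
Local Notation mu := (@lebesgue_measure R).
Implicit Types (a b c d t s : R) (f g : C -> C) (p q z w l : C).

Definition sq f p t := rect f (Re p - t) (Re p + t) (Im p - t) (Im p + t).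
Definition insq p t z := inrect (Re p - t) (Re p + t) (Im p - t) (Im p + t) z.
Definition bdsq p t z := bdry (Re p - t) (Re p + t) (Im p - t) (Im p + t) z.

Lemma eq_le_self (x y : R) : x = y -> x <= y. Proof. by move=> ->. Qed.

Lemma cReB z w : Re (z - w) = Re z - Re w. Proof. by case: z w => ? ? []. Qed.
Lemma cImB z w : Im (z - w) = Im z - Im w. Proof. by case: z w => ? ? []. Qed.

Lemma bdsq_insq p t z : bdsq p t z -> insq p t z.
Proof. by case/andP. Qed.

Lemma bdsq_ge p t z : 0 < t -> bdsq p t z -> t <= cmod (z - p).
Proof.
move=> t0 /andP[_ /or4P[] /eqP h];
  [apply: le_trans (normr_Re_le _)|apply: le_trans (normr_Re_le _)
  |apply: le_trans (normr_Im_le _)|apply: le_trans (normr_Im_le _)];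
  rewrite ?cReB ?cImB h; rewrite addrAC subrr add0r ?normrN ger0_norm//; exact: ltW.
Qed.

Lemma insq_le p t z : insq p t z -> cmod (z - p) <= 2 * t.
Proof.
move=> zi; apply: le_trans (cmod_le_ReIm _) _; rewrite cReB cImB.
have -> : 2 * t = t + t by ring.
by move: zi; rewrite /insq /inrect => zi; apply: lerD; rewrite ler_norml; lra.
Qed.

Lemma insq_near p t z : cmod (z - p) <= t -> insq p t z.
Proof.
move=> h; have := normr_Re_le (z - p); have := normr_Im_le (z - p).
rewrite cReB cImB => h1 h2; have := le_trans h1 h; have := le_trans h2 h.
by rewrite !ler_norml /insq /inrect; lra.
Qed.

(** Two vertical and two horizontal cuts along the sides of the small square give five rectangles;
    the four outer ones avoid [p] and contribute nothing by Goursat's theorem. *)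
Lemma rect_cut g a b c d p t : 0 < t -> a <= Re p - t -> Re p + t <= b ->
  c <= Im p - t -> Im p + t <= d ->
  (forall z, inrect a b c d z -> z != p -> cdiff_at g z) ->
  rect g a b c d = sq g p t.
Proof.
move=> t0 ha hb hc hd dg.
have dg' z : inrect a b c d z -> (Re z != Re p) || (Im z != Im p) -> cdiff_at g z.
  move=> zi /orP zp; apply: dg => //; apply: contraPneq zp => ->.
  by rewrite !eqxx => -[].
have cg z zi zp := cdiff_cont (dg' z zi zp).
rewrite (@rect_split_v _ g _ (Re p - t))//; last 4 first.
- lra.
- lra.
- move=> z /andP[zi /or4P[]/eqP h]; apply: cg => //; rewrite ?h; apply/orP;
  (try by left; rewrite lt_eqF//; lra); (try by left; rewrite gt_eqF//; lra);
  (try by right; rewrite lt_eqF//; lra); by right; rewrite gt_eqF//; lra.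
- by move=> y yy; apply: cg; [rewrite /inrect /=; lra|rewrite /= lt_eqF//; lra].
rewrite goursat ?add0r; [|lra|lra|]; last first.
  move=> z zi; apply: dg'; first by move: zi; rewrite /inrect; lra.
  by rewrite lt_eqF//; move: zi; rewrite /inrect; lra.
rewrite (@rect_split_v _ g _ (Re p + t))//; last 4 first.
- lra.
- lra.
- move=> z /andP[zi /or4P[]/eqP h]; (apply: cg; first by move: zi; rewrite /inrect; lra);
  rewrite ?h; apply/orP;
  (try by left; rewrite lt_eqF//; lra); (try by left; rewrite gt_eqF//; lra);
  (try by right; rewrite lt_eqF//; lra); by right; rewrite gt_eqF//; lra.
- by move=> y yy; apply: cg; [rewrite /inrect /=; lra|rewrite /= gt_eqF//; lra].
rewrite [X in _ + X]goursat ?addr0; [|lra|lra|]; last first.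
  move=> z zi; apply: dg'; first by move: zi; rewrite /inrect; lra.
  by rewrite gt_eqF//; move: zi; rewrite /inrect; lra.
rewrite (@rect_split_h _ g _ _ _ (Im p - t))//; last 4 first.
- lra.
- lra.
- move=> z /andP[zi /or4P[]/eqP h]; (apply: cg; first by move: zi; rewrite /inrect; lra);
  rewrite ?h; apply/orP;
  (try by left; rewrite lt_eqF//; lra); (try by left; rewrite gt_eqF//; lra);
  (try by right; rewrite lt_eqF//; lra); by right; rewrite gt_eqF//; lra.
- by move=> y yy; apply: cg; [rewrite /inrect /=; lra|rewrite /= orbC lt_eqF//; lra].
rewrite goursat ?add0r; [|lra|lra|]; last first.
  move=> z zi; apply: dg'; first by move: zi; rewrite /inrect; lra.
  by rewrite orbC lt_eqF//; move: zi; rewrite /inrect; lra.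
rewrite (@rect_split_h _ g _ _ _ (Im p + t))//; last 4 first.
- lra.
- lra.
- move=> z /andP[zi /or4P[]/eqP h]; (apply: cg; first by move: zi; rewrite /inrect; lra);
  rewrite ?h; apply/orP;
  (try by left; rewrite lt_eqF//; lra); (try by left; rewrite gt_eqF//; lra);
  (try by right; rewrite lt_eqF//; lra); by right; rewrite gt_eqF//; lra.
- by move=> y yy; apply: cg; [rewrite /inrect /=; lra|rewrite /= orbC gt_eqF//; lra].
rewrite [X in _ + X]goursat ?addr0; [by []|lra|lra|].
move=> z zi; apply: dg'; first by move: zi; rewrite /inrect; lra.
by rewrite orbC gt_eqF//; move: zi; rewrite /inrect; lra.
Qed.

Lemma cder_sub p z : cder (fun w => w - p) z 1.
Proof. by have := cderD (cder_id z) (cder_cst (- p) z); rewrite addr0. Qed.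

Lemma cdiffM f g z : cdiff_at f z -> cdiff_at g z -> cdiff_at (fun w => f w * g w) z.
Proof. by move=> [l1 h1] [l2 h2]; have := cderM h1 h2; eexists; eauto. Qed.

Lemma cdiff_inv_sub p z : z != p -> cdiff_at (fun w => (w - p)^-1) z.
Proof.
move=> zp; eexists; apply: cderV (cder_sub p z) _.
by rewrite subr_eq0.
Qed.

Lemma sq_le f p t (M : R) : 0 < t -> (forall z, bdsq p t z -> ccont f z) ->
  (forall z, bdsq p t z -> cmod (f z) <= M) -> cmod (sq f p t) <= 16 * M * t.
Proof.
move=> t0 cf fM; apply: le_trans (rect_le _ _ cf fM) _; [lra|lra|].
by apply: eq_le_self; ring.
Qed.

Lemma sqD f g p t : 0 < t -> (forall z, bdsq p t z -> ccont f z) ->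
  (forall z, bdsq p t z -> ccont g z) ->
  sq (fun z => f z + g z) p t = sq f p t + sq g p t.
Proof. by move=> t0 cf cg; apply: rectD => //; lra. Qed.

Lemma sqZ k f p t : 0 < t -> (forall z, bdsq p t z -> ccont f z) ->
  sq (fun z => k * f z) p t = k * sq f p t.
Proof. by move=> t0 cf; apply: rectZ => //; lra. Qed.

Lemma sq_eq f g p t : 0 < t -> (forall z, bdsq p t z -> f z = g z) ->
  sq f p t = sq g p t.
Proof. by move=> t0 fg; apply: rect_eq => //; lra. Qed.

Lemma sq_cut g p t q s : 0 < s -> cmod (q - p) <= t - s ->
  (forall z, insq p t z -> z != q -> cdiff_at g z) -> sq g p t = sq g q s.
Proof.
move=> s0 qp dg; apply: rect_cut => //;
  have := normr_Re_le (q - p); have := normr_Im_le (q - p);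
  rewrite cReB cImB => h1 h2; have := le_trans h1 qp; have := le_trans h2 qp;
  rewrite !ler_norml; lra.
Qed.

(** The difference quotient stays bounded near [q], while the contour may be shrunk to an
    arbitrarily small square around [q]. *)
Lemma cauchy_diff f p t q : cmod (q - p) < t ->
  (forall z, insq p t z -> cdiff_at f z) ->
  sq (fun z => (f z - f q) * (z - q)^-1) p t = 0.
Proof.
move=> qp df; set g := fun z => _.
have dg z : insq p t z -> z != q -> cdiff_at g z.
  move=> zi zq; apply: cdiffM; last exact: cdiff_inv_sub.
  by have [l dl] := df z zi; exists (l + 0); apply: cderD dl (cder_cst _ _).
have qi : insq p t q by apply/insq_near/ltW.
have [l dl] := df _ qi.
have [r r0 hr] := cder_epsE dl ltr01.
pose M := cmod l + 1.
have M0 : 0 < M by rewrite /M; have := cmod_ge0 l; lra.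
apply/eqP; rewrite -cmod_eq0 eq_le cmod_ge0 andbT.
apply/ler_addgt0Pl => e e0; rewrite addr0.
(* The three bounds keep the square around [q] inside the given one, keep its points (at distance at
   most 2 s) where the quotient is below [M], and make 16 M s at most [e]. *)
pose s := Num.min (t - cmod (q - p)) (Num.min (r / 4) (e / (16 * M))).
have s0 : 0 < s by rewrite !lt_min subr_gt0 qp !divr_gt0//; lra.
have s1 : s <= t - cmod (q - p) by rewrite /s ge_min lexx.
have s2 : s <= r / 4 by rewrite /s !ge_min lexx !orbT.
have s3 : s <= e / (16 * M) by rewrite /s !ge_min lexx !orbT.
rewrite (@sq_cut g p t q s)//; last lra.
have sqin z : insq q s z -> insq p t z.
  move=> zi; have := normr_Re_le (q - p); have := normr_Im_le (q - p).
  have qs : cmod (q - p) <= t - s by lra.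
  rewrite cReB cImB => h1 h2; have := le_trans h1 qs; have := le_trans h2 qs.
  by rewrite !ler_norml; move: zi; rewrite /insq /inrect; lra.
have nz z : bdsq q s z -> z != q.
  move=> /(bdsq_ge s0) h; apply: contraTneq h => ->.
  by rewrite subrr cmod0 -ltNge.
apply: le_trans (@sq_le g q s M s0 _ _) _.
- by move=> z zi; apply/cdiff_cont/dg; [exact/sqin/bdsq_insq|exact: nz].
- move=> z zi; have zq : cmod (z - q) < r.
    by apply: le_lt_trans (insq_le (bdsq_insq zi)) _; lra.
  have z0 : 0 < cmod (z - q) by rewrite cmod_gt0 subr_eq0 nz.
  rewrite /g cmodM cmodV ler_pdivrMr//.
  have := hr _ zq; have := cmodBD (f z - f q) (- (l * (z - q))).
  by rewrite cmodN cmodM /M; lra.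
- by rewrite mulrC -ler_pdivlMr// mulr_gt0.
Qed.

(* Plays the role of 2 pi i; only a lower bound on its modulus is ever needed. *)
Definition kerI p t : C := sq (fun z => (z - p)^-1) p t.

(** Both contours can be enlarged to a square of half-side [T], on which the two kernels differ by
    O(1 / T^2) while the perimeter is O(T). *)
Lemma sq_invI p t q : cmod (q - p) < t -> sq (fun z => (z - q)^-1) p t = kerI p t.
Proof.
move=> qp; have t0 : 0 < t by apply: le_lt_trans (cmod_ge0 _) qp.
apply/eqP; rewrite -subr_eq0 -cmod_eq0 eq_le cmod_ge0 andbT.
apply/ler_addgt0Pl => e e0; rewrite addr0.
have m0 := cmod_ge0 (q - p).
(* With this choice 16 |q - p| / (T - |q - p|), the final bound on the difference, is at most
   [e]. *)
pose T := t + cmod (q - p) + 16 * cmod (q - p) / e.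
have h0 : 0 <= 16 * cmod (q - p) / e by apply: divr_ge0; [exact: mulr_ge0|exact: ltW].
have tT : t <= T by rewrite /T; lra.
have T0 : 0 < T by lra.
pose s := (t - cmod (q - p)) / 2.
have s0 : 0 < s by rewrite /s; lra.
have enl r : cmod (r - p) <= t - s ->
    sq (fun z => (z - r)^-1) p t = sq (fun z => (z - r)^-1) p T.
  move=> rs; rewrite (@sq_cut _ p t r s)//; last by move=> *; exact: cdiff_inv_sub.
  rewrite (@sq_cut _ p T r s)//; first by lra.
  by move=> *; exact: cdiff_inv_sub.
rewrite /kerI !enl; last 2 first.
- by rewrite subrr cmod0 /s; lra.
- by rewrite /s; lra.
have cq z : bdsq p T z -> z != q.
  move=> /(bdsq_ge T0) h; apply: contraTneq h => ->.
  by rewrite -ltNge; lra.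
have cp z : bdsq p T z -> z != p.
  move=> /(bdsq_ge T0) h; apply: contraTneq h => ->.
  by rewrite subrr cmod0 -ltNge.
have -> : sq (fun z => (z - q)^-1) p T - sq (fun z => (z - p)^-1) p T =
  sq (fun z => (z - q)^-1 + (-1) * (z - p)^-1) p T.
  rewrite sqD// ?sqZ ?mulN1r//.
  - by move=> z /cp zp; exact/cdiff_cont/cdiff_inv_sub.
  - by move=> z /cq zq; exact/cdiff_cont/cdiff_inv_sub.
  - move=> z /cp zp; apply: ccontM; first exact: ccont_cst.
    exact/cdiff_cont/cdiff_inv_sub.
apply: le_trans (@sq_le _ p T (cmod (q - p) / (T * (T - cmod (q - p)))) T0 _ _) _.
- move=> z zb; apply: ccontD; first exact/cdiff_cont/cdiff_inv_sub/cq.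
  by apply: ccontM; [exact: ccont_cst|exact/cdiff_cont/cdiff_inv_sub/cp].
- move=> z zb; have zq := cq _ zb; have zp := cp _ zb.
  have -> : (z - q)^-1 + -1 * (z - p)^-1 = (q - p) * ((z - p)^-1 * (z - q)^-1).
    by field; rewrite !subr_eq0 zp zq.
  rewrite !cmodM !cmodV; apply: ler_wpM2l => //; rewrite -invfM.
  have z1 := bdsq_ge T0 zb.
  have z2 : T - cmod (q - p) <= cmod (z - q).
    have := cmodBD (z - p) (- (q - p)); rewrite cmodN.
    have -> : z - p - (q - p) = z - q by ring.
    lra.
  have T1 : 0 < T - cmod (q - p) by rewrite /T; lra.
  rewrite lef_pV2 ?posrE ?mulr_gt0//; [|lra|lra].
  by apply: ler_pM => //; lra.
- have T1 : 0 < T - cmod (q - p) by rewrite /T; lra.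
  have -> : 16 * (cmod (q - p) / (T * (T - cmod (q - p)))) * T =
    16 * cmod (q - p) / (T - cmod (q - p)).
    by field; rewrite !gt_eqF.
  rewrite ler_pdivrMr// [e * _]mulrC -ler_pdivrMr//; rewrite /T; lra.
Qed.

Lemma cauchy_formula f p t q : cmod (q - p) < t ->
  (forall z, insq p t z -> cdiff_at f z) ->
  sq (fun z => f z * (z - q)^-1) p t = f q * kerI p t.
Proof.
move=> qp df; have t0 : 0 < t by apply: le_lt_trans (cmod_ge0 _) qp.
have nq z : bdsq p t z -> z != q.
  move=> /(bdsq_ge t0) h; apply: contraTneq h => ->.
  by rewrite -ltNge.
have ci z : bdsq p t z -> ccont (fun z => (z - q)^-1) z.
  by move=> /nq zq; exact/cdiff_cont/cdiff_inv_sub.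
have cf z : bdsq p t z -> ccont f z by move=> /bdsq_insq/df/cdiff_cont.
rewrite -(sq_invI qp) -sqZ//.
rewrite (@sq_eq _ (fun z => (f z - f q) * (z - q)^-1 + f q * (z - q)^-1))//; last first.
  by move=> z _; ring.
rewrite sqD//.
- by rewrite cauchy_diff// add0r.
- move=> z zb; apply: ccontM; last exact: ci.
  by apply: ccontD; [exact: cf|exact: ccont_cst].
- by move=> z zb; apply: ccontM; [exact: ccont_cst|exact: ci].
Qed.

(** The imaginary part is a sum of two integrals of 2 t / (x^2 + t^2) over [-t, t]. There x^2 + t^2
    <= 2 t^2, so each integrand is at least 1 / t and each integral at least 2. *)
Lemma kerI_ge p t : 0 < t -> 4 <= cmod (kerI p t).
Proof.
move=> t0.
have ci z : bdsq p t z -> ccont (fun z => (z - p)^-1) z.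
  move=> zb; apply/cdiff_cont/cdiff_inv_sub.
  have := bdsq_ge t0 zb; apply: contraTneq => ->.
  by rewrite subrr cmod0 -ltNge.
apply: le_trans (normr_Im_le _); apply: le_trans (ler_norm _).
rewrite /kerI /sq /rect /cint.
have X1 : Re p - t <= Re p + t by lra.
have Y1 : Im p - t <= Im p + t by lra.
have [f1 f2] := cont_bdry_h Y1 ci; have [f3 f4] := cont_bdry_v X1 ci.
have len (x : R) : fine (mu `[x - t, x + t]%classic) = 2 * t.
  rewrite lebesgue_measure_itv /= lte_fin ifT /=; first by ring.
  by lra.
rewrite /GRing.mul /GRing.add /= mul0r mul1r add0r.
have -> : 4 = 2 + 2 :> R by ring.
have two (x : R) : \int[mu]_(y in `[x - t, x + t]) t^-1 = 2.
  by rewrite Rintegral_cst// len; field; rewrite gt_eqF.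
have key (x : R) (A B : R) : - t <= x <= t -> A = x -> B = t -> t^-1 <= 2 * B / (A ^+ 2 + B ^+ 2).
  move=> xt -> ->; have h : 0 < x ^+ 2 + t ^+ 2 by rewrite ltr_wpDl ?sqr_ge0// exprn_gt0.
  rewrite ler_pdivlMr// mulrC ler_pdivrMr//; nra.
have cc (x : R) : mu.-integrable `[x - t, x + t] (EFin \o fun=> t^-1).
  by apply: cont_itv_integrable => s _; exact: cst_continuous.
apply: lerD.
- rewrite -(two (Re p)); apply: le_Rintegral => //.
    exact: pcont_on_Im (pcont_onB f1 f2).
  move=> x /=; rewrite in_itv /= => xx.
  case: p ci f1 f2 f3 f4 X1 Y1 xx => p1 p2 /= _ _ _ _ _ _ _ xx.
  apply: le_trans (key (x - p1) (x - p1) t _ erefl erefl) _; first by lra.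
  have -> : p2 - t - p2 = - t by ring.
  have -> : p2 + t - p2 = t by ring.
  apply: eq_le_self; rewrite sqrrN; field.
  have h : 0 < (x - p1) ^+ 2 + t ^+ 2 by rewrite ltr_wpDl ?sqr_ge0// exprn_gt0.
  by rewrite gt_eqF.
- rewrite -(two (Im p)); apply: le_Rintegral => //.
    exact: pcont_on_Re (pcont_onB f3 f4).
  move=> x /=; rewrite in_itv /= => xx.
  case: p ci f1 f2 f3 f4 X1 Y1 xx => p1 p2 /= _ _ _ _ _ _ _ xx.
  apply: le_trans (key (x - p2) (x - p2) t _ erefl erefl) _; first by lra.
  have -> : p1 - t - p1 = - t by ring.
  have -> : p1 + t - p1 = t by ring.
  apply: eq_le_self; rewrite sqrrN; field.
  have h : 0 < (x - p2) ^+ 2 + t ^+ 2 by rewrite ltr_wpDl ?sqr_ge0// exprn_gt0.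
  by rewrite [X in X != 0]addrC gt_eqF// addrC.
Qed.

End CauchyFormula.

(** * Derivatives as contour integrals, Cauchy's estimate, second-order expansion *)

Section Taylor.
Variable R : realType.
Local Notation C := R[i].
Implicit Types (a b c d t s M : R) (f g : C -> C) (p q z w l h : C).

Lemma bounded_inrect f a b c d : a <= b -> c <= d ->
  (forall z, inrect a b c d z -> ccont f z) ->
  exists M, forall z, inrect a b c d z -> cmod (f z) <= M.
Proof.
move=> ab cd cf; apply: (@rect_cousin _ (fun a b c d =>
  exists M, forall z, inrect a b c d z -> cmod (f z) <= M)) => //.
  move=> {cd ab cf}a {}b {}c {}d ab cd [M1 h1] [M2 h2] [M3 h3] [M4 h4].
  exists (Num.max (Num.max M1 M2) (Num.max M3 M4)) => z; rewrite /inrect.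
  move=> /andP[/andP[z1 z2] /andP[z3 z4]]; rewrite !le_max.
  have [zx|zx] := leP (Re z) ((a + b) / 2); have [zy|zy] := leP (Im z) ((c + d) / 2).
  - by rewrite h1 ?orbT// /inrect z1 zx z3 zy.
  - by rewrite h3 ?orbT// /inrect z1 zx z4 ltW.
  - by rewrite h2 ?orbT// /inrect z3 zy z2 ltW.
  - by rewrite h4 ?orbT// /inrect z2 z4 !ltW.
move=> z /cf /(_ 1 ltr01)[e e0 he].
exists (e / 2); first by rewrite divr_gt0.
move=> a' b' c' d' _ _ _ _ zi d1 d2; exists (cmod (f z) + 1) => w wi.
have wz : cmod (w - z) < e.
  apply: le_lt_trans (cmod_le_ReIm _) _.
  rewrite cReB cImB.
  have -> : e = e / 2 + e / 2 by field.
  by move: wi zi; rewrite /inrect => wi zi; apply: ltrD; rewrite ltr_norml; lra.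
have := he w wz; have := cmodD (f w - f z) (f z); rewrite subrK; lra.
Qed.

Lemma bounded_insq f p t : 0 < t -> (forall z, insq p t z -> ccont f z) ->
  exists2 M, 0 < M & forall z, insq p t z -> cmod (f z) <= M.
Proof.
move=> t0 cf; have [||M hM] := @bounded_inrect f (Re p - t) (Re p + t) (Im p - t) (Im p + t) _ _ cf.
- lra.
- lra.
exists (`|M| + 1); first by have := normr_ge0 M; lra.
by move=> z /hM /le_trans; apply; have := ler_norm M; lra.
Qed.

Lemma ccontZ g (y : C) z : ccont g z -> ccont (fun z => y * g z) z.
Proof. exact: ccontM (ccont_cst y z). Qed.

Lemma ccont_ker f q k z : ccont f z -> z != q ->
  ccont (fun w => f w * ((w - q) ^+ k)^-1) z.
Proof.
move=> cf zq; apply: ccontM => //; apply: ccontV; last first.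
  by rewrite expf_neq0// subr_eq0.
by apply: ccontX; exact: cder_cont (cder_sub q z).
Qed.

Section Square.
Variables (f : C -> C) (p : C) (t : R).
Hypothesis t0 : 0 < t.
Hypothesis df : forall z, insq p t z -> cdiff_at f z.

Let cf z : bdsq p t z -> ccont f z.
Proof. by move=> /bdsq_insq/df/cdiff_cont. Qed.

Let K := kerI p t.

Let K4 : 4 <= cmod K. Proof. exact: kerI_ge. Qed.

Let K0 : K != 0. Proof. by rewrite -cmod_gt0; exact: lt_le_trans K4. Qed.

Let far q z : bdsq p t z -> t - cmod (q - p) <= cmod (z - q).
Proof.
move=> /(bdsq_ge t0) h; have := cmodBD (z - p) (- (q - p)); rewrite cmodN.
have -> : z - p - (q - p) = z - q by ring.
lra.
Qed.

Let neq q z : cmod (q - p) < t -> bdsq p t z -> z != q.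
Proof.
move=> qp /(far q) h; apply: contraTneq h => ->.
by rewrite subrr cmod0 -ltNge; lra.
Qed.

(** Cauchy's integral for the derivative, with [K] in the place of 2 pi i. *)
Definition dker q := sq (fun z => f z * ((z - q) ^+ 2)^-1) p t / K.

Lemma cder_dker q : cmod (q - p) < t -> cder f q (dker q).
Proof.
move=> qp; pose s := t - cmod (q - p).
have s0 : 0 < s by rewrite /s; lra.
have [M M0 hM] := bounded_insq t0 (fun z zi => cdiff_cont (df zi)).
apply: (@cder_quad _ f q _ (8 * M * t / s ^+ 3) (s / 2)); first lra.
move=> h hs.
have qhp : cmod (q + h - p) < t.
  have := cmodD (q - p) h; have -> : q - p + h = q + h - p by ring.
  by rewrite /s in hs; lra.
(* With u = z - q, this integrates 1/(u - h) - 1/u - h/u^2 = h^2 / (u^2 (u - h)) against [f]; the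
   factor h^2 is the quadratic remainder. *)
have E : (f (q + h) - f q - dker q * h) * K =
    h ^+ 2 * sq (fun z => f z * ((z - q) ^+ 2)^-1 * (z - (q + h))^-1) p t.
  rewrite /dker !mulrBl (mulrAC _ h K) divfK//.
  rewrite -(cauchy_formula qhp df) -(cauchy_formula qp df).
  pose k2 z := f z * ((z - q) ^+ 2)^-1; pose k3 z := k2 z * (z - (q + h))^-1.
  rewrite -/k2 -/k3.
  rewrite (@sq_eq _ _ (fun z => f z * (z - q)^-1 + (h * k2 z + h ^+ 2 * k3 z)))//; last first.
    move=> z zb; rewrite /k3 /k2; field.
    by rewrite !subr_eq0 !neq.
  have c2 z : bdsq p t z -> ccont k2 z.
    by move=> zb; apply: ccont_ker; [exact: cf|exact: neq].
  have c3 z : bdsq p t z -> ccont k3 z.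
    move=> zb; apply: ccontM; first exact: c2.
    exact/cdiff_cont/cdiff_inv_sub/neq.
  rewrite sqD//; last 2 first.
  - move=> z zb; apply: ccontM; first exact: cf.
    exact/cdiff_cont/cdiff_inv_sub/neq.
  - by move=> z zb; apply: ccontD; apply: ccontZ; [exact: c2|exact: c3].
  rewrite sqD//; last 2 first.
  - by move=> z zb; apply: ccontZ; exact: c2.
  - by move=> z zb; apply: ccontZ; exact: c3.
  by rewrite !sqZ//; ring.
have B : cmod (sq (fun z => f z * ((z - q) ^+ 2)^-1 * (z - (q + h))^-1) p t) <=
    16 * (M * (s ^+ 2)^-1 * (s / 2)^-1) * t.
  apply: sq_le => //.
    move=> z zb; apply: ccontM; first by apply: ccont_ker; [exact: cf|exact: neq].
    exact/cdiff_cont/cdiff_inv_sub/neq.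
  move=> z zb; rewrite !cmodM !cmodV cmodX.
  have z1 : s <= cmod (z - q) by exact: far.
  have z2 : s / 2 <= cmod (z - (q + h)).
    have := cmodBD (z - q) (- h); rewrite cmodN.
    have -> : z - q - h = z - (q + h) by ring.
    lra.
  apply: ler_pM => //; rewrite ?mulr_ge0 ?invr_ge0 ?exprn_ge0 ?cmod_ge0//.
    apply: ler_pM => //; rewrite ?invr_ge0 ?exprn_ge0 ?cmod_ge0//.
      exact/hM/bdsq_insq.
    rewrite lef_pV2 ?posrE ?exprn_gt0//; last exact: lt_le_trans z1.
    by rewrite lerXn2r// ?nnegrE ?cmod_ge0// ltW.
  by rewrite lef_pV2 ?posrE//; [lra|lra].
have : cmod (f (q + h) - f q - dker q * h) * 4 <=
    cmod h ^+ 2 * (16 * (M * (s ^+ 2)^-1 * (s / 2)^-1) * t).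
  apply: le_trans (_ : cmod (f (q + h) - f q - dker q * h) * cmod K <= _).
    by apply: ler_wpM2l => //; exact: cmod_ge0.
  rewrite -cmodM E cmodM cmodX; apply: ler_wpM2l => //.
  by rewrite exprn_ge0// cmod_ge0.
have -> : cmod h ^+ 2 * (16 * (M * (s ^+ 2)^-1 * (s / 2)^-1) * t) =
  (8 * M * t / s ^+ 3 * cmod h ^+ 2) * 4 by field; rewrite gt_eqF.
by rewrite ler_pM2r.
Qed.

(** Cauchy's estimate; the 4 is the quotient of the constant 16 in [sq_le] by the lower bound 4 for
    the modulus of [K]. *)
Lemma dker_le M : (forall z, bdsq p t z -> cmod (f z) <= M) ->
  cmod (dker p) <= 4 * M / t.
Proof.
move=> fM; have t0' : 0 < t := t0; rewrite /dker cmodM cmodV ler_pdivrMr; last exact: lt_le_trans K4.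
have pp : cmod (p - p) < t by rewrite subrr cmod0.
have B : cmod (sq (fun z => f z * ((z - p) ^+ 2)^-1) p t) <=
    16 * (M * (t ^+ 2)^-1) * t.
  apply: sq_le => //.
    by move=> z zb; apply: ccont_ker; [exact: cf|exact: neq].
  move=> z zb; rewrite cmodM cmodV cmodX.
  have z1 := bdsq_ge t0 zb.
  apply: ler_pM => //; rewrite ?invr_ge0 ?exprn_ge0 ?cmod_ge0//; first exact: fM.
  rewrite lef_pV2 ?posrE ?exprn_gt0//; last exact: lt_le_trans z1.
  by rewrite lerXn2r// ?nnegrE ?cmod_ge0// ltW.
apply: le_trans B _.
have -> : 16 * (M * (t ^+ 2)^-1) * t = 4 * M / t * 4 by field; rewrite gt_eqF.
apply: ler_wpM2l => //.
have zb : bdsq p t (Complex (Re p + t) (Im p)).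
  apply/andP; split; last by rewrite /= eqxx /= orbT.
  by rewrite /inrect /=; apply/andP; split; apply/andP; split; lra.
have M0 : 0 <= M by exact: le_trans (cmod_ge0 _) (fM _ zb).
by rewrite divr_ge0 ?mulr_ge0// ltW.
Qed.

Lemma cdiff_dker : cdiff_at dker p.
Proof.
have t0' : 0 < t := t0.
have [M M0 hM] := bounded_insq t0 (fun z zi => cdiff_cont (df zi)).
pose k j z := f z * ((z - p) ^+ j)^-1.
exists (2 * sq (k 3%N) p t / K).
apply: (@cder_quad _ _ p _ (4 * (M * (8 * t) * (t ^+ 3)^-1 * ((t / 2) ^+ 2)^-1) * t)
  (t / 2)); first lra.
move=> h ht.
have pp : cmod (p - p) < t by rewrite subrr cmod0.
have php : cmod (p + h - p) < t by rewrite addrAC subrr add0r; lra.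
(* With u = z - p, this is the remainder in 1/(u - h)^2 = 1/u^2 + 2 h/u^3 + h^2 (3 u - 2 h) / (u^3
   (u - h)^2). *)
pose r z := f z * (3 * (z - p) - 2 * h) * ((z - p) ^+ 3)^-1 * ((z - (p + h)) ^+ 2)^-1.
have ck j z : bdsq p t z -> ccont (k j) z.
  by move=> zb; apply: ccont_ker; [exact: cf|exact: neq].
have cr z : bdsq p t z -> ccont r z.
  move=> zb; apply: ccont_ker; last exact: neq.
  apply: ccont_ker; last exact: neq.
  apply: ccontM; first exact: cf.
  apply: ccontD; last exact: ccont_cst.
  by apply: ccontM; [exact: ccont_cst|exact: cder_cont (cder_sub p z)].
have E : (dker (p + h) - dker p - 2 * sq (k 3%N) p t / K * h) * K = h ^+ 2 * sq r p t.
  rewrite /dker !mulrBl !divfK// (mulrAC _ h K) divfK//.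
  rewrite (@sq_eq _ _ (fun z => k 2%N z + ((2 * h) * k 3%N z + h ^+ 2 * r z)))//; last first.
    move=> z zb; rewrite /k /r; field.
    by rewrite !subr_eq0 !neq.
  rewrite sqD//; [|exact: ck|]; last first.
    by move=> z zb; apply: ccontD; apply: ccontZ; [exact: ck|exact: cr].
  rewrite sqD//; last 2 first.
  - by move=> z zb; apply: ccontZ; exact: ck.
  - by move=> z zb; apply: ccontZ; exact: cr.
  rewrite sqZ//; last exact: ck.
  rewrite sqZ//; rewrite -/(k 2%N); set X := sq (k 3%N) p t; set Y := sq r p t.
  by set Z := sq (k 2%N) p t; ring.
have B : cmod (sq r p t) <= 16 * (M * (8 * t) * (t ^+ 3)^-1 * ((t / 2) ^+ 2)^-1) * t.
  apply: sq_le => // z zb; rewrite !cmodM !cmodV !cmodX.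
  have z1 := bdsq_ge t0 zb.
  have z2 : t / 2 <= cmod (z - (p + h)).
    have := cmodBD (z - p) (- h); rewrite cmodN.
    have -> : z - p - h = z - (p + h) by ring.
    lra.
  have z3 := insq_le (bdsq_insq zb).
  apply: ler_pM => //; rewrite ?mulr_ge0 ?invr_ge0 ?exprn_ge0 ?cmod_ge0//.
    apply: ler_pM => //; rewrite ?mulr_ge0 ?invr_ge0 ?exprn_ge0 ?cmod_ge0//.
      apply: ler_pM => //; rewrite ?cmod_ge0//; first exact/hM/bdsq_insq.
      apply: le_trans (cmodD _ _) _; rewrite cmodN !cmodM.
      by rewrite !cmod_nat; lra.
    rewrite lef_pV2 ?posrE ?exprn_gt0//; last exact: lt_le_trans z1.
    by rewrite lerXn2r// ?nnegrE ?cmod_ge0// ltW.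
  rewrite lef_pV2 ?posrE ?exprn_gt0//; [|lra|lra].
  by rewrite lerXn2r ?nnegrE ?cmod_ge0//; lra.
set D := dker _ - _ - _ in E *.
have : cmod D * 4 <= cmod h ^+ 2 * (16 * (M * (8 * t) * (t ^+ 3)^-1 * ((t / 2) ^+ 2)^-1) * t).
  apply: le_trans (_ : cmod D * cmod K <= _).
    by apply: ler_wpM2l => //; exact: cmod_ge0.
  rewrite -cmodM E cmodM cmodX; apply: ler_wpM2l => //.
  by rewrite exprn_ge0// cmod_ge0.
set U := M * _ * _ * _.
have -> : cmod h ^+ 2 * (16 * U * t) = (4 * U * t * cmod h ^+ 2) * 4 by ring.
by rewrite ler_pM2r.
Qed.

(** The geometric expansion of 1/(u - h) with u = z - p is stopped after h^2/u^3. The second-order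
    term is what the maximum principle and the division by a zero require. *)
Lemma taylor2_dker : exists l (L : R), forall h, cmod h < t / 2 ->
  cmod (f (p + h) - f p - dker p * h - l * h ^+ 2) <= L * cmod h ^+ 3.
Proof.
have t0' : 0 < t := t0.
have [M M0 hM] := bounded_insq t0 (fun z zi => cdiff_cont (df zi)).
pose k j z := f z * ((z - p) ^+ j)^-1.
exists (sq (k 3%N) p t / K), (4 * (M * (t ^+ 3)^-1 * (t / 2)^-1) * t) => h ht.
have pp : cmod (p - p) < t by rewrite subrr cmod0.
have php : cmod (p + h - p) < t by rewrite addrAC subrr add0r; lra.
pose r z := k 3%N z * (z - (p + h))^-1.
have ck j z : bdsq p t z -> ccont (k j) z.
  by move=> zb; apply: ccont_ker; [exact: cf|exact: neq].
have cr z : bdsq p t z -> ccont r z.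
  move=> zb; apply: ccontM; first exact: ck.
  exact/cdiff_cont/cdiff_inv_sub/neq.
have E : (f (p + h) - f p - dker p * h - sq (k 3%N) p t / K * h ^+ 2) * K =
    h ^+ 3 * sq r p t.
  rewrite /dker !mulrBl (mulrAC _ h K) divfK// (mulrAC _ (h ^+ 2) K) divfK//.
  rewrite -(cauchy_formula php df) -(cauchy_formula pp df) -/(k 2%N).
  rewrite (@sq_eq _ _ (fun z => f z * (z - p)^-1 + (h * k 2%N z + (h ^+ 2 * k 3%N z + h ^+ 3 * r z))))//; last first.
    move=> z zb; rewrite /r /k; field.
    by rewrite !subr_eq0 !neq.
  rewrite sqD//; last 2 first.
  - move=> z zb; apply: ccontM; first exact: cf.
    exact/cdiff_cont/cdiff_inv_sub/neq.
  - move=> z zb; apply: ccontD; first exact/ccontZ/ck.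
    by apply: ccontD; [exact/ccontZ/ck|exact/ccontZ/cr].
  rewrite sqD//; last 2 first.
  - by move=> z zb; exact/ccontZ/ck.
  - by move=> z zb; apply: ccontD; [exact/ccontZ/ck|exact/ccontZ/cr].
  rewrite sqD//; last 2 first.
  - by move=> z zb; exact/ccontZ/ck.
  - by move=> z zb; exact/ccontZ/cr.
  rewrite sqZ//; last exact: ck.
  rewrite sqZ//; last exact: ck.
  rewrite sqZ//; set X := sq (k 3%N) p t; set Y := sq r p t.
  by set Z := sq (k 2%N) p t; set W := sq _ p t; ring.
have B : cmod (sq r p t) <= 16 * (M * (t ^+ 3)^-1 * (t / 2)^-1) * t.
  apply: sq_le => // z zb; rewrite !cmodM !cmodV !cmodX.
  have z1 := bdsq_ge t0 zb.
  have z2 : t / 2 <= cmod (z - (p + h)).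
    have := cmodBD (z - p) (- h); rewrite cmodN.
    have -> : z - p - h = z - (p + h) by ring.
    lra.
  apply: ler_pM => //; rewrite ?mulr_ge0 ?invr_ge0 ?exprn_ge0 ?cmod_ge0//.
    apply: ler_pM => //; rewrite ?mulr_ge0 ?invr_ge0 ?exprn_ge0 ?cmod_ge0//.
      exact/hM/bdsq_insq.
    rewrite lef_pV2 ?posrE ?exprn_gt0//; last exact: lt_le_trans z1.
    by rewrite lerXn2r// ?nnegrE ?cmod_ge0// ltW.
  by rewrite lef_pV2 ?posrE//; [lra|lra].
set D := f _ - _ - _ - _ in E *.
have : cmod D * 4 <= cmod h ^+ 3 * (16 * (M * (t ^+ 3)^-1 * (t / 2)^-1) * t).
  apply: le_trans (_ : cmod D * cmod K <= _).
    by apply: ler_wpM2l => //; exact: cmod_ge0.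
  rewrite -cmodM E cmodM cmodX; apply: ler_wpM2l => //.
  by rewrite exprn_ge0// cmod_ge0.
set U := M * _ * _.
have -> : cmod h ^+ 3 * (16 * U * t) = (4 * U * t * cmod h ^+ 3) * 4 by ring.
by rewrite ler_pM2r.
Qed.

End Square.

Lemma cder_le f p t l M : 0 < t -> (forall z, insq p t z -> cdiff_at f z) ->
  (forall z, bdsq p t z -> cmod (f z) <= M) -> cder f p l -> cmod l <= 4 * M / t.
Proof.
move=> t0 df fM dl; have pp : cmod (p - p) < t by rewrite subrr cmod0.
by rewrite (cder_unique dl (cder_dker t0 df pp)) dker_le.
Qed.

(** Near the centre [g] coincides with [dker] by uniqueness of derivatives, and [dker] is
    differentiable at the centre. *)
Lemma cdiff_deriv f g p t : 0 < t -> (forall z, insq p t z -> cder f z (g z)) ->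
  cdiff_at g p.
Proof.
move=> t0 dg; have df z : insq p t z -> cdiff_at f z by move=> /dg; exists (g z).
have [l dl] := cdiff_dker t0 df; exists l.
apply: (cder_near t0 _ dl) => w wp; apply: cder_unique (dg w _).
  exact: cder_dker.
exact/insq_near/ltW.
Qed.

Lemma taylor2 f p t l : 0 < t -> (forall z, insq p t z -> cdiff_at f z) ->
  cder f p l -> exists l2 (L : R), forall h, cmod h < t / 2 ->
  cmod (f (p + h) - f p - l * h - l2 * h ^+ 2) <= L * cmod h ^+ 3.
Proof.
move=> t0 df dl; have pp : cmod (p - p) < t by rewrite subrr cmod0.
by rewrite (cder_unique dl (cder_dker t0 df pp)); exact: taylor2_dker.
Qed.

End Taylor.

(** * Maximum principle and Blaschke products *)

Section MaximumPrinciple.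
Variable R : realType.
Local Notation C := R[i].
Implicit Types (f g : C -> C) (a b z w l h : C) (r rho : R).

Definition anD f := forall z, Dset z -> cdiff_at f z.

Lemma insq_Dset a z : Dset a -> insq a ((1 - cmod a) / 4) z -> Dset z.
Proof.
rewrite /Dset /= => Da /insq_le h; have := cmodD (z - a) a; rewrite subrK; lra.
Qed.

Lemma Dset_rad a : Dset a -> 0 < (1 - cmod a) / 4 :> R.
Proof. by rewrite /Dset /=; lra. Qed.

(** If no maximum existed, every point of the disc would have a neighbourhood on which [u] stays
    below one of its own values; Cousin's lemma would yield a single value dominating the whole
    disc, which is again exceeded. *)
Lemma disc_max (u : C -> R) rho : 0 <= rho ->
  (forall z, cmod z <= rho -> forall e : R, 0 < e -> exists2 d : R, 0 < d &
     forall w, cmod (w - z) < d -> `|u w - u z| < e) ->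
  exists2 a, cmod a <= rho & forall z, cmod z <= rho -> u z <= u a.
Proof.
move=> r0 cu; apply: contrapT => nmax.
have {}nmax a : cmod a <= rho -> exists2 z, cmod z <= rho & u a < u z.
  move=> ar; apply: contrapT => h; apply: nmax; exists a => // z zr.
  by rewrite leNgt; apply/negP => az; apply: h; exists z.
have rr : - rho <= rho by lra.
have [b br hb] : exists2 b, cmod b <= rho &
    forall z, inrect (- rho) rho (- rho) rho z -> cmod z <= rho -> u z <= u b.
  apply: (@rect_cousin _ (fun x1 x2 y1 y2 => exists2 b, cmod b <= rho &
    forall z, inrect x1 x2 y1 y2 z -> cmod z <= rho -> u z <= u b)) => //.
    have mx b1 b2 : cmod b1 <= rho -> cmod b2 <= rho ->
        exists b, [/\ cmod b <= rho, u b1 <= u b & u b2 <= u b].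
      move=> h1 h2; have [l12|l21] := leP (u b1) (u b2); first by exists b2.
      by exists b1; split => //; exact: ltW.
    move=> x1 x2 y1 y2 x12 y12 [b1 c1 h1] [b2 c2 h2] [b3 c3 h3] [b4 c4 h4].
    have [b5 [c5 l1 l2]] := mx _ _ c1 c2; have [b6 [c6 l3 l4]] := mx _ _ c3 c4.
    have [b7 [c7 l5 l6]] := mx _ _ c5 c6.
    exists b7 => // z; rewrite /inrect => /andP[/andP[z1 z2] /andP[z3 z4]] zr.
    have [zx|zx] := leP (Re z) ((x1 + x2) / 2);
      have [zy|zy] := leP (Im z) ((y1 + y2) / 2).
    - by apply: le_trans (h1 z _ zr) (le_trans l1 l5); rewrite /inrect z1 zx z3 zy.
    - apply: le_trans (h3 z _ zr) (le_trans l3 l6).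
      by rewrite /inrect z1 zx z4 ltW.
    - apply: le_trans (h2 z _ zr) (le_trans l2 l5).
      by rewrite /inrect z3 zy z2 ltW.
    - apply: le_trans (h4 z _ zr) (le_trans l4 l6).
      by rewrite /inrect z2 z4 !ltW.
  move=> z _; have close (e : R) x1 x2 y1 y2 w : inrect x1 x2 y1 y2 z ->
      inrect x1 x2 y1 y2 w -> x2 - x1 < e / 2 -> y2 - y1 < e / 2 -> cmod (w - z) < e.
    move=> zi wi dx dy; apply: le_lt_trans (cmod_le_ReIm _) _; rewrite cReB cImB.
    have -> : e = e / 2 + e / 2 by field.
    by move: wi zi; rewrite /inrect => wi zi; apply: ltrD; rewrite ltr_norml; lra.
  have [zr|zr] := leP (cmod z) rho.
    have [b br ub] := nmax z zr.
    have [|d d0 hd] := cu z zr (u b - u z); first by rewrite subr_gt0.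
    exists (d / 2); first by rewrite divr_gt0.
    move=> x1 x2 y1 y2 _ _ _ _ zi dx dy; exists b => // w wi wr.
    have := hd w (close _ _ _ _ _ _ zi wi dx dy); rewrite ltr_norml; lra.
  (* A small rectangle around a point outside the disc does not meet the disc, so the witness 0 is
     arbitrary. *)
  exists ((cmod z - rho) / 2); first by rewrite divr_gt0// subr_gt0.
  move=> x1 x2 y1 y2 _ _ _ _ zi dx dy; exists 0; first by rewrite cmod0.
  move=> w wi wr; have := close _ _ _ _ _ _ zi wi dx dy.
  have := cmodBD z (w - z); rewrite subrKC; lra.
have [z zr uz] := nmax b br.
suff zi : inrect (- rho) rho (- rho) rho z by have := hb z zi zr; rewrite leNgt uz.
rewrite /inrect -!ler_norml.
by rewrite (le_trans (normr_Re_le _) zr) (le_trans (normr_Im_le _) zr).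
Qed.

Lemma cReD z w : Re (z + w) = Re z + Re w. Proof. by case: z w => ? ? []. Qed.
Lemma cImD z w : Im (z + w) = Im z + Im w. Proof. by case: z w => ? ? []. Qed.
Lemma cReN z : Re (- z) = - Re z. Proof. by case: z. Qed.
Lemma cImN z : Im (- z) = - Im z. Proof. by case: z. Qed.
Lemma cReM z w : Re (z * w) = Re z * Re w - Im z * Im w.
Proof. by case: z w => ? ? []. Qed.
Lemma cImM z w : Im (z * w) = Re z * Im w + Im z * Re w.
Proof. by case: z w => ? ? []. Qed.

(* The fourth roots of unity average out the terms of degree 1 and 2, so that the
   mean of |f|^2 over the four points dominates |f(a)|^2 up to third order. *)
Lemma four_point (A l l2 : C) (t : R) (i : C) : i = Complex 0 1 ->
  \sum_(h <- [:: t%:C%C; - t%:C%C; i * t%:C%C; - (i * t%:C%C)])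
     cmod (A + l * h + l2 * h ^+ 2) ^+ 2 =
  4 * (cmod A ^+ 2 + cmod l ^+ 2 * t ^+ 2 + cmod l2 ^+ 2 * t ^+ 4).
Proof.
move=> ->; rewrite !big_cons big_nil !cmod_sqr.
rewrite ![_ ^+ 2 : C]expr2 !(cReD, cImD, cReM, cImM, cReN, cImN) /=; ring.
Qed.

(** The perturbation eta |z|^2 of |f|^2 has a strictly positive second-order mean, which prevents an
    interior maximum once the third-order Taylor error is absorbed. *)
Lemma max_principle f rho (M : R) : 0 <= rho -> rho < 1 -> anD f -> 0 <= M ->
  (forall z, cmod z = rho -> cmod (f z) <= M) ->
  forall z, cmod z <= rho -> cmod (f z) <= M.
Proof.
move=> r0 r1 df M0 fM z0 z0r; rewrite leNgt; apply/negP => Mz.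
(* The excess of |f z0|^2 over M^2 is 2 eta, while the perturbation is at most eta on the disc;
   hence the maximum of [u] cannot lie on the circle. *)
have [eta eta0 etaE] : exists2 eta : R, 0 < eta & cmod (f z0) ^+ 2 = M ^+ 2 + 2 * eta.
  by exists ((cmod (f z0) ^+ 2 - M ^+ 2) / 2); [nra|field].
pose u z := cmod (f z) ^+ 2 + eta * cmod z ^+ 2.
have [z zr e e0|a ar amax] := @disc_max u rho r0.
  have Dz : Dset z by rewrite /Dset /=; lra.
  have cf := cdiff_cont (df z Dz).
  pose B := 2 * cmod (f z) + 1 + eta * (2 * cmod z + 1).
  have B0 : 0 < B by rewrite /B; have := cmod_ge0 (f z); have := cmod_ge0 z; nra.
  have k0 : 0 < Num.min 1 (e / B) by rewrite lt_min ltr01 divr_gt0.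
  have [d d0 hd] := cf _ k0.
  exists (Num.min d (Num.min 1 (e / B))); first by rewrite lt_min d0.
  move=> w; rewrite !lt_min => /andP[/hd]; rewrite lt_min => /andP[f1 f2] /andP[w1 w2].
  have sqd (x y : C) (k : R) : cmod (x - y) < 1 -> cmod (x - y) < k ->
      `|cmod x ^+ 2 - cmod y ^+ 2| < (2 * cmod y + 1) * k.
    move=> xy1 xyk; have h1 := cmodBD x (y - x); have h2 := cmodBD y (x - y).
    move: h1 h2; rewrite !subrKC (cmodB y x) => h1 h2.
    have x0 := cmod_ge0 x; have y0 := cmod_ge0 y; have d1 := cmod_ge0 (x - y).
    rewrite ltr_norml; apply/andP; split; nra.
  have A1 := sqd _ _ _ f1 f2; have A2 := sqd _ _ _ w1 w2.
  have eB : e = B * (e / B) by rewrite mulrC divfK// gt_eqF.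
  rewrite /u [X in _ < X]eB; set k := e / B in A1 A2 *.
  have -> : cmod (f w) ^+ 2 + eta * cmod w ^+ 2 - (cmod (f z) ^+ 2 + eta * cmod z ^+ 2) =
    (cmod (f w) ^+ 2 - cmod (f z) ^+ 2) + eta * (cmod w ^+ 2 - cmod z ^+ 2) by ring.
  apply: le_lt_trans (ler_normD _ _) _; rewrite normrM (gtr0_norm eta0).
  have -> : B * k = (2 * cmod (f z) + 1) * k + eta * ((2 * cmod z + 1) * k).
    by rewrite /B; ring.
  by apply: ltrD => //; rewrite ltr_pM2l.
have ua : M ^+ 2 + eta * rho ^+ 2 < u a.
  apply: lt_le_trans (amax _ z0r); rewrite /u.
  have : rho ^+ 2 <= 1 by rewrite expr_le1// ltW.
  have := sqr_ge0 (cmod z0).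
  by rewrite etaE => h1 h2; nra.
have {}ar : cmod a < rho.
  rewrite lt_neqAle ar andbT; apply/eqP => arho.
  have := fM a arho; move: ua; rewrite /u arho; have := cmod_ge0 (f a); nra.
have Da : Dset a by rewrite /Dset /=; lra.
have t0 := Dset_rad Da.
have [l dl] := df a Da.
have [l2 [L hL]] := taylor2 t0 (fun z zi => df z (insq_Dset Da zi)) dl.
pose B := cmod (f a) + cmod l + cmod l2.
have B0 : 0 <= B by rewrite /B !addr_ge0// cmod_ge0.
pose L' := `|L| + 1.
have L0 : 0 < L' by rewrite /L'; have := normr_ge0 L; lra.
(* In turn: t <= 1 bounds the Taylor polynomial by [B], the four points stay in the disc, they stay
   within the radius of the expansion, and the error 2 B L' t^3 becomes smaller than eta t^2. *)
pose t := Num.min (Num.min 1 ((rho - cmod a) / 2))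
  (Num.min ((1 - cmod a) / 16) (eta / (4 * (B + 1) * L'))).
have tp : 0 < t.
  have BL0 : 0 < 4 * (B + 1) * L' by rewrite !mulr_gt0//; lra.
  have ra : 0 < rho - cmod a by lra.
  have r1a : 0 < 1 - cmod a by lra.
  by rewrite !lt_min ltr01 /= !divr_gt0.
have tt1 : t <= 1 by rewrite /t !ge_min lexx.
have tt2 : t <= (rho - cmod a) / 2 by rewrite /t !ge_min lexx !orbT.
have tt3 : t <= (1 - cmod a) / 16 by rewrite /t !ge_min lexx !orbT.
have tt4 : t <= eta / (4 * (B + 1) * L') by rewrite /t !ge_min lexx !orbT.
have ti : cmod (Complex 0 1 : C) = 1.
  by rewrite /cmod /= expr0n expr1n add0r sqrtr1.
have hs h : cmod h = t ->
    cmod (f a + l * h + l2 * h ^+ 2) ^+ 2 - 2 * B * L' * t ^+ 3 <= cmod (f (a + h)) ^+ 2.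
  move=> ht; have := hL h; rewrite ht.
  set P := f a + l * h + l2 * h ^+ 2.
  have -> : f (a + h) - f a - l * h - l2 * h ^+ 2 = f (a + h) - P by rewrite /P; ring.
  move=> /(_ ltac:(lra)) e1.
  have PB : cmod P <= B.
    apply: le_trans (cmodD _ _) _; apply: le_trans (lerD (cmodD _ _) (lexx _)) _.
    rewrite (cmodM l h) (cmodM l2) cmodX ht /B; apply: lerD; first by
      apply: lerD => //; rewrite ler_piMr ?cmod_ge0.
    by rewrite ler_piMr ?cmod_ge0// expr_le1// ltW.
  have e2 : cmod (f (a + h) - P) <= L' * t ^+ 3.
    apply: le_trans e1 _; apply: ler_wpM2r; first by rewrite exprn_ge0// ltW.
    by rewrite /L'; have := ler_norm L; lra.
  have := cmodBD P (f (a + h) - P); rewrite subrKC => e3.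
  have P0 := cmod_ge0 P; have F0 := cmod_ge0 (f (a + h)).
  set X := L' * t ^+ 3 in e2.
  have -> : 2 * B * L' * t ^+ 3 = 2 * B * X by rewrite /X; ring.
  have X0 : 0 <= X by rewrite /X mulr_ge0 ?exprn_ge0 ?ltW.
  have [PX|PX] := leP (cmod P) X; nra.
pose H : seq C := [:: t%:C%C; - t%:C%C; Complex 0 1 * t%:C%C; - (Complex 0 1 * t%:C%C)].
have Ht h : h \in H -> cmod h = t.
  by rewrite !inE => /or4P[]/eqP ->; rewrite ?cmodN ?cmodM ?ti ?mul1r cmod_real gtr0_norm.
have sum4 (F : C -> R) : \sum_(h <- H) F h =
  F (t%:C%C) + (F (- t%:C%C) + (F (Complex 0 1 * t%:C%C) + F (- (Complex 0 1 * t%:C%C)))).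
  by rewrite /H !big_cons big_nil addr0.
pose G h := cmod (f a + l * h + l2 * h ^+ 2) ^+ 2.
pose Y h := cmod (a + h) ^+ 2.
have S1 : \sum_(h <- H) G h =
  4 * (cmod (f a) ^+ 2 + cmod l ^+ 2 * t ^+ 2 + cmod l2 ^+ 2 * t ^+ 4).
  exact: four_point.
have S2 : \sum_(h <- H) Y h = 4 * (cmod a ^+ 2 + t ^+ 2).
  transitivity (\sum_(h <- H) cmod (a + 1 * h + 0 * h ^+ 2) ^+ 2).
    by apply: eq_bigr => h _; rewrite mul1r mul0r addr0.
  by rewrite four_point// cmod0 cmod1; ring.
pose W := 2 * B * L' * t ^+ 3.
have qle h : h \in H -> G h - W + eta * Y h <= u a.
  move=> hH; have ht := Ht _ hH; apply: le_trans (amax (a + h) _); last first.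
    by have := cmodD a h; rewrite ht; lra.
  by rewrite /u /Y lerD2r; exact: hs.
have m1 : t%:C%C \in H by rewrite !inE eqxx.
have m2 : - t%:C%C \in H by rewrite !inE eqxx !orbT.
have m3 : Complex 0 1 * t%:C%C \in H by rewrite !inE eqxx !orbT.
have m4 : - (Complex 0 1 * t%:C%C) \in H by rewrite !inE eqxx !orbT.
(* Adding the four inequalities at the points a + h leaves only nonnegative terms and the gain eta
   t^2 on one side, and the error [W] on the other. *)
have key : eta * t ^+ 2 <= W.
  have q1 : 0 <= cmod l ^+ 2 * t ^+ 2 by rewrite mulr_ge0 ?sqr_ge0.
  have q2 : 0 <= cmod l2 ^+ 2 * t ^+ 4 by rewrite mulr_ge0 ?sqr_ge0// exprn_ge0// ltW.
  have := congr1 (fun x => eta * x) S2; rewrite sum4 !mulrDr => S3.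
  rewrite sum4 in S1.
  move: (qle _ m1) (qle _ m2) (qle _ m3) (qle _ m4) S1 S3 q1 q2.
  rewrite /u; move: {qle}W (cmod l ^+ 2 * t ^+ 2) (cmod l2 ^+ 2 * t ^+ 4) => W' A1 A2.
  move: (G _) (G _) (G _) (G _) => G1 G2 G3 G4.
  move: (Y _) (Y _) (Y _) (Y _) => Y1 Y2 Y3 Y4.
  move: (cmod (f a) ^+ 2) (cmod a ^+ 2) (t ^+ 2) => A3 A4 A5.
  clear => *; lra.
move: tt4; rewrite ler_pdivlMr; last by rewrite !mulr_gt0//; lra.
move=> tt4; have t20 : 0 < t ^+ 2 by rewrite exprn_gt0.
have : eta * t ^+ 2 <= 2 * B * L' * t * t ^+ 2 by apply: le_trans key _; rewrite /W; apply/eq_le_self; ring.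
rewrite ler_pM2r// => h.
have BL : 0 <= B * L' by rewrite mulr_ge0// ltW.
have tL : 0 < t * L' by rewrite mulr_gt0.
nra.
Qed.

End MaximumPrinciple.

(** * Division by zeros and Blaschke products *)

Section Blaschke.
Variable R : realType.
Local Notation C := R[i].
Implicit Types (f g : C -> C) (a b z w l h : C) (r rho : R).

(** The quotient is filled at [a] with f'(a); the second-order expansion of [f] shows that it is
    differentiable there, with the second Taylor coefficient as derivative. *)
Lemma anD_divide f a : anD f -> Dset a -> f a = 0 ->
  exists2 g, anD g & forall z, f z = g z * (z - a).
Proof.
move=> df Da fa; have [l dl] := df a Da.
pose g z := if z == a then l else f z / (z - a).
exists g; last first.
  move=> z; rewrite /g; case: eqP => [->|/eqP za]; first by rewrite fa subrr mulr0.
  by rewrite divfK// subr_eq0.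
move=> z Dz; have [->|za] := eqVneq z a.
  have t0 := Dset_rad Da.
  have [l2 [L hL]] := taylor2 t0 (fun z zi => df z (insq_Dset Da zi)) dl.
  exists l2; apply: (@cder_quad _ g a l2 L ((1 - cmod a) / 4 / 2)); first lra.
  move=> h /hL; rewrite fa subr0 /g eqxx.
  have [->|h0] := eqVneq h 0.
    by move=> _; rewrite addr0 eqxx mulr0 subrr subr0 !cmod0 expr0n mulr0.
  have -> : (a + h == a) = false.
    by apply/negbTE; rewrite -subr_eq0 addrAC subrr add0r.
  have -> : a + h - a = h by ring.
  have -> : f (a + h) / h - l - l2 * h = (f (a + h) - l * h - l2 * h ^+ 2) / h.
    by field.
  have hp : 0 < cmod h by rewrite cmod_gt0.
  rewrite [cmod (_ / _)]cmodM cmodV ler_pdivrMr// => /le_trans; apply.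
  by rewrite exprSr mulrA.
have [m dm] := df z Dz.
have dp : 0 < cmod (z - a) by rewrite cmod_gt0 subr_eq0.
have [k dk] := cdiffM (df z Dz) (cdiff_inv_sub za).
exists k; apply: (cder_near dp _ dk) => w wz; rewrite /g ifF//.
apply/negbTE; apply: contraTneq wz => ->.
by rewrite -leNgt cmodB.
Qed.

Definition bl a z : C := (z - a) / (1 - conjc a * z).

Lemma bl_den_ge a z : 1 - cmod a * cmod z <= cmod (1 - conjc a * z).
Proof.
by have := cmodBD 1 (- (conjc a * z)); rewrite cmodN cmodM cmod_conj cmod1.
Qed.

Lemma bl_den_neq0 a z : cmod a < 1 -> cmod z < 1 -> 1 - conjc a * z != 0.
Proof.
move=> a1 z1; rewrite -cmod_gt0; apply: lt_le_trans (bl_den_ge a z).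
have := cmod_ge0 a; have := cmod_ge0 z; nra.
Qed.

Lemma cmod_bl_den a z :
  cmod (1 - conjc a * z) ^+ 2 - cmod (z - a) ^+ 2 = (1 - cmod a ^+ 2) * (1 - cmod z ^+ 2).
Proof.
rewrite !cmod_sqr; case: a z => a1 a2 [z1 z2].
rewrite !(cReD, cImD, cReM, cImM, cReN, cImN) /=; ring.
Qed.

Lemma cmod_bl_sqr a z : 1 - conjc a * z != 0 ->
  cmod (bl a z) ^+ 2 = 1 - (1 - cmod a ^+ 2) * (1 - cmod z ^+ 2) / cmod (1 - conjc a * z) ^+ 2.
Proof.
move=> n0; have h : cmod (1 - conjc a * z) != 0 by rewrite cmod_eq0.
by rewrite -cmod_bl_den cmodM cmodV; field.
Qed.

Lemma bl_eq0 a z : cmod a < 1 -> cmod z < 1 -> (bl a z == 0) = (z == a).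
Proof.
by move=> a1 z1; rewrite mulf_eq0 invr_eq0 (negbTE (bl_den_neq0 a1 z1)) orbF subr_eq0.
Qed.

Lemma cdiff_bl_den a z : cdiff_at (fun w => 1 - conjc a * w) z.
Proof.
exists (0 + (0 * z + - conjc a * 1)); apply: cderD; first exact: cder_cst.
have := cderM (cder_cst (- conjc a) z) (cder_id z).
by apply: (cder_near ltr01) => w _; rewrite mulNr.
Qed.

Lemma anD_blaschke f (s : seq C) : anD f -> uniq s ->
  (forall a, a \in s -> Dset a) -> (forall a, a \in s -> f a = 0) ->
  exists2 g, anD g & forall z, Dset z -> f z = g z * \prod_(a <- s) bl a z.
Proof.
move=> df; elim: s => [|a s IH] /=.
  by move=> _ _ _; exists f => // z _; rewrite big_nil mulr1.
move=> /andP[as_ us] sD s0.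
have [b bs|b bs|g dg fg] := IH us; first by apply: sD; rewrite inE bs orbT.
  by apply: s0; rewrite inE bs orbT.
have Da : Dset a by apply: sD; rewrite inE eqxx.
have ga : g a = 0.
  have := fg a Da; rewrite s0 ?inE ?eqxx// => /esym/eqP; rewrite mulf_eq0.
  move=> /orP[/eqP//|]; rewrite prodf_seq_eq0 => /hasP[b bs /=].
  rewrite bl_eq0//; last by apply: (sD b); rewrite inE bs orbT.
  by move=> /eqP ab; move: as_; rewrite ab bs.
have [k dk gk] := anD_divide dg Da ga.
exists (fun z => k z * (1 - conjc a * z)).
  by move=> z Dz; apply: cdiffM; [exact: dk|exact: cdiff_bl_den].
move=> z Dz; rewrite big_cons fg// gk /bl; field.
by apply: bl_den_neq0.
Qed.

(** One has 1 - |bl a z|^2 = (1 - |a|^2)(1 - |z|^2) / |1 - conj(a) z|^2, at most 2 (1 - rho) / (1 -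
    r)^2; [rho] is chosen close enough to 1 to make this at most 1 - kap^2. *)
Lemma bl_circle r (kap : R) : 0 <= r -> r < 1 -> 0 < kap < 1 ->
  exists2 rho, r < rho < 1 &
   forall a z, cmod a <= r -> cmod z = rho -> kap <= cmod (bl a z).
Proof.
move=> r0 r1 k01.
have eta0 : 0 < (1 - kap ^+ 2) * (1 - r) ^+ 2 by apply: mulr_gt0; [nra|rewrite exprn_gt0//; lra].
pose rho := Num.max ((1 + r) / 2) (1 - (1 - kap ^+ 2) * (1 - r) ^+ 2 / 2).
have h1 : (1 + r) / 2 <= rho by rewrite /rho le_max lexx.
have h2 : 1 - (1 - kap ^+ 2) * (1 - r) ^+ 2 / 2 <= rho by rewrite /rho le_max lexx orbT.
have h3 : rho < 1 by rewrite /rho gt_max; apply/andP; split; lra.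
exists rho; first by apply/andP; split; lra.
move=> a z ar zr; have a1 : cmod a < 1 by lra.
have z1 : cmod z < 1 by lra.
have n0 := bl_den_neq0 a1 z1.
rewrite -(@ler_pXn2r _ 2)// ?nnegrE ?cmod_ge0//; last lra.
rewrite cmod_bl_sqr// zr lerBrDr -lerBrDl ler_pdivrMr; last by rewrite exprn_gt0// cmod_gt0.
have a0 := cmod_ge0 a.
have dge : 1 - r <= cmod (1 - conjc a * z).
  apply: le_trans (bl_den_ge a z); rewrite zr; nra.
apply: le_trans (_ : (1 - kap ^+ 2) * (1 - r) ^+ 2 <= _); last first.
  apply: ler_wpM2l; first nra.
  by rewrite lerXn2r ?nnegrE ?cmod_ge0//; lra.
apply: le_trans (_ : 1 - rho ^+ 2 <= _); last first.
  have : 1 - rho ^+ 2 <= 2 * (1 - rho) by nra.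
  lra.
rewrite ler_piMl//; nra.
Qed.

(** The maximum principle is applied to [f] divided by its Blaschke product, each factor being at
    least [kap] on the circle. The radius depends on [r] and [kap] only, so it is fixed before the
    number of zeros grows. *)
Lemma blaschke_bound r (kap : R) : 0 <= r -> r < 1 -> 0 < kap < 1 ->
  exists2 rho, r < rho < 1 &
  forall f (s : seq C) (A : R), anD f -> uniq s ->
    (forall a, a \in s -> cmod a <= r) -> (forall a, a \in s -> f a = 0) ->
    (forall z, cmod z <= rho -> cmod (f z) <= A) ->
    forall z, cmod z <= rho ->
      cmod (f z) <= A / kap ^+ size s * \prod_(a <- s) cmod (bl a z).
Proof.
move=> r0 r1 k01; have [rho rr hk] := bl_circle r0 r1 k01.
exists rho => // f s A df us sr s0 fA.
have A0 : 0 <= A by apply: le_trans (cmod_ge0 _) (fA 0 _); rewrite cmod0; lra.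
have [a as_|g dg fg] := anD_blaschke df us _ s0.
  by rewrite /Dset /=; have := sr a as_; lra.
have k0 : 0 < kap by lra.
have ks : 0 < kap ^+ size s by rewrite exprn_gt0.
have gle : forall z, cmod z <= rho -> cmod (g z) <= A / kap ^+ size s.
  apply: max_principle => //; [lra|lra|by rewrite divr_ge0// ltW|].
  move=> z zr; rewrite ler_pdivlMr//.
  apply: le_trans (fA z _); last by rewrite zr.
  rewrite fg ?cmodM; last by rewrite /Dset /= zr; lra.
  apply: ler_wpM2l; first exact: cmod_ge0.
  rewrite cmod_prod.
  have : forall a, a \in s -> kap <= cmod (bl a z).
    by move=> a as_; apply: hk => //; exact: sr.
  elim: (s) => [|b q IH] hq; first by rewrite big_nil expr0.
  rewrite big_cons /= exprS; apply: ler_pM; rewrite ?exprn_ge0 ?(ltW k0)//.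
    by apply: hq; rewrite inE eqxx.
  by apply: IH => c cq; apply: hq; rewrite inE cq orbT.
move=> z zr; rewrite fg; last by rewrite /Dset /=; lra.
rewrite cmodM cmod_prod; apply: ler_wpM2r; last exact: gle.
by apply: prodr_ge0 => a _; exact: cmod_ge0.
Qed.

End Blaschke.

(** * Green energy and nearly extremal points *)

Section Fekete.
Variable R : realType.
Local Notation C := R[i].
Implicit Types (a b z w : C).

(** The real-valued Green kernel, not the constant [kap] of the Blaschke bounds. Since [ln] is 0 at
    0, its diagonal value is 0 and not infinite, so energies and potentials treat the diagonal
    separately. *)
Definition kap z w : R := - ln (cmod (bl w z)).

Lemma cmod_bl_sym z w : cmod (bl w z) = cmod (bl z w).
Proof.
rewrite /bl !cmodM !cmodV cmodB; congr (_ / _).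
rewrite -cmod_conj; congr cmod; case: z w => z1 z2 [w1 w2].
by apply/eqP; rewrite eq_complex /=; apply/andP; split; apply/eqP; ring.
Qed.

Lemma kapC z w : kap z w = kap w z.
Proof. by rewrite /kap cmod_bl_sym. Qed.

Lemma cmod_bl_le1 z w : cmod z < 1 -> cmod w < 1 -> cmod (bl w z) <= 1.
Proof.
move=> z1 w1; have n0 := bl_den_neq0 w1 z1.
rewrite -(@ler_pXn2r _ 2)// ?nnegrE ?cmod_ge0// cmod_bl_sqr// expr1n lerBlDr lerDl.
have z0 := cmod_ge0 z; have w0 := cmod_ge0 w.
by rewrite divr_ge0 ?sqr_ge0//; apply: mulr_ge0; nra.
Qed.

Lemma cmod_bl_gt0 z w : cmod z < 1 -> cmod w < 1 -> z != w -> 0 < cmod (bl w z).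
Proof. by move=> z1 w1 zw; rewrite cmod_gt0 bl_eq0. Qed.

Lemma kap_ge0 z w : cmod z < 1 -> cmod w < 1 -> z != w -> 0 <= kap z w.
Proof.
by move=> z1 w1 zw; rewrite /kap oppr_ge0 ln_le0// cmod_bl_le1.
Qed.

Lemma green_kap z w : z != w -> cmod z < 1 -> cmod w < 1 -> green z w = (kap z w)%:E.
Proof.
move=> zw z1 w1; rewrite /green (negbTE zw); congr EFin.
rewrite /kap -lnV; last by rewrite posrE cmod_bl_gt0.
by rewrite -cmodV /bl invfM invrK mulrC.
Qed.

Definition fek_energy n (z : 'I_n -> C) : R :=
  \sum_i \sum_(j | j != i) kap (z i) (z j).

Definition fek_row n (z : 'I_n -> C) i w : R := \sum_(j | j != i) kap w (z j).

Definition subst n (z : 'I_n -> C) (i : 'I_n) w : 'I_n -> C :=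
  fun j => if j == i then w else z j.

Lemma fek_energy_row n (z : 'I_n -> C) i : fek_energy z =
  2 * fek_row z i (z i) +
  \sum_(a | a != i) \sum_(b | (b != a) && (b != i)) kap (z a) (z b).
Proof.
rewrite /fek_energy (bigD1 i)//= -/(fek_row z i (z i)).
have -> : \sum_(a | a != i) \sum_(b | b != a) kap (z a) (z b) =
  \sum_(a | a != i) (kap (z a) (z i) +
     \sum_(b | (b != a) && (b != i)) kap (z a) (z b)).
  by apply: eq_bigr => a ai; rewrite (bigD1 i)//= eq_sym.
rewrite big_split /= addrA; congr (_ + _).
have -> : \sum_(a | a != i) kap (z a) (z i) = fek_row z i (z i).
  by apply: eq_bigr => a _; rewrite kapC.
by ring.
Qed.

Lemma fek_energy_subst n (z : 'I_n -> C) i w :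
  fek_energy (subst z i w) = fek_energy z + 2 * (fek_row z i w - fek_row z i (z i)).
Proof.
rewrite (fek_energy_row _ i) [in RHS](fek_energy_row _ i).
have -> : fek_row (subst z i w) i (subst z i w i) = fek_row z i w.
  by rewrite /fek_row {1}/subst eqxx; apply: eq_bigr => j ji; rewrite /subst (negbTE ji).
have -> : \sum_(a | a != i) \sum_(b | (b != a) && (b != i))
    kap (subst z i w a) (subst z i w b) =
  \sum_(a | a != i) \sum_(b | (b != a) && (b != i)) kap (z a) (z b).
  apply: eq_bigr => a ai; apply: eq_bigr => b /andP[_ bi].
  by rewrite /subst (negbTE ai) (negbTE bi).
by ring.
Qed.

(** Take N + 1 points of nearly minimal energy. If every row sum is below N v, the energy bound
    follows. Otherwise a point with row sum at least N v is removed: moving it to [w] cannot lower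
    the energy by much, so the potential of the other N points at [w] is at least N v - ln 2, and
    its exponential is the product. *)
Lemma fekete (S : set C) N (v : R) : (forall z, S z -> cmod z < 1) ->
  (exists2 z : 'I_N.+1 -> C, injective z & forall i, S (z i)) ->
  (exists z : 'I_N -> C, [/\ injective z, forall i, S (z i) &
     forall w, S w -> \prod_i cmod (bl (z i) w) <= 2 * expR (- (N%:R * v))]) \/
  (exists z : 'I_N.+1 -> C, [/\ injective z, forall i, S (z i) &
     fek_energy z <= N.+1%:R * (N%:R * v)]).
Proof.
move=> S1 [z0 iz0 Sz0].
pose adm (z : 'I_N.+1 -> C) := injective z /\ forall i, S (z i).
have E0 (z : 'I_N.+1 -> C) : adm z -> 0 <= fek_energy z.
  move=> [iz Sz]; apply: sumr_ge0 => i _; apply: sumr_ge0 => j ji.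
  by apply: kap_ge0; rewrite ?S1// (inj_eq iz) eq_sym.
pose V := [set fek_energy z | z in adm].
have hV : has_inf V.
  split; first by exists (fek_energy z0), z0.
  by exists 0 => _ [z az <-]; exact: E0.
have l20 : 0 < ln 2 :> R by rewrite ln_gt0// ltr1n.
(* The slack 2 ln 2 becomes ln 2 in a row sum, as each pair is counted twice, and the factor 2 after
   exponentiation. *)
have [_ [z [iz Sz] <-] zinf] := inf_adherent (mulr_gt0 (ltr0n R 2) l20) hV.
have [[i hi]|no] := pselect (exists i, N%:R * v <= fek_row z i (z i)); last first.
  right; exists z; split => //.
  rewrite /fek_energy.
  apply: (@le_trans _ _ (\sum_(i < N.+1) N%:R * v)); last first.
    by rewrite sumr_const card_ord -[_ * v *+ _]mulr_natl.
  apply: ler_sum => i _; rewrite leNgt; apply/negP => h; apply: no.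
  by exists i; exact: ltW.
left; exists (z \o lift i); split => [|j|w Sw].
- by move=> a b /= /iz /lift_inj.
- exact: Sz.
(* At a remaining point the product vanishes; elsewhere the system with [w] substituted is still
   injective and competes in the infimum. *)
have [[j wj]|nw] := pselect (exists j, z (lift i j) = w).
  rewrite (bigD1 j)//= wj.
  have -> : cmod (bl w w) = 0 by rewrite /bl subrr mul0r cmod0.
  by rewrite mul0r mulr_ge0// expR_ge0.
have neq j : j != i -> w != z j.
  rewrite eq_sym => ji; apply/eqP => wz; apply: nw.
  by have [k kE _] := unlift_some ji; exists k; rewrite wz kE.
have adm' : adm (subst z i w).
  split=> [a b|a]; rewrite /subst; last by case: eqP.
  case: (eqVneq a i) => [->|ai]; case: (eqVneq b i) => [->//|bi].
  - by move=> /eqP; rewrite (negbTE (neq _ bi)).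
  - by move=> /esym/eqP; rewrite (negbTE (neq _ ai)).
  - by move=> /iz.
have hinf : inf V <= fek_energy (subst z i w).
  by apply: inf_lbound; [case: hV|exists (subst z i w)].
have rle : fek_row z i (z i) - ln 2 <= fek_row z i w.
  move: hinf; rewrite fek_energy_subst; lra.
have -> : \prod_j cmod (bl ((z \o lift i) j) w) = expR (- fek_row z i w).
  rewrite /fek_row -sumrN expR_sum.
  transitivity (\prod_(j | j != i) cmod (bl (z j) w)); last first.
    apply: eq_bigr => j ji; rewrite /kap opprK lnK// posrE.
    by apply: cmod_bl_gt0; rewrite ?S1// neq.
  rewrite [RHS](reindex_omap (lift i) (unlift i))/=.
    by apply: eq_bigl => j; rewrite liftK eq_sym neq_lift eqxx.
  by move=> j; case: unliftP => [k ->|->]; rewrite ?eqxx.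
apply: (@le_trans _ _ (expR (- (N%:R * v - ln 2)))).
  by rewrite ler_expR; lra.
by rewrite opprB expRD lnK ?posrE.
Qed.

End Fekete.

(** * Morton codes and simultaneous limits of bounded sequences *)

Section Coding.
Variable R : realType.
Local Notation C := R[i].
Implicit Types (z w : C).

Definition dyad (m : nat) (x : R) : nat := Num.truncn (2 ^+ m * (x + 1)).

(* Interleaved binary digits (the Morton order): each level refines the previous
   one by a final base-4 digit, so sorting by level k sorts by all levels m <= k. *)
Fixpoint mcode (m : nat) z : nat :=
  match m with
  | 0%N => (2 * dyad 0 (Re z) + dyad 0 (Im z))%N
  | m'.+1 => (4 * mcode m' z + (2 * (dyad m (Re z) %% 2) + dyad m (Im z) %% 2))%N
  end.

Lemma truncn_double (y : R) : 0 <= y -> (Num.truncn (2 * y) %/ 2 = Num.truncn y)%N.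
Proof.
move=> y0; have /andP[h1 h2] := truncn_itv y0.
have y20 : 0 <= 2 * y by rewrite mulr_ge0.
have /andP[h3 h4] := truncn_itv y20.
set T := Num.truncn y in h1 h2 *; set T2 := Num.truncn (2 * y) in h3 h4 *.
have : (T2 < 2 * T + 2)%N by rewrite -(ltr_nat R) natrD natrM; move: h2; rewrite -natr1; lra.
have : (2 * T < T2 + 1)%N by rewrite -(ltr_nat R) natrD natrM; move: h4; rewrite -natr1; lra.
lia.
Qed.

Lemma dyadS m (x : R) : -1 <= x -> (dyad m.+1 x %/ 2 = dyad m x)%N.
Proof.
move=> x1; rewrite /dyad exprS -mulrA truncn_double// mulr_ge0 ?exprn_ge0//.
by rewrite -lerBlDr sub0r.
Qed.

Lemma code_mono m k z w : (m <= k)%N -> (mcode k z <= mcode k w)%N ->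
  (mcode m z <= mcode m w)%N.
Proof.
elim: k => [|k IH]; first by rewrite leqn0 => /eqP ->.
rewrite leq_eqVlt => /orP[/eqP -> //|]; rewrite ltnS => mk h.
apply: IH => //; move: h => /=.
have := ltn_pmod (dyad k.+1 (Re z)) (isT : 0 < 2)%N.
have := ltn_pmod (dyad k.+1 (Im z)) (isT : 0 < 2)%N.
have := ltn_pmod (dyad k.+1 (Re w)) (isT : 0 < 2)%N.
have := ltn_pmod (dyad k.+1 (Im w)) (isT : 0 < 2)%N.
lia.
Qed.

Lemma dyad0_lt (x : R) : `|x| < 1 -> (dyad 0 x < 2)%N.
Proof.
rewrite ltr_norml => h; rewrite /dyad expr0 mul1r -(ltr_nat R).
apply: le_lt_trans (_ : x + 1 < _); last lra.
by have /andP[] : (Num.truncn (x + 1))%:R <= x + 1 < (Num.truncn (x + 1)).+1%:R by apply: truncn_itv; lra.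
Qed.

Lemma Re_lt1 z : cmod z < 1 -> `|Re z| < 1.
Proof. exact: le_lt_trans (normr_Re_le z). Qed.

Lemma Im_lt1 z : cmod z < 1 -> `|Im z| < 1.
Proof. exact: le_lt_trans (normr_Im_le z). Qed.

Lemma code_lt m z : cmod z < 1 -> (mcode m z < 4 ^ m.+1)%N.
Proof.
move=> z1; elim: m => [|m IH] /=.
  by have := dyad0_lt (Re_lt1 z1); have := dyad0_lt (Im_lt1 z1); rewrite expn1; lia.
have := ltn_pmod (dyad m.+1 (Re z)) (isT : 0 < 2)%N.
have := ltn_pmod (dyad m.+1 (Im z)) (isT : 0 < 2)%N.
by rewrite expnS; lia.
Qed.

Lemma code_dyad m z w : cmod z < 1 -> cmod w < 1 -> mcode m z = mcode m w ->
  dyad m (Re z) = dyad m (Re w) /\ dyad m (Im z) = dyad m (Im w).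
Proof.
move=> z1 w1; elim: m => [|m IH] /=.
  have := dyad0_lt (Re_lt1 z1); have := dyad0_lt (Im_lt1 z1).
  by have := dyad0_lt (Re_lt1 w1); have := dyad0_lt (Im_lt1 w1); lia.
have a1 := ltn_pmod (dyad m.+1 (Re z)) (isT : 0 < 2)%N.
have a2 := ltn_pmod (dyad m.+1 (Im z)) (isT : 0 < 2)%N.
have a3 := ltn_pmod (dyad m.+1 (Re w)) (isT : 0 < 2)%N.
have a4 := ltn_pmod (dyad m.+1 (Im w)) (isT : 0 < 2)%N.
move=> h; have [|e1 e2] := IH; first by lia.
have ge (x : R) : `|x| < 1 -> -1 <= x by rewrite ltr_norml => ?; lra.
move: e1 e2; rewrite -(dyadS m (ge _ (Re_lt1 z1))) -(dyadS m (ge _ (Re_lt1 w1))).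
rewrite -(dyadS m (ge _ (Im_lt1 z1))) -(dyadS m (ge _ (Im_lt1 w1))) => e1 e2.
have := divn_eq (dyad m.+1 (Re z)) 2; have := divn_eq (dyad m.+1 (Im z)) 2.
have := divn_eq (dyad m.+1 (Re w)) 2; have := divn_eq (dyad m.+1 (Im w)) 2.
lia.
Qed.

Lemma dyad_close m (x y : R) : -1 <= x -> -1 <= y -> dyad m x = dyad m y ->
  `|x - y| <= (2 ^+ m)^-1.
Proof.
move=> x1 y1; rewrite /dyad => e.
have p : 0 < 2 ^+ m :> R by rewrite exprn_gt0.
have x0 : 0 <= 2 ^+ m * (x + 1) by apply: mulr_ge0; [exact: ltW|lra].
have y0 : 0 <= 2 ^+ m * (y + 1) by apply: mulr_ge0; [exact: ltW|lra].
have := truncn_itv x0; have := truncn_itv y0; rewrite e -natr1.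
move=> h1 h2; rewrite -(ler_pM2l p) divff ?gt_eqF// -(ger0_norm (ltW p)) -normrM.
by rewrite ler_norml; lra.
Qed.

Lemma code_close m z w : cmod z < 1 -> cmod w < 1 -> mcode m z = mcode m w ->
  `|Re z - Re w| <= (2 ^+ m)^-1 /\ `|Im z - Im w| <= (2 ^+ m)^-1.
Proof.
have ge (x : R) : `|x| < 1 -> -1 <= x by rewrite ltr_norml => ?; lra.
move=> z1 w1 /(code_dyad z1 w1)[e1 e2].
by split; apply: dyad_close => //; apply: ge; by [exact: Re_lt1|exact: Im_lt1].
Qed.

(** An ultrafilter finer than [\oo] converges along every coordinate at once; finite intersections
    of its sets with a tail are nonempty and supply the indices of the diagonal subsequence. *)
Lemma diagonal_selection (x : nat -> nat -> R) :
  (forall k i, 0 <= x k i <= 1) ->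
  exists c : nat -> R, forall l, exists2 k, (l <= k)%N &
    forall i, (i <= l)%N -> `|x k i - c i| < l.+1%:R^-1.
Proof.
move=> x01; have [G [UG FG]] := ultraFilterLemma (@eventually_filter : ProperFilter _).
have PG : ProperFilter G by apply: ultra_proper.
have lim i : exists c : R, forall e : R, 0 < e -> G [set k | `|x k i - c| < e].
  have cpt := @segment_compact R 0 1.
  have [|p [_ pc]] := cpt ((x^~ i) @ G) _.
    have : G [set k | `[0, 1]%classic (x k i)]; last by [].
    by apply: filterE => k; rewrite /= in_itv /=; exact: x01.
  exists p => e e0; have [//|nG] := in_ultra_setVsetC [set k | `|x k i - p| < e] UG.
  have [] := pc ((x^~ i) @` (~` [set k | `|x k i - p| < e])) (ball p e).
  - apply: (@filterS _ G _ _ _ _ nG) => k nk; by exists k.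
  - exact: nbhsx_ballx.
  - by move=> _ [[k nk <-]]; rewrite /ball /= distrC => /nk.
have [c hc] := choice lim; exists c => l.
have l0 : 0 < l.+1%:R^-1 :> R by rewrite invr_gt0.
have GA n : G [set k | forall i, (i < n)%N -> `|x k i - c i| < l.+1%:R^-1].
  elim: n => [|n IH]; first by apply: filterE => k i.
  apply: (@filterS _ G _ _ _ _ (filterI IH (hc n _ l0))) => k [/= h1 h2] i.
  by rewrite ltnS leq_eqVlt => /orP[/eqP ->|/h1].
have GB : G [set k | (l <= k)%N] by apply: FG; exists l.
have [k [/= h1 h2]] := filter_ex (filterI (GA l.+1) GB).
by exists k => // i il; exact: h1.
Qed.

End Coding.

(** * Quantile maps of empirical measures *)

Section QuantileMap.
Variable R : realType.
Local Notation C := R[i].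
Implicit Types (z w : C) (s : seq C) (t : R).

Definition bin s t : nat := Num.truncn ((size s)%:R * t).
(** The quantile function of the uniform measure on the entries of [s], in the order of the list. *)
Definition quant s t : C := nth 0 s (bin s t).
(** The empirical distribution function of the level-[m] Morton codes. *)
Definition ecdf s m j : R := (count (fun z => (mcode m z < j)%N) s)%:R / (size s)%:R.

Lemma bin_lt s t : (0 < size s)%N -> 0 <= t < 1 -> (bin s t < size s)%N.
Proof.
move=> s0 /andP[t0 t1]; rewrite /bin -(ltr_nat R).
have h : 0 <= (size s)%:R * t by rewrite mulr_ge0.
have /andP[h1 _] := truncn_itv h; apply: le_lt_trans h1 _.
by rewrite gtr_pMr// ltr0n.
Qed.

Lemma quant_mem s t : (0 < size s)%N -> 0 <= t < 1 -> quant s t \in s.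
Proof. by move=> s0 t01; rewrite mem_nth// bin_lt. Qed.

Lemma ecdf01 s m j : 0 <= ecdf s m j <= 1.
Proof.
rewrite /ecdf; case: (posnP (size s)) => [->|s0]; first by rewrite invr0 mulr0 lexx ler01.
by rewrite divr_ge0//= ler_pdivrMr ?ltr0n// mul1r ler_nat count_size.
Qed.

(** Sorting at level [k] also sorts the coarser level-[m] codes, so the points with code below [j]
    form an initial segment of the list; its relative length is the empirical distribution
    function. *)
Lemma quant_code s t m k j : (0 < size s)%N -> 0 <= t < 1 -> (m <= k)%N ->
  sorted (fun z w => (mcode k z <= mcode k w)%N) s ->
  (mcode m (quant s t) < j)%N = (t < ecdf s m j).
Proof.
move=> s0 t01 mk ss.
have sm : sorted <=%O (map (mcode m) s).
  rewrite sorted_map; apply: sub_sorted ss => z w /=; rewrite leEnat.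
  exact: code_mono.
have cE : count (< j)%O (map (mcode m) s) = count (fun z => (mcode m z < j)%N) s.
  by rewrite count_map; apply: eq_count => z /=; rewrite ltEnat.
have nE : nth 0%N (map (mcode m) s) (bin s t) = mcode m (quant s t).
  by rewrite (nth_map 0)// bin_lt.
have n0 : 0 < (size s)%:R :> R by rewrite ltr0n.
have h : 0 <= (size s)%:R * t by rewrite mulr_ge0//; case/andP: t01.
have /andP[h1 h2] := truncn_itv h.
rewrite /ecdf ltr_pdivlMr// [t * _]mulrC.
set N := count _ s in cE *.
have [bN|Nb] := ltnP (bin s t) N.
  have := @nth_count_lt _ _ j 0%N _ (bin s t) sm; rewrite cE nE ltEnat => /(_ bN) /= ->.
  apply/esym; apply: lt_le_trans h2 _; by rewrite ler_nat.
have := @nth_count_ge _ _ j 0%N _ (bin s t) sm; rewrite cE nE leEnat size_map Nb bin_lt//=.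
move=> /(_ isT) jc; rewrite ltnNge jc /=; apply/esym/negbTE.
by rewrite -leNgt; apply: le_trans h1; rewrite ler_nat.
Qed.

(** Pairs of a level and a threshold are enumerated by [pickle]; stage [l] asks for accuracy 1 / (l
    + 1) for only finitely many of them. *)
Lemma select_cdf (s : nat -> seq C) : exists (sub : nat -> nat) (c : nat -> nat -> R),
  (forall l, (l <= sub l)%N) /\
  forall m j l, (pickle (m, j) <= l)%N -> `|ecdf (s (sub l)) m j - c m j| < l.+1%:R^-1.
Proof.
pose x k i : R := if @unpickle (nat * nat)%type i is Some p then ecdf (s k) p.1 p.2 else 0.
have [k i|c hc] := @diagonal_selection R x.
  by rewrite /x; case: unpickle => [p|]; rewrite ?ecdf01// lexx ler01.
have hc' l : exists k, (l <= k)%N /\ forall i, (i <= l)%N -> `|x k i - c i| < l.+1%:R^-1.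
  by have [k ? ?] := hc l; exists k.
have [sub hs] := choice hc'.
exists sub, (fun m j => c (pickle (m, j))); split => [l|m j l ml]; first by have [] := hs l.
by have [_ /(_ _ ml)] := hs l; rewrite /x pickleK.
Qed.

Section Limit.
Variables (s : nat -> seq C) (c : nat -> nat -> R).
Hypothesis s_gt : forall l, (l < size (s l))%N.
Hypothesis s_D : forall l z, z \in s l -> cmod z < 1.
Hypothesis s_sorted : forall l, exists2 k, (l <= k)%N &
  sorted (fun z w => (mcode k z <= mcode k w)%N) (s l).
Hypothesis s_cdf : forall m j l, (pickle (m, j) <= l)%N ->
  `|ecdf (s l) m j - c m j| < l.+1%:R^-1.

Let s0 l : (0 < size (s l))%N. Proof. exact: leq_ltn_trans (s_gt l). Qed.

Lemma inv_lt_eventually (e : R) : 0 < e -> exists L, forall l, (L <= l)%N -> l.+1%:R^-1 < e.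
Proof.
move=> e0; exists (Num.truncn e^-1) => l Ll.
rewrite -[e]invrK ltf_pV2 ?posrE ?invr_gt0//.
apply: lt_le_trans (truncnS_gt _) _; by rewrite ler_nat ltnS.
Qed.

(** As [t] differs from the limit value, its comparison with the empirical value is eventually the
    comparison with the limit. Finitely many thresholds [j] exhaust the codes of level [m], hence
    one [L] for all. *)
Lemma code_stable t m : 0 <= t < 1 -> (forall m j, t != c m j) ->
  exists L, forall l, (L <= l)%N -> forall j, (j <= 4 ^ m.+1)%N ->
    (mcode m (quant (s l) t) < j)%N = (t < c m j).
Proof.
move=> t01 tc; elim: (4 ^ m.+1)%N => [|J [L IH]].
  have [L hL] : exists L, forall l, (L <= l)%N ->
      (mcode m (quant (s l) t) < 0)%N = (t < c m 0%N).
    have d0 : 0 < `|t - c m 0%N| by rewrite normr_gt0 subr_eq0.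
    have [L hL] := inv_lt_eventually d0.
    exists (maxn L (maxn m (pickle (m, 0%N)))) => l; rewrite !geq_max => /and3P[l1 l2 l3].
    have [k lk sk] := s_sorted l.
    rewrite (quant_code _ (s0 l) t01 (leq_trans l2 lk) sk).
    have := lt_trans (s_cdf l3) (hL _ l1); rewrite ltr_norml.
    by case: (ltP t (c m 0%N)) => h; [rewrite ltr0_norm ?subr_lt0// => ?; apply/idP; lra
      |rewrite ger0_norm ?subr_ge0// => ?; apply/negbTE; rewrite -leNgt; lra].
  by exists L => l Ll j; rewrite leqn0 => /eqP ->; exact: hL.
have d0 : 0 < `|t - c m J.+1| by rewrite normr_gt0 subr_eq0.
have [L' hL'] := inv_lt_eventually d0.
exists (maxn L (maxn L' (maxn m (pickle (m, J.+1))))) => l.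
rewrite !geq_max => /and4P[l0 l1 l2 l3] j; rewrite leq_eqVlt => /orP[/eqP ->|jJ]; last exact: IH.
have [k lk sk] := s_sorted l.
rewrite (quant_code _ (s0 l) t01 (leq_trans l2 lk) sk).
have := lt_trans (s_cdf l3) (hL' _ l1); rewrite ltr_norml.
by case: (ltP t (c m J.+1)) => h; [rewrite ltr0_norm ?subr_lt0// => ?; apply/idP; lra
  |rewrite ger0_norm ?subr_ge0// => ?; apply/negbTE; rewrite -leNgt; lra].
Qed.

Lemma quant_D l t : 0 <= t < 1 -> cmod (quant (s l) t) < 1.
Proof. by move=> t01; apply: (s_D (l := l)); exact: quant_mem. Qed.

Lemma code_cauchy t m : 0 <= t < 1 -> (forall m j, t != c m j) ->
  exists L, forall l l', (L <= l)%N -> (L <= l')%N ->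
    mcode m (quant (s l) t) = mcode m (quant (s l') t).
Proof.
move=> t01 tc; have [L hL] := code_stable m t01 tc.
have le l l' : (L <= l)%N -> (L <= l')%N ->
    (mcode m (quant (s l) t) <= mcode m (quant (s l') t))%N.
  move=> Ll Ll'; have b := code_lt m (quant_D l' t01).
  by rewrite -ltnS (hL l)// -(hL l')// ltnS.
by exists L => l l' Ll Ll'; apply/eqP; rewrite eqn_leq !le.
Qed.

(** At each level the cell of the quantile is eventually constant, and cells of level [m] have side
    at most 2^-m, so both coordinates are Cauchy sequences. *)
Lemma quant_cvg t : 0 <= t < 1 -> (forall m j, t != c m j) ->
  exists z, (fun l => Re (quant (s l) t)) @ \oo --> Re z /\
            (fun l => Im (quant (s l) t)) @ \oo --> Im z.
Proof.
move=> t01 tc.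
have small (e : R) : 0 < e -> exists m, (2 ^+ m)^-1 < e :> R.
  move=> e0; have [L hL] := inv_lt_eventually e0; exists L.
  apply: le_lt_trans (hL L (leqnn L)); rewrite lef_pV2 ?posrE ?exprn_gt0//.
  by rewrite -natrX ler_nat ltn_expl.
have cR : cvgn (fun l => Re (quant (s l) t)).
  apply: cauchy_cvg.
  apply/cauchy_exP => e e0; have [m me] := small e e0.
  have [L hL] := code_cauchy m t01 tc.
  exists (Re (quant (s L) t)); exists L => // l /= Ll.
  apply: le_lt_trans me.
  by have [] := code_close (quant_D L t01) (quant_D l t01) (hL _ _ (leqnn L) Ll).
have cI : cvgn (fun l => Im (quant (s l) t)).
  apply: cauchy_cvg.
  apply/cauchy_exP => e e0; have [m me] := small e e0.
  have [L hL] := code_cauchy m t01 tc.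
  exists (Im (quant (s L) t)); exists L => // l /= Ll.
  apply: le_lt_trans me.
  by have [] := code_close (quant_D L t01) (quant_D l t01) (hL _ _ (leqnn L) Ll).
by exists (Complex (limn (fun l => Re (quant (s l) t))) (limn (fun l => Im (quant (s l) t)))).
Qed.

End Limit.

End QuantileMap.

(** * Measurability of the Green kernel and energy of an image measure *)

Section GreenMeasurable.
Variable R : realType.
Local Notation C := R[i].

Lemma measurable_cmod d (T : measurableType d) (f : T -> C) (D : set T) :
  measurable_fun D (fun x => Re (f x)) -> measurable_fun D (fun x => Im (f x)) ->
  measurable_fun D (fun x => cmod (f x)).
Proof.
move=> m1 m2; under eq_fun do rewrite /cmod -powR12_sqrt ?addr_ge0 ?sqr_ge0//.
apply: (measurableT_comp (@measurable_powR R 2^-1)).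
by apply: measurable_funD; exact: measurable_funX.
Qed.

Lemma measurable_green : measurable_fun [set: ((R * R) * (R * R))%type]
  (fun x : ((R * R) * (R * R))%type => green (toC x.1) (toC x.2)).
Proof.
pose a (x : ((R * R) * (R * R))%type) : R := x.1.1.
pose b (x : ((R * R) * (R * R))%type) : R := x.1.2.
pose c (x : ((R * R) * (R * R))%type) : R := x.2.1.
pose e (x : ((R * R) * (R * R))%type) : R := x.2.2.
have ma : measurable_fun setT a by exact: (measurableT_comp measurable_fst measurable_fst).
have mb : measurable_fun setT b by exact: (measurableT_comp measurable_snd measurable_fst).
have mc : measurable_fun setT c by exact: (measurableT_comp measurable_fst measurable_snd).
have me : measurable_fun setT e by exact: (measurableT_comp measurable_snd measurable_snd).
rewrite (_ : (fun x => _) = (fun x => if (a x == c x) && (b x == e x) then +oo%E else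
  (ln (cmod (1 - conjc (toC x.2) * toC x.1) * cmod (toC x.1 - toC x.2) `^ (-1)))%:E)); last first.
  apply/funext => x; rewrite /green /toC /a /b /c /e eq_complex /=.
  case: ifPn => // ne; congr (ln _)%:E.
  by rewrite cmodM cmodV powR_inv1 ?cmod_ge0.
apply: measurable_fun_ifT.
- by apply: measurable_and; apply: measurable_fun_eqr.
- exact: measurable_cst.
apply/measurable_EFinP; apply: (measurableT_comp (@measurable_ln R)).
apply: measurable_funM; [|apply: (measurableT_comp (@measurable_powR R (-1)))].
- apply: measurable_cmod.
  + rewrite (_ : (fun x => _) = (fun x => 1 - (c x * a x + e x * b x))); last first.
      by apply/funext => x; rewrite cReB cReM /= mulNr opprK.
    by apply: measurable_funB => //; apply: measurable_funD; apply: measurable_funM.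
  + rewrite (_ : (fun x => _) = (fun x => e x * a x - c x * b x)); last first.
      apply/funext => x; rewrite cImB cImM /= /a /b /c /e; ring.
    by apply: measurable_funB; apply: measurable_funM.
- apply: measurable_cmod.
  + rewrite (_ : (fun x => _) = (fun x => a x - c x)); last by apply/funext => x; rewrite cReB.
    exact: measurable_funB.
  + rewrite (_ : (fun x => _) = (fun x => b x - e x)); last by apply/funext => x; rewrite cImB.
    exact: measurable_funB.
Qed.

(** Outside the disc the Green formula can be negative; truncation gives a nonnegative kernel, so
    that Tonelli's theorem and Fatou's lemma apply, without changing it on the disc. *)
Definition gpos (p q : R * R) : \bar R := maxe 0%E (green (toC p) (toC q)).

Lemma measurable_gpos : measurable_fun [set: ((R * R) * (R * R))%type]
  (fun x : ((R * R) * (R * R))%type => gpos x.1 x.2).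
Proof. exact: measurable_maxe (measurable_cst _) measurable_green. Qed.

Lemma gpos_ge0 p q : (0 <= gpos p q)%E.
Proof. by rewrite /gpos le_max lexx. Qed.

Lemma green_gpos p q : cmod (toC p) < 1 -> cmod (toC q) < 1 ->
  green (toC p) (toC q) = gpos p q.
Proof.
move=> p1 q1; rewrite /gpos max_r//.
have [->|pq] := eqVneq (toC p) (toC q); first by rewrite /green eqxx leey.
by rewrite green_kap// lee_fin kap_ge0.
Qed.

Lemma measurable_Ddisc : measurable [set p : (R * R)%type | cmod (toC p) < 1].
Proof.
have m : measurable_fun [set: (R * R)%type] (fun p : R * R => cmod (toC p)).
  by apply: measurable_cmod => /=; [exact: measurable_fst|exact: measurable_snd].
rewrite (_ : [set p | _] = setT `&` (fun p : R * R => cmod (toC p)) @^-1` `]-oo, 1[%classic).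
  by apply: m => //; exact: measurable_itv.
by apply/seteqP; split => p /=; rewrite in_itv /= => // -[].
Qed.

Lemma energy_distribution d (X : measurableType d) (P : probability X R)
  (T : {mfun X >-> (R * R)%type}) :
  (forall t, cmod (toC (T t)) < 1) ->
  energy (distribution P T) = (\int[P]_t \int[P]_u gpos (T t) (T u))%E.
Proof.
move=> TD; rewrite /energy; set mu := distribution P T.
pose N := ~` [set p : (R * R)%type | cmod (toC p) < 1].
have mN : measurable N by apply: measurableC; exact: measurable_Ddisc.
have muN : mu N = 0%E.
  rewrite /mu /distribution /pushforward (_ : T @^-1` N = set0) ?measure0//.
  by apply/seteqP; split => // t; rewrite /N /=; have := TD t.
have mg1 p : measurable_fun [set: (R * R)%type] (fun q : R * R => green (toC p) (toC q)).
  exact: (measurable_fun_pair2 p measurable_green).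
have mp1 p : measurable_fun [set: (R * R)%type] (gpos p).
  exact: (measurable_fun_pair2 p measurable_gpos).
have inner p : cmod (toC p) < 1 ->
    (\int[mu]_q green (toC p) (toC q) = \int[mu]_q gpos p q)%E.
  move=> p1; apply: ae_eq_integral => //.
  exists N; split => // q /= /not_implyP[_ h]; rewrite /N /= => q1; apply: h.
  exact: green_gpos.
(* The untruncated kernel has no sign, so its partial integral is measured as the difference of
   those of its positive and negative parts. *)
have mF : measurable_fun [set: (R * R)%type]
    (fun p : R * R => \int[mu]_q green (toC p) (toC q))%E.
  pose g (x : ((R * R) * (R * R))%type) := green (toC x.1) (toC x.2).
  have mP : measurable_fun setT (fun p : R * R => \int[mu]_q (g^\+ (p, q)))%E.
    apply: (@measurable_fun_fubini_tonelli_F _ _ _ _ _ mu (g^\+)%E).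
      exact: measurable_funepos measurable_green.
    exact: funepos_ge0.
  have mQ : measurable_fun setT (fun p : R * R => \int[mu]_q (g^\- (p, q)))%E.
    apply: (@measurable_fun_fubini_tonelli_F _ _ _ _ _ mu (g^\-)%E).
      exact: measurable_funeneg measurable_green.
    exact: funeneg_ge0.
  rewrite [X in measurable_fun _ X](_ : _ = ((fun p : R * R => \int[mu]_q (g^\+ (p, q)))
    \- (fun p : R * R => \int[mu]_q (g^\- (p, q))))%E).
    exact: emeasurable_funB.
  apply/funext => p; rewrite [LHS]integralE /=.
  by congr (_ - _)%E; apply: eq_integral => q _; rewrite ?funeposE ?funenegE.
have mG : measurable_fun [set: (R * R)%type] (fun p : R * R => \int[mu]_q gpos p q)%E.
  apply: (@measurable_fun_fubini_tonelli_F _ _ _ _ _ mu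
    (fun x : ((R * R) * (R * R))%type => gpos x.1 x.2)).
    exact: measurable_gpos.
  by move=> x; exact: gpos_ge0.
transitivity (\int[mu]_p \int[mu]_q gpos p q)%E.
  apply: (@ae_eq_integral _ _ _ mu setT (fun p => \int[mu]_q gpos p q)%E) => //.
  exists N; split => // p /= /not_implyP[_ h]; rewrite /N /= => p1; apply: h.
  exact: inner.
rewrite ge0_integral_distribution//; last first.
  by move=> p; apply: integral_ge0 => q _; exact: gpos_ge0.
apply: eq_integral => t _ /=.
by rewrite ge0_integral_distribution// => q; exact: gpos_ge0.
Qed.

End GreenMeasurable.

Section StepIntegral.
Variable R : realType.
Local Notation C := R[i].
Local Notation mu := (@lebesgue_measure R).
Implicit Types (s : seq C) (t : R).

Lemma limn_esup_ub (u : nat -> \bar R) (q : \bar R) N :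
  (forall n, (N <= n)%N -> (u n <= q)%E) -> (limn_esup u <= q)%E.
Proof.
move=> uq; apply: le_trans (_ : (ereal_sup (u @` [set k | (N <= k)%N]) <= _)%E).
  by apply: ereal_inf_lbound; exists [set k | (N <= k)%N] => //; exists N.
by apply: ge_ereal_sup => _ [n /= Nn <-]; exact: uq.
Qed.

Lemma limn_einf_lb (u : nat -> \bar R) (q : \bar R) N :
  (forall n, (N <= n)%N -> (q <= u n)%E) -> (q <= limn_einf u)%E.
Proof.
move=> uq; rewrite /limn_einf leeNr; apply: (@limn_esup_ub _ _ N) => n Nn.
by rewrite leeN2 uq.
Qed.

Lemma limn_einf_ub (u : nat -> \bar R) (q : \bar R) :
  (forall n, (u n <= q)%E) -> (limn_einf u <= q)%E.
Proof.
move=> uq; apply: le_trans (limn_einf_sup u) _.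
by apply: (@limn_esup_ub _ _ 0) => n _; exact: uq.
Qed.

Definition cell s i : set R := `[i%:R / (size s)%:R, i.+1%:R / (size s)%:R[%classic.

Lemma bin_cell s t i : (0 < size s)%N -> 0 <= t -> (bin s t == i) = (t \in cell s i).
Proof.
move=> s0 t0; have n0 : 0 < (size s)%:R :> R by rewrite ltr0n.
rewrite /bin truncn_eq ?mulr_ge0// mem_setE /cell in_itv /=.
by rewrite ler_pdivrMr// ltr_pdivlMr// mulrC.
Qed.

Lemma measurable_bin s (d : measure_display) (T : measurableType d) (h : nat -> T) :
  (0 < size s)%N -> measurable_fun (`[0, 1[%classic : set R) (fun t => h (bin s t)).
Proof.
move=> s0 mD Y mY.
rewrite (_ : _ `&` _ = \bigcup_(i in [set i | Y (h i)]) (`[0, 1[%classic `&` cell s i)).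
  by apply: bigcup_measurable => i _; apply: measurableI => //; exact: measurable_itv.
apply/seteqP; split => t /=.
  move=> [tD Yt]; exists (bin s t) => //; split => //.
  by apply/set_mem; rewrite -bin_cell//; move: tD; rewrite in_itv /= => /andP[].
move=> [i /= Yi [tD ti]]; split => //; suff /eqP -> : bin s t == i by [].
rewrite bin_cell//; first exact: mem_set.
by move: tD; rewrite in_itv /= => /andP[].
Qed.

Lemma integral_bin s (h : nat -> R) : (0 < size s)%N ->
  (forall i, (i < size s)%N -> 0 <= h i) ->
  (\int[mu]_(t in `[0%R, 1%R[) (h (bin s t))%:E =
   ((\sum_(i < size s) h i) / (size s)%:R)%:E)%E.
Proof.
move=> s0 h0; have n0 : 0 < (size s)%:R :> R by rewrite ltr0n.
transitivity (\int[mu]_(t in `[0%R, 1%R[)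
    (\sum_(i < size s) (h i * \1_(cell s i) t)%:E))%E.
  apply: eq_integral => t; rewrite inE /= in_itv /= => t01; have /andP[t0 t1] := t01.
  have b := bin_lt s0 t01; rewrite sumEFin; congr EFin.
  rewrite (bigD1 (Ordinal b))//= big1 ?addr0.
    by rewrite indicE -bin_cell// eqxx mulr1.
  move=> i; rewrite -val_eqE /= indicE -bin_cell// eq_sym => /negbTE ->.
  by rewrite mulr0.
rewrite ge0_integral_sum//; last 2 first.
  by move=> i; apply/measurable_EFinP; apply: measurable_funM => //; apply: measurable_indic; exact: measurable_itv.
  by move=> i t _; rewrite lee_fin mulr_ge0// h0.
rewrite mulr_suml -sumEFin; apply: eq_bigr => i _.
under eq_integral do rewrite EFinM.
rewrite ge0_integralZl//; last 2 first.
  by apply/measurable_EFinP; apply: measurable_indic; exact: measurable_itv.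
  by rewrite lee_fin h0.
rewrite integral_indic//; last exact: measurable_itv.
rewrite EFinM; congr (_ * _)%E.
rewrite (_ : cell s i `&` _ = cell s i); last first.
  apply/setIidPl => t; rewrite /cell /= !in_itv /= => /andP[h1 h2]; apply/andP; split.
    by apply: le_trans h1; rewrite divr_ge0.
  apply: lt_le_trans h2 _; rewrite ler_pdivrMr// mul1r ler_nat; exact: ltn_ord.
have := @lebesgue_measure_itv R `[i%:R / (size s)%:R, i.+1%:R / (size s)%:R[.
rewrite /= lte_fin ltr_pM2r ?invr_gt0// ltr_nat ltnSn => E; rewrite /cell; apply: etrans E _.
by rewrite -EFinB -mulrBl -natr1 addrAC subrr add0r mul1r.
Qed.

Lemma integral_uniform01 (f : R -> \bar R) : measurable_fun setT f ->
  (forall x, 0 <= f x)%E ->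
  (\int[uniform_prob (@ltr01 R)]_x f x = \int[mu]_(x in `[0%R, 1%R[) f x)%E.
Proof.
move=> mf f0; rewrite integral_uniform// subr0 invr1 mul1e.
rewrite integral_itv_bndo_bndc//.
by apply: measurable_funS mf.
Qed.

End StepIntegral.

(** * Discrete energies and semicontinuity of the Green kernel *)

Section LimitMeasure.
Variable R : realType.
Local Notation C := R[i].
Local Notation mu := (@lebesgue_measure R).
Implicit Types (s : seq C) (t u : R) (z w : C).

Definition seq_energy s : R := \sum_(a <- s) \sum_(b <- s | b != a) kap a b.

(** The kernel in terms of indices, with zero diagonal; its mean over all index pairs is the
    discrete energy divided by the squared number of points. *)
Definition pair_kap s (i j : nat) : R :=
  if i == j then 0 else kap (nth 0 s i) (nth 0 s j).

Lemma seq_energyE s : uniq s ->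
  seq_energy s = \sum_(i < size s) \sum_(j < size s) pair_kap s i j.
Proof.
move=> us; rewrite /seq_energy (big_nth 0) big_mkord; apply: eq_bigr => i _.
rewrite (big_nth 0) big_mkord big_mkcond /=; apply: eq_bigr => j _.
by rewrite nth_uniq// /pair_kap [in RHS]eq_sym; case: eqP.
Qed.

Lemma pair_kap_ge0 s i j : uniq s -> (forall z, z \in s -> cmod z < 1) ->
  (i < size s)%N -> (j < size s)%N -> 0 <= pair_kap s i j.
Proof.
move=> us sD si sj; rewrite /pair_kap; case: eqP => // /eqP ij.
by apply: kap_ge0; rewrite ?nth_uniq//; apply: sD; exact: mem_nth.
Qed.

(** The hypothesis is kept free of quotients and covers z0 = w0. A displacement of both points by
    less than [d] changes numerator and denominator by at most 2 d each, whence the divisor 2 + 2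
    E. *)
Lemma bl_lt_near (z0 w0 : C) (E : R) : 0 < E -> cmod z0 <= 1 -> cmod w0 < 1 ->
  cmod (z0 - w0) < E * cmod (1 - conjc w0 * z0) ->
  exists2 d : R, 0 < d & forall z w, cmod z < 1 -> cmod w < 1 ->
    cmod (z - z0) < d -> cmod (w - w0) < d -> cmod (bl w z) < E.
Proof.
move=> E0 z01 w01 lt0.
have g0 : 0 < E * cmod (1 - conjc w0 * z0) - cmod (z0 - w0) by rewrite subr_gt0.
exists ((E * cmod (1 - conjc w0 * z0) - cmod (z0 - w0)) / (2 + 2 * E)).
  by rewrite divr_gt0// addr_gt0// mulr_gt0.
move=> z w z1 w1; rewrite !ltr_pdivlMr ?addr_gt0 ?mulr_gt0//.
set D := cmod (1 - _) in g0 *; set X := cmod (z0 - w0) in g0 *.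
have := cmod_ge0 (z - z0); have := cmod_ge0 (w - w0).
set p := cmod (z - z0); set q := cmod (w - w0) => q0 p0 hp hq.
have A1 : cmod (z - w) <= X + p + q.
  have -> : z - w = (z0 - w0) + (z - z0) - (w - w0) by ring.
  apply: le_trans (cmodD _ _) _; rewrite cmodN lerD2r; exact: cmodD.
have A2 : D - p - q <= cmod (1 - conjc w * z).
  have -> : 1 - conjc w * z = (1 - conjc w0 * z0) + - (conjc w * (z - z0) + conjc (w - w0) * z0).
    by rewrite rmorphB /=; ring.
  apply: le_trans (cmodBD _ _); rewrite cmodN -addrA lerD2l -opprD lerN2.
  apply: le_trans (cmodD _ _) _; rewrite !cmodM !cmod_conj; apply: lerD.
    by rewrite ler_piMl// ltW.
  by rewrite ler_piMr.
have n0 := bl_den_neq0 w1 z1.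
rewrite /bl cmodM cmodV ltr_pdivrMr ?cmod_gt0//.
apply: le_lt_trans A1 _; apply: (@lt_le_trans _ _ (E * (D - p - q))); last first.
  by rewrite ler_pM2l.
nra.
Qed.

Lemma quant_neq s t u : uniq s -> bin s t != bin s u -> (0 < size s)%N ->
  0 <= t < 1 -> 0 <= u < 1 -> quant s t != quant s u.
Proof. by move=> us tu s0 t01 u01; rewrite nth_uniq// bin_lt. Qed.

Lemma bin_neq s t u : 0 <= t -> 0 <= u -> 1 < (size s)%:R * `|t - u| -> bin s t != bin s u.
Proof.
move=> t0 u0; apply: contraTneq => e.
have h1 := truncn_itv (mulr_ge0 (ler0n R (size s)) t0).
have h2 := truncn_itv (mulr_ge0 (ler0n R (size s)) u0).
move: h1 h2; rewrite -/(bin s t) -/(bin s u) e -natr1 => h1 h2.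
rewrite -leNgt -{1}(ger0_norm (ler0n R (size s))) -normrM mulrBr ler_norml.
by apply/andP; split; lra.
Qed.

End LimitMeasure.

Section LimitEnergy.
Variable R : realType.
Local Notation C := R[i].
Local Notation mu := (@lebesgue_measure R).
Implicit Types (t u : R) (z w : C).

(* The weak limit of the empirical measures of [s l] is realised as the law of [zlim] under
   the uniform measure on [0, 1]: the points are listed in Morton order, and convergence of
   the distribution functions of all cells makes the quantile maps converge outside the
   countable set [bad]. *)
Section Quantiles.
Variables (U : set C) (r v : R) (s : nat -> seq C) (c : nat -> nat -> R).
Hypothesis r01 : 0 <= r < 1.
Hypothesis U_r : forall z, U z -> cmod z <= r.
Hypothesis s_uniq : forall l, uniq (s l).
Hypothesis s_gt : forall l, (l < size (s l))%N.
Hypothesis s_near : forall l z, z \in s l ->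
  exists2 w, U w & cmod (z - w) < (1 - r) / l.+2%:R.
Hypothesis s_sorted : forall l, exists2 k, (l <= k)%N &
  sorted (fun z w => (mcode k z <= mcode k w)%N) (s l).
Hypothesis s_cdf : forall m j l, (pickle (m, j) <= l)%N ->
  `|ecdf (s l) m j - c m j| < l.+1%:R^-1.
Hypothesis s_energy : forall l, seq_energy (s l) <= (size (s l))%:R ^+ 2 * v.

Let s0 l : (0 < size (s l))%N. Proof. exact: leq_ltn_trans (s_gt l). Qed.

Lemma quant_seq_D l z : z \in s l -> cmod z < 1.
Proof.
have r1 := r01.
move=> /s_near[w /U_r wr zw]; have := cmodD (z - w) w; rewrite subrK => h.
apply: le_lt_trans h _; apply: lt_le_trans (ltr_leD zw wr) _.
rewrite -lerBrDr ler_pdivrMr// ler_peMr//; first lra.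
by rewrite ler1n.
Qed.

Definition bad : set R := range (fun x : nat * nat => c x.1 x.2).
Definition good : set R := `[0, 1[%classic `\` bad.

Lemma countable_bad : countable bad.
Proof. exact: sub_countable (card_image_le _ _) (countableP _). Qed.

Lemma measurable_bad : measurable bad.
Proof. by apply: countable_measurable countable_bad => t; exact: measurable_set1. Qed.

Lemma measurable_good : measurable good.
Proof. by apply: measurableD => //; exact: measurable_bad. Qed.

Lemma good_itv t : good t -> 0 <= t < 1.
Proof. by move=> [/=]; rewrite in_itv. Qed.

Lemma good_c t : good t -> forall m j, t != c m j.
Proof. by move=> [_ nb] m j; apply/eqP => e; apply: nb; exists (m, j). Qed.

Variable z0 : C.
Hypothesis Uz0 : U z0.

(** On the null set where the quantiles may diverge the limit is given the value [z0], a point of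
    [U], so that it stays in the closure of [U] for every [t]. *)
Lemma zlim_exists t : exists z, if t \in good then
  ((fun l => Re (quant (s l) t)) @ \oo --> Re z /\
   (fun l => Im (quant (s l) t)) @ \oo --> Im z) else z = z0.
Proof.
case: (boolP (t \in good)) => [/set_mem gt|_]; last by exists z0.
exact: (quant_cvg s_gt quant_seq_D s_sorted s_cdf (good_itv gt) (good_c gt)).
Qed.

Definition zlim t : C := projT1 (cid (zlim_exists t)).

Lemma zlim_good t : good t ->
  (fun l => Re (quant (s l) t)) @ \oo --> Re (zlim t) /\
  (fun l => Im (quant (s l) t)) @ \oo --> Im (zlim t).
Proof.
by move=> gt; have := projT2 (cid (zlim_exists t)); rewrite -/(zlim t) mem_set.
Qed.

Lemma zlim_bad t : ~ good t -> zlim t = z0.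
Proof.
move=> gt; have := projT2 (cid (zlim_exists t)); rewrite -/(zlim t) ifF//.
by apply/negbTE; rewrite notin_setE.
Qed.

Lemma zlim_near t (e : R) : good t -> 0 < e ->
  exists L, forall l, (L <= l)%N -> cmod (quant (s l) t - zlim t) < e.
Proof.
move=> gt e0; have [/cvgrPdist_lt c1 /cvgrPdist_lt c2] := zlim_good gt.
have e2 : 0 < e / 2 by rewrite divr_gt0.
have [L1 _ h1] := c1 _ e2; have [L2 _ h2] := c2 _ e2.
exists (maxn L1 L2) => l; rewrite geq_max => /andP[l1 l2].
apply: le_lt_trans (cmod_le_ReIm _) _; rewrite cReB cImB.
have := h1 l l1; have := h2 l l2; rewrite /= distrC => a1; rewrite distrC => a2.
lra.
Qed.

(** For large [l] the quantile is close both to its limit and to [U], as the neighbourhoods shrink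
    with [l]. *)
Lemma zlim_U t (e : R) : 0 < e -> exists2 w, U w & cmod (zlim t - w) < e.
Proof.
move=> e0; have [gt|/zlim_bad ->] := pselect (good t); last first.
  by exists z0 => //; rewrite subrr cmod0.
have r1 := r01.
have e2 : 0 < e / 2 by rewrite divr_gt0.
have [L hL] := zlim_near gt e2.
have [K hK] := inv_lt_eventually e2.
pose l := maxn L K.
have [w Uw qw] := s_near (quant_mem (s0 l) (good_itv gt)).
exists w => //; have h1 := hK l (leq_maxr _ _); have := hL l (leq_maxl _ _).
rewrite (cmodB (quant _ _)) => h2.
have -> : zlim t - w = (zlim t - quant (s l) t) + (quant (s l) t - w) by ring.
apply: le_lt_trans (cmodD _ _) _.
have : (1 - r) / l.+2%:R <= l.+1%:R^-1.
  apply: le_trans (_ : l.+2%:R^-1 <= _).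
    by rewrite ler_piMl ?invr_ge0//; lra.
  by rewrite lef_pV2 ?posrE// ler_nat.
move=> h3; rewrite [e in _ < e](_ : e = e / 2 + e / 2); last by field.
exact: ltrD h2 (lt_trans (lt_le_trans qw h3) h1).
Qed.

Lemma zlim_r t : cmod (zlim t) <= r.
Proof.
apply/ler_addgt0Pl => e e0; have [w /U_r wr h] := zlim_U t e0.
have := cmodD (zlim t - w) w; rewrite subrK; lra.
Qed.

Lemma zlim_D t : cmod (zlim t) < 1.
Proof. by have := zlim_r t; have := r01; lra. Qed.

Definition tlim t : R * R := toRR (zlim t).

Lemma toC_tlim t : toC (tlim t) = zlim t.
Proof. by rewrite /tlim; case: (zlim t). Qed.

Lemma measurable_quant (h : C -> R) l :
  measurable_fun good (fun t => h (quant (s l) t)).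
Proof.
have := measurable_bin (fun i => h (nth 0 (s l) i)) (s0 l).
by apply: measurable_funS => //; exact: subDsetl.
Qed.

Lemma measurable_tlim : measurable_fun setT tlim.
Proof.
have piece (f : R -> R) (x0 : R) : measurable_fun good f ->
    (forall t, ~ good t -> f t = x0) -> measurable_fun setT f.
  move=> mf fb; rewrite -(setUv good); apply/measurable_funU.
  - exact: measurable_good.
  - by apply: measurableC; exact: measurable_good.
  - split => //; apply: (eq_measurable_fun (cst x0)) => // t.
    by rewrite inE /= => gt; rewrite fb.
apply/measurable_fun_pairP; split.
- apply: (piece _ (Re z0)) => [|t /zlim_bad]; last by rewrite /= => ->.
  apply: (measurable_fun_cvg (fun l => measurable_quant (@complex.Re R) l)).
  by move=> t gt; have [] := zlim_good gt.
- apply: (piece _ (Im z0)) => [|t /zlim_bad]; last by rewrite /= => ->.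
  apply: (measurable_fun_cvg (fun l => measurable_quant (@complex.Im R) l)).
  by move=> t gt; have [] := zlim_good gt.
Qed.

(** For distinct [t] and [u] the bins eventually differ, since the number of points grows; the
    discrete kernel is then the true one, and lower semicontinuity of the Green function applies. *)
Lemma kap_liminf t u : good t -> good u -> t != u ->
  (gpos (tlim t) (tlim u) <=
   limn_einf (fun l => (pair_kap (s l) (bin (s l) t) (bin (s l) u))%:E))%E.
Proof.
move=> gt gu tu; have t01 := good_itv gt; have u01 := good_itv gu.
rewrite -green_gpos ?toC_tlim ?zlim_D//.
(* The hypothesis says that the Green function exceeds [M] at the limit points when they differ;
   when they coincide it holds for every [M], which handles the value +oo. *)
have key (M : R) : cmod (zlim t - zlim u) < expR (- M) * cmod (1 - conjc (zlim u) * zlim t) ->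
    (M%:E <= limn_einf (fun l => (pair_kap (s l) (bin (s l) t) (bin (s l) u))%:E))%E.
  move=> lt0.
  have [d d0 hd] := bl_lt_near (expR_gt0 _) (ltW (zlim_D t)) (zlim_D u) lt0.
  have [L1 h1] := zlim_near gt d0; have [L2 h2] := zlim_near gu d0.
  have tu0 : 0 < `|t - u| by rewrite normr_gt0 subr_eq0.
  have [L3 h3] := inv_lt_eventually tu0.
  apply: (@limn_einf_lb _ _ _ (maxn L1 (maxn L2 L3))) => l.
  rewrite !geq_max => /and3P[l1 l2 l3].
  have bn : bin (s l) t != bin (s l) u.
    apply: bin_neq; [by case/andP: t01|by case/andP: u01|].
    rewrite mulrC -ltr_pdivrMr ?ltr0n// div1r; apply: le_lt_trans (h3 l l3).
    by rewrite lef_pV2 ?posrE ?ltr0n// ler_nat.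
  rewrite lee_fin /pair_kap (negbTE bn) -/(quant _ _) -/(quant _ _).
  have qt := quant_D s_gt quant_seq_D l t01; have qu := quant_D s_gt quant_seq_D l u01.
  have qq := quant_neq (s_uniq l) bn (s0 l) t01 u01.
  rewrite /kap lerNr -ler_expR lnK ?posrE ?cmod_bl_gt0//.
  exact/ltW/hd/h2/l2/(h1 _ l1).
have [e|ne] := eqVneq (zlim t) (zlim u).
  rewrite e /green eqxx leye_eq; apply/eqP/eqyP => M M0; apply: key.
  rewrite e subrr cmod0 mulr_gt0 ?expR_gt0// cmod_gt0.
  by apply: bl_den_neq0; exact: zlim_D.
rewrite green_kap ?zlim_D//; apply/lee_addgt0Pr => e e0.
apply: (@le_trans _ _ ((kap (zlim t) (zlim u) - e)%:E + e%:E)%E).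
  by rewrite -EFinD subrK.
apply: leeD2r; apply: key.
have n0 := bl_den_neq0 (zlim_D u) (zlim_D t).
rewrite -ltr_pdivrMr ?cmod_gt0// -cmodV -cmodM -/(bl _ _).
rewrite /kap opprB opprK expRD lnK ?posrE ?cmod_bl_gt0 ?zlim_D//.
by rewrite ltr_pMl ?cmod_bl_gt0 ?zlim_D// expR_gt1.
Qed.

Lemma ae_good : {ae mu, forall t, `[0, 1[%classic t -> good t}.
Proof.
exists bad; split; [exact: measurable_bad|exact: countable_lebesgue_measure0 countable_bad|].
by move=> t /= /not_implyP[t01 ng]; apply: contrapT => nb; apply: ng.
Qed.

Lemma measurable_row l : measurable_fun (`[0, 1[%classic : set R)
  (fun t => \int[mu]_(u in `[0%R, 1%R[) (pair_kap (s l) (bin (s l) t) (bin (s l) u))%:E)%E.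
Proof.
exact: (measurable_bin (fun i =>
  \int[mu]_(u in `[0%R, 1%R[) (pair_kap (s l) i (bin (s l) u))%:E)%E (s0 l)).
Qed.

Lemma integral_pair_kap l :
  (\int[mu]_(t in `[0%R, 1%R[) \int[mu]_(u in `[0%R, 1%R[)
    (pair_kap (s l) (bin (s l) t) (bin (s l) u))%:E <= v%:E)%E.
Proof.
have n0 : 0 < (size (s l))%:R :> R by rewrite ltr0n.
have pk i j : (i < size (s l))%N -> (j < size (s l))%N -> 0 <= pair_kap (s l) i j.
  by move=> il jl; apply: pair_kap_ge0 => // z; exact: quant_seq_D.
have -> : (\int[mu]_(t in `[0%R, 1%R[) \int[mu]_(u in `[0%R, 1%R[)
    (pair_kap (s l) (bin (s l) t) (bin (s l) u))%:E)%E =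
  (\int[mu]_(t in `[0%R, 1%R[)
    ((fun i => (\sum_(j < size (s l)) pair_kap (s l) i j) / (size (s l))%:R) (bin (s l) t))%:E)%E.
  apply: eq_integral => t; rewrite inE /= in_itv /= => t01.
  by rewrite integral_bin// => j jl; apply: pk => //; exact: bin_lt.
rewrite (integral_bin (s0 l) (h := (fun i => (\sum_(j < size (s l)) pair_kap (s l) i j) / (size (s l))%:R))); last first.
  move=> i il; rewrite divr_ge0// sumr_ge0// => j _; exact: pk.
rewrite lee_fin -mulr_suml -seq_energyE// -mulrA -invfM ler_pdivrMr ?mulr_gt0//.
by rewrite mulrC -expr2.
Qed.

(** Fatou's lemma is applied to the inner integral, then to the outer one; at each stage the
    discrete double integral is at most [v]. *)
Lemma zlim_energy : (\int[mu]_(t in `[0%R, 1%R[) \int[mu]_(u in `[0%R, 1%R[)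
   gpos (tlim t) (tlim u) <= v%:E)%E.
Proof.
pose a l t u := (pair_kap (s l) (bin (s l) t) (bin (s l) u))%:E.
have pk l t u : `[0, 1[%classic t -> `[0, 1[%classic u -> (0 <= a l t u)%E.
  rewrite /= !in_itv /= => t01 u01; rewrite lee_fin.
  by apply: pair_kap_ge0; rewrite ?bin_lt// => z; exact: quant_seq_D.
have m2 : measurable_fun [set: (R * R)%type] (fun x => gpos (tlim x.1) (tlim x.2)).
  have mT2 : measurable_fun [set: (R * R)%type] (fun x : R * R => (tlim x.1, tlim x.2)).
    apply: measurable_fun_pair.
      exact: (measurableT_comp measurable_tlim measurable_fst).
    exact: (measurableT_comp measurable_tlim measurable_snd).
  exact: (measurableT_comp (@measurable_gpos R) mT2).
have mg t : measurable_fun (`[0, 1[%classic : set R) (fun u => gpos (tlim t) (tlim u)).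
  apply: measurable_funS (measurable_fun_pair2 t m2) => //.
have ma l t : measurable_fun (`[0, 1[%classic : set R) (a l t).
  apply/measurable_EFinP.
  exact: (measurable_bin (fun j => pair_kap (s l) (bin (s l) t) j) (s0 l)).
have mli (d : measure_display) (T : measurableType d) (D : set T) (f : (T -> \bar R)^nat) :
    (forall n, measurable_fun D (f n)) -> measurable_fun D (fun x => limn_einf (f^~ x)).
  move=> mf; apply: (measurableT_comp (@oppe_measurable R setT)).
  apply: measurable_fun_limn_esup => n; exact: (measurableT_comp (@oppe_measurable R setT)).
have li0 (x : nat -> \bar R) : (forall l, 0 <= x l)%E -> (0 <= limn_einf x)%E.
  by move=> x0; apply: (@limn_einf_lb _ _ _ 0) => l _.
pose b l t := (\int[mu]_(u in `[0%R, 1%R[) a l t u)%E.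
have b0 l t : `[0, 1[%classic t -> (0 <= b l t)%E.
  by move=> t01; apply: integral_ge0 => u u01; exact: pk.
have mb l : measurable_fun (`[0, 1[%classic : set R) (b l) by exact: measurable_row.
have step1 t : good t -> (\int[mu]_(u in `[0%R, 1%R[) gpos (tlim t) (tlim u) <=
    limn_einf (b^~ t))%E.
  move=> gt; apply: le_trans (fatou mu _ (fun l => ma l t) _) => //.
    apply: ae_ge0_le_integral => //.
    - by move=> u _; exact: gpos_ge0.
    - exact: mg.
    - move=> u u01; apply: li0 => l; apply: pk => //=; rewrite in_itv /=; exact: good_itv.
    - by apply: mli => l; exact: ma.
    (* The point [t] joins the exceptional set because the bins of [t] and [u] separate only for u
       different from t. *)
    - exists (bad `|` [set t]); split.
      + by apply: measurableU; [exact: measurable_bad|exact: measurable_set1].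
      + apply: countable_lebesgue_measure0.
        rewrite (_ : _ `|` _ = range (fun o : option (nat * nat) =>
          if o is Some x then c x.1 x.2 else t)).
          exact: sub_countable (card_image_le _ _) (countableP _).
        apply/seteqP; split => x /=.
          by move=> [[y _ <-]|->]; [exists (Some y)|exists None].
        by move=> [[y|] _ <-]; [left; exists y|right].
      + move=> u /= /not_implyP[u01 nle]; apply: contrapT => /not_orP[nb ut]; apply: nle.
        by apply: kap_liminf => //; apply/eqP => tu; apply: ut.
  by move=> l u u01; apply: pk => //=; rewrite in_itv /=; exact: good_itv.
apply: (@le_trans _ _ (\int[mu]_(t in `[0%R, 1%R[) limn_einf (b^~ t))%E).
  apply: ae_ge0_le_integral => //.
  - by move=> t _; apply: integral_ge0 => u _; exact: gpos_ge0.
  (* Measurability of the inner integral is taken from Tonelli's theorem for the uniform probability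
     and transferred to Lebesgue measure on [0, 1[. *)
  - have mG := @measurable_fun_fubini_tonelli_F _ _ _ _ _ (uniform_prob (@ltr01 R))
      (fun x : R * R => gpos (tlim x.1) (tlim x.2)) m2 (fun x => gpos_ge0 _ _).
    apply: (@measurable_funS _ _ _ _ setT) => //.
    apply: (eq_measurable_fun _ _ mG) => t _; rewrite /fubini_F integral_uniform01//.
      exact: (measurable_fun_pair2 t m2).
    by move=> u; exact: gpos_ge0.
  - by move=> t t01; apply: li0 => l; exact: b0.
  - exact: mli.
  - have [N [mN N0 hN]] := ae_good; exists N; split => // t /= /not_implyP[t01 nle].
    by apply: hN => /= h; apply: nle; exact: step1 (h t01).
apply: le_trans (fatou mu _ mb _) _ => //.
by apply: limn_einf_ub => l; exact: integral_pair_kap.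
Qed.

Lemma quantile_measure : exists P : probability (R * R)%type R,
  P (~` closure (@toRR R @` U)) = 0%E /\ (energy P <= v%:E)%E.
Proof.
have mT : @measurable_fun _ _ (measurableTypeR R) (R * R)%type setT tlim.
  exact: measurable_tlim.
pose T : {mfun (measurableTypeR R) >-> (R * R)%type} :=
  @mfun_Sub _ _ (measurableTypeR R) (R * R)%type tlim (mem_set mT).
exists (distribution (uniform_prob (@ltr01 R)) T); split.
  transitivity (uniform_prob (@ltr01 R) (T @^-1` (~` closure (@toRR R @` U)))) => //.
  rewrite (_ : _ @^-1` _ = set0) ?measure0//.
  (* No [t] at all is mapped outside the closure of [U], so the preimage is empty and not merely
     null. *)
  apply/seteqP; split => // t /=; apply => B /nbhs_ballP[e /= e0 eB].
  have [w Uw h] := zlim_U t e0; exists (toRR w); split; first by exists w.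
  apply: eB; split; rewrite /ball /=.
    by apply: le_lt_trans h; rewrite -cReB; exact: normr_Re_le.
  by apply: le_lt_trans h; rewrite -cImB; exact: normr_Im_le.
rewrite energy_distribution; last by move=> t; rewrite toC_tlim; exact: zlim_D.
have m2 : measurable_fun [set: (R * R)%type] (fun x => gpos (tlim x.1) (tlim x.2)).
  have mT2 : measurable_fun [set: (R * R)%type] (fun x : R * R => (tlim x.1, tlim x.2)).
    apply: measurable_fun_pair.
      exact: (measurableT_comp measurable_tlim measurable_fst).
    exact: (measurableT_comp measurable_tlim measurable_snd).
  exact: (measurableT_comp (@measurable_gpos R) mT2).
have mG := @measurable_fun_fubini_tonelli_F _ _ _ _ _ (uniform_prob (@ltr01 R))
      (fun x : R * R => gpos (tlim x.1) (tlim x.2)) m2 (fun x => gpos_ge0 _ _).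
rewrite integral_uniform01//; last first.
  by move=> t; apply: integral_ge0 => u _; exact: gpos_ge0.
apply: le_trans zlim_energy; rewrite le_eqVlt; apply/orP; left; apply/eqP.
apply: eq_integral => t _; rewrite integral_uniform01//.
  exact: (measurable_fun_pair2 t m2).
by move=> u; exact: gpos_ge0.
Qed.

End Quantiles.

End LimitEnergy.

(** * Points with a small Blaschke product *)

Section GoodPoints.
Variable R : realType.
Local Notation C := R[i].
Implicit Types (z w : C) (U : set C) (r v : R).

Definition nbh U (d : R) : set C := [set z | exists2 w, U w & cmod (z - w) < d].

Lemma seq_energy_codom n (z : 'I_n -> C) : injective z ->
  seq_energy [seq z i | i <- enum 'I_n] = fek_energy z.
Proof.
move=> iz; rewrite /seq_energy big_map big_enum /=; apply: eq_bigr => i _.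
rewrite big_map big_enum_cond /=; apply: eq_bigl => j.
by rewrite (inj_eq iz).
Qed.

Lemma fek_energy_ge0 n (z : 'I_n -> C) : injective z -> (forall i, cmod (z i) < 1) ->
  0 <= fek_energy z.
Proof.
move=> iz zD; apply: sumr_ge0 => i _; apply: sumr_ge0 => j ji.
by apply: kap_ge0; rewrite ?(inj_eq iz) // eq_sym.
Qed.

Lemma seq_energy_perm (s s' : seq C) : perm_eq s s' -> seq_energy s = seq_energy s'.
Proof.
move=> ss'; rewrite /seq_energy (perm_big _ ss') /=; apply: eq_bigr => a _.
by rewrite (perm_big _ ss').
Qed.

(** A neighbourhood contains arbitrarily many distinct points even when [U] is a single point; this
    makes the extremal problem nonempty. *)
Lemma nbh_inj U (d : R) z0 n : U z0 -> 0 < d ->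
  exists2 z : 'I_n -> C, injective z & forall i, nbh U d (z i).
Proof.
move=> Uz0 d0; exists (fun i : 'I_n => z0 + (d / i.+2%:R)%:C%C).
  move=> i j /addrI/complexI /(mulfI (lt0r_neq0 d0)) /invr_inj /eqP.
  by rewrite eqr_nat => /eqP[] /val_inj.
move=> i; exists z0 => //; rewrite addrAC subrr add0r cmod_real ger0_norm.
  by rewrite ltr_pdivrMr// ltr_pMr// ltr1n.
by rewrite divr_ge0// ltW.
Qed.

Lemma compact_closure_disc U r : r <= 1 -> (forall z, U z -> cmod z <= r) ->
  compact (closure (@toRR R @` U)).
Proof.
move=> r1 Ur.
have cbox : compact (`[-1, 1]%classic `*` `[-1, 1]%classic : set (R * R)%type).
  by apply: compact_setX; exact: segment_compact.
apply: (subclosed_compact _ cbox); first exact: closed_closure.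
have cl : closed (`[-1, 1]%classic `*` `[-1, 1]%classic : set (R * R)%type).
  by apply: compact_closed cbox; exact: norm_hausdorff.
rewrite [X in _ `<=` X](proj1 (closure_id _) cl).
apply: closure_subset => _ [z Uz <-]; split; rewrite /= in_itv /= -ler_norml.
  by apply: le_trans (normr_Re_le _) (le_trans (Ur _ Uz) r1).
by apply: le_trans (normr_Im_le _) (le_trans (Ur _ Uz) r1).
Qed.

(** The radius [d] is the same for all large N. Its negation therefore gives, for every radius (1 -
    r) / (k + 2), arbitrarily large N without good points, which is what lets sizes grow while
    neighbourhoods shrink. *)
Lemma good_points U r v z0 : 0 <= r < 1 -> (forall z, U z -> cmod z <= r) -> U z0 ->
  (v%:E < Vgreen (closure (@toRR R @` U)))%E ->
  exists d : R, [/\ 0 < d, r + d < 1 & exists N0, forall N, (N0 <= N)%N ->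
    exists z : 'I_N -> C, [/\ injective z, forall i, nbh U d (z i) &
      forall w, nbh U d w -> \prod_i cmod (bl (z i) w) <= 2 * expR (- (N%:R * v))]].
Proof.
move=> r01 Ur Uz0 vV; apply: contrapT => no.
have dk k : 0 < (1 - r) / k.+2%:R by rewrite divr_gt0//; lra.
have dk1 k : r + (1 - r) / k.+2%:R < 1.
  rewrite -ltrBrDl ltr_pdivrMr// ltr_pMr ?ltr1n//; lra.
have nbD k z : nbh U ((1 - r) / k.+2%:R) z -> cmod z < 1.
  move=> [w /Ur wr zw]; have := cmodD (z - w) w; rewrite subrK.
  by move: (dk1 k) zw; move: ((1 - r) / _) => D d1 zw h; lra.
have ex k : exists s : seq C, [/\ uniq s, (k < size s)%N,
    forall z, z \in s -> nbh U ((1 - r) / k.+2%:R) z &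
    seq_energy s <= (size s)%:R ^+ 2 * v].
  have {}no : ~ (exists N0, forall N, (N0 <= N)%N ->
      exists z : 'I_N -> C, [/\ injective z, forall i, nbh U ((1 - r) / k.+2%:R) (z i) &
      forall w, nbh U ((1 - r) / k.+2%:R) w ->
        \prod_i cmod (bl (z i) w) <= 2 * expR (- (N%:R * v))]).
    by move=> h; apply: no; exists ((1 - r) / k.+2%:R); split.
  have [N kN nN] : exists2 N, (k.+1 <= N)%N &
      ~ exists z : 'I_N -> C, [/\ injective z, forall i, nbh U ((1 - r) / k.+2%:R) (z i) &
      forall w, nbh U ((1 - r) / k.+2%:R) w ->
        \prod_i cmod (bl (z i) w) <= 2 * expR (- (N%:R * v))].
    apply: contrapT => h; apply: no; exists k.+1 => N kN; apply: contrapT => h'.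
    by apply: h; exists N.
  have [//|[z [iz zn ze]]] := @fekete R (nbh U ((1 - r) / k.+2%:R)) N v (nbD k) (nbh_inj _ Uz0 (dk k)).
  exists [seq z i | i <- enum 'I_N.+1]; split.
  - by rewrite map_inj_uniq ?enum_uniq.
  - by rewrite size_map size_enum_ord; apply: leq_trans kN _.
  - by move=> _ /mapP[i _ ->].
  - rewrite seq_energy_codom// size_map size_enum_ord.
    have e0 := fek_energy_ge0 iz (fun i => nbD k _ (zn i)).
    have N0 : 0 < N%:R :> R by rewrite ltr0n (leq_trans _ kN).
    (* [v] is not assumed nonnegative; the energy of the points is, which permits replacing N (N +
       1) by (N + 1)^2. *)
    have v0 : 0 <= v.
      have := le_trans e0 ze; rewrite pmulr_rge0// pmulr_rge0//.
    apply: le_trans ze _; rewrite expr2 -mulrA ler_pM2l// ler_wpM2r//.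
    by rewrite ler_nat.
have [s hs] := choice ex.
(* Energy and size are unaffected by reordering; the Morton order is what makes the quantiles
   converge. *)
pose s' k := sort (fun z w => (mcode k z <= mcode k w)%N) (s k).
have [sub [c [subl hc]]] := select_cdf s'.
have ps l : perm_eq (s' l) (s l) by rewrite /s' perm_sort.
have [P [PK Pe]] : exists P : probability (R * R)%type R,
    P (~` closure (@toRR R @` U)) = 0%E /\ (energy P <= v%:E)%E.
  apply: (@quantile_measure R U r v (fun l => s' (sub l)) c r01 Ur _ _ _ _ hc _ z0 Uz0).
  - by move=> l; rewrite (perm_uniq (ps _)); have [] := hs (sub l).
  - move=> l; rewrite (perm_size (ps _)); have [_ h _ _] := hs (sub l).
    exact: leq_ltn_trans (subl l) h.
  - move=> l z; rewrite (perm_mem (ps _)); have [_ _ h _] := hs (sub l).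
    move=> /h[w Uw zw]; exists w => //; apply: lt_le_trans zw _.
    apply: ler_wpM2l; first by lra.
    by rewrite lef_pV2 ?posrE// ler_nat !ltnS.
  - move=> l; exists (sub l) => //; apply: sort_sorted => z w.
    exact: leq_total.
  - move=> l; rewrite (seq_energy_perm (ps _)) (perm_size (ps _)).
    by have [] := hs (sub l).
have : (Vgreen (closure (@toRR R @` U)) <= energy P)%E.
  apply: ereal_inf_lbound; exists P => //; exists (closure (@toRR R @` U)).
  by split; [apply: (@compact_closure_disc _ r) => //; lra|split].
by move=> /le_trans/(_ Pe); rewrite leNgt vV.
Qed.

End GoodPoints.

(** * The weighted Dirichlet space *)

Section RadialIntegral.
Variable R : realType.
Local Notation C := R[i].
Local Notation mu := (@lebesgue_measure R).
Variable omega : R -> R.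
Hypothesis om_adm : admissible_weight omega.

Let om_cont : {within `[0, 1[, continuous omega}. Proof. by case: om_adm. Qed.
Let om_gt0 (x : R) : 0 <= x < 1 -> 0 < omega x. Proof. by case: om_adm => _ [h _]; exact: h. Qed.
Let om_int : mu.-integrable `[0, 1[ (EFin \o omega). Proof. by case: om_adm => _ []. Qed.

Definition om_mass : \bar R := (\int[mu]_(x in `[0%R, 1%R[) (omega x)%:E)%E.

Lemma measurable_omega : measurable_fun (`[0, 1[%classic : set R) omega.
Proof. by apply/measurable_EFinP; case/integrableP: om_int. Qed.

Lemma om_mass_lty : (om_mass < +oo)%E.
Proof.
case/integrableP: om_int => _; apply: le_lt_trans; rewrite /om_mass.
apply: ge0_le_integral => //.
- by move=> x /=; rewrite in_itv /= => /om_gt0/ltW; rewrite lee_fin.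
- by apply/measurable_EFinP; exact: measurable_omega.
- by apply: measurableT_comp => //; apply/measurable_EFinP; exact: measurable_omega.
- by move=> x _; rewrite /= lee_fin ler_norm.
Qed.

Lemma om_mass_ge0 : (0 <= om_mass)%E.
Proof.
by apply: integral_ge0 => x /=; rewrite in_itv /= => /om_gt0/ltW; rewrite lee_fin.
Qed.

Section Chord.
Variables (c X : R).
Hypothesis c0 : 0 <= c.
Hypothesis cX : c <= X.
Hypothesis Xc : X ^+ 2 + c ^+ 2 < 1.

Let F (x : R) : R := Num.sqrt (x ^+ 2 + c ^+ 2).

Lemma chord_itv x : `|x| <= X -> 0 <= F x < 1.
Proof.
move=> xX; rewrite sqrtr_ge0 /= -[ltRHS]sqrtr1 ltr_sqrt//.
apply: le_lt_trans Xc; rewrite lerD2r -(real_normK (num_real x)).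
by rewrite lerXn2r ?nnegrE//; exact: le_trans cX.
Qed.

Lemma chord_cont x : {for x, continuous F}.
Proof.
rewrite (_ : F = @Num.sqrt R \o (fun x => x ^+ 2 + c ^+ 2))//.
apply: continuous_comp; last exact: sqrt_continuous.
by apply: continuousD; [exact: exprn_continuous|exact: cst_continuous].
Qed.

Lemma chord_within (A : set R) : A `<=` [set x | `|x| <= X] ->
  {within A, continuous (fun x => omega (F x))}.
Proof.
move=> AX; apply: (@continuous_subspaceW _ _ A [set x | `|x| <= X]) => //.
apply/subspace_continuousP => x xX.
have /subspace_continuousP/(_ (F x)) := om_cont.
have Fx := chord_itv xX.
rewrite /= in_itv /= Fx => /(_ isT) h.
apply: cvg_comp h.
move=> P HP; have H := @chord_cont x _ HP.
apply: (@filterS _ (nbhs x) _ _ _ _ H) => y hy yX.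
by apply: hy; rewrite /= in_itv /=; exact: chord_itv.
Qed.

(** Substitution of r = sqrt(x^2 + c^2): for x >= c one has r <= 2 x, so dx <= 2 dr. *)
Lemma chord_integral :
  (\int[mu]_(x in `[c, X]) (omega (F x))%:E <= 2%:E * om_mass)%E.
Proof.
have cX' : c <= X := cX.
have XX : `|X| <= X by rewrite ger0_norm//; exact: le_trans cX.
have mW (A : set R) : measurable A -> A `<=` [set x | `|x| <= X] ->
    measurable_fun A (fun x => (omega (F x))%:E).
  by move=> mA AX; apply/measurable_EFinP; apply: subspace_continuous_measurable_fun => //; exact: chord_within.
have sub : (`[c, X]%classic : set R) `<=` [set x | `|x| <= X].
  by move=> x /=; rewrite in_itv /= => /andP[h1 h2]; rewrite ger0_norm//; exact: le_trans h1.
have [c00|c00] := eqVneq c 0.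
  apply: (@le_trans _ _ om_mass); last first.
    by rewrite lee_pemull ?om_mass_ge0// lee_fin ler1n.
  have -> : (\int[mu]_(x in `[c, X]) (omega (F x))%:E = \int[mu]_(x in `[c, X]) (omega x)%:E)%E.
    apply: eq_integral => x; rewrite inE /= in_itv /= => /andP[h1 h2].
    by rewrite /F c00 expr0n addr0 sqrtr_sqr ger0_norm//; exact: le_trans h1.
  apply: ge0_subset_integral => //.
  - by apply/measurable_EFinP; exact: measurable_omega.
  - by move=> x /=; rewrite in_itv /= => /om_gt0/ltW; rewrite lee_fin.
  - move=> x /=; rewrite !in_itv /= => /andP[h1 h2]; apply/andP; split; first exact: le_trans h1.
    have x0 : 0 <= x by exact: le_trans h1.
    have : X ^+ 2 < 1 by move: Xc; rewrite c00 expr0n addr0.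
    rewrite expr_lt1// ?(le_trans x0)// => ?; exact: le_lt_trans h2 _.
have cp : 0 < c by rewrite lt_def c00.
have Fpos x : 0 < x ^+ 2 + c ^+ 2 by rewrite ltr_wpDl ?sqr_ge0// exprn_gt0.
have Fgt0 x : 0 < F x by rewrite sqrtr_gt0.
have dF (x : R) : is_derive x 1 F (x / F x).
  have h1 : is_derive x 1 (fun y : R => y ^+ 2 + c ^+ 2) (2 * x).
    by apply: is_derive_eq; rewrite addr0 /GRing.scale /= mulr1 mulrDl mul1r.
  have h2 := @is_derive1_sqrt R _ (Fpos x).
  have := @is_derive1_comp R (@Num.sqrt R) (fun y => y ^+ 2 + c ^+ 2) x _ _ h2 h1.
  rewrite (_ : _ * _ = x / F x)//; rewrite /F; field.
  by rewrite gt_eqF// sqrtr_gt0.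
have dFE : (derive1 F) = fun x => x / F x.
  by apply/funext => x; rewrite derive1E; exact: (@derive_val _ _ _ _ _ _ _ (dF x)).
have cdF x : {for x, continuous (derive1 F)}.
  rewrite dFE; apply: continuousM; first exact: cvg_id.
  by apply: continuousV; [rewrite gt_eqF|exact: chord_cont].
have incF : {in `[c, X] &, {homo F : x y / x < y}}.
  move=> x y; rewrite !in_itv /= => /andP[x1 _] _ xy.
  have x0 : 0 <= x by exact: le_trans x1.
  by rewrite ltr_sqrt// ltrD2r ltrXn2r// ?nnegrE//; lra.
have subs := @integration_by_substitution_increasing R F omega c X cX incF.
apply: (@le_trans _ _ (2%:E * \int[mu]_(x in `[F c, F X]) (omega x)%:E)%E); last first.
  apply: lee_wpmul2l; first by rewrite lee_fin.
  apply: ge0_subset_integral => //.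
  - by apply/measurable_EFinP; exact: measurable_omega.
  - by move=> x /=; rewrite in_itv /= => /om_gt0/ltW; rewrite lee_fin.
  - move=> x /=; rewrite !in_itv /= => /andP[h1 h2]; apply/andP; split.
      exact: le_trans (ltW (Fgt0 c)) h1.
    apply: le_lt_trans h2 _; by have /andP[_] := chord_itv XX.
rewrite subs; last 5 first.
- by move=> x _; exact: cdF.
- apply/cvg_ex; exists ((derive1 F) c); apply: cvg_at_right_filter; exact: cdF.
- apply/cvg_ex; exists ((derive1 F) X); apply: cvg_at_left_filter; exact: cdF.
- split => [x _||]; first exact: (@ex_derive _ _ _ _ _ _ _ (dF x)).
    apply: cvg_at_right_filter; exact: chord_cont.
  apply: cvg_at_left_filter; exact: chord_cont.
- apply: continuous_subspaceW om_cont => x /=; rewrite !in_itv /= => /andP[h1 h2].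
  apply/andP; split; first exact: le_trans (ltW (Fgt0 c)) h1.
  apply: le_lt_trans h2 _; by have /andP[_] := chord_itv XX.
have om0 x : `[c, X]%classic x -> 0 <= omega (F x).
  by move=> /sub xX; apply/ltW/om_gt0/chord_itv.
have mFd : measurable_fun (`[c, X]%classic : set R) (fun x => omega (F x) * derive1 F x).
  apply: measurable_funM; first by apply/measurable_EFinP; exact: mW.
  by apply: measurable_funS (continuous_measurable_fun _) => //; exact: cdF.
rewrite -ge0_integralZl//; last 2 first.
- exact/measurable_EFinP.
- move=> x xi; rewrite lee_fin mulr_ge0//; first exact: om0.
  rewrite dFE divr_ge0// ?ltW//; move: xi; rewrite /= in_itv /= => /andP[h _].
  exact: lt_le_trans h.
apply: ge0_le_integral => //.
- exact: mW.
- apply: measurable_funeM; exact/measurable_EFinP.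
move=> x xi; rewrite -EFinM lee_fin mulrCA ler_peMr//; first exact: om0.
rewrite dFE mulrA ler_pdivlMr// mul1r.
move: xi; rewrite /= in_itv /= => /andP[h _].
have x0 : 0 < x by exact: lt_le_trans h.
rewrite -(@ler_pXn2r _ 2)// ?nnegrE ?mulr_ge0// ?sqrtr_ge0 ?(ltW x0)//.
rewrite sqr_sqrtr; last exact/ltW/Fpos.
rewrite exprMn.
have : c ^+ 2 <= x ^+ 2 by rewrite lerXn2r ?nnegrE// ltW.
have := sqr_ge0 x; lra.
Qed.

End Chord.

End RadialIntegral.

(** * Integrability of the radial weight on the disc *)

Section DiscIntegral.
Variable R : realType.
Local Notation C := R[i].
Local Notation mu := (@lebesgue_measure R).
Local Notation T2 := (measurableTypeR R * measurableTypeR R)%type.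
Variable omega : R -> R.
Hypothesis om_adm : admissible_weight omega.

Let om_gt0 (x : R) : 0 <= x < 1 -> 0 < omega x. Proof. by case: om_adm => _ [h _]; exact: h. Qed.

Definition disc : set T2 := [set p | Dset (toC p)].

Lemma measurable_disc : measurable disc.
Proof. exact: measurable_Ddisc. Qed.

Lemma measurable_cmodT (D : set T2) : measurable_fun D (fun p : T2 => cmod (toC p)).
Proof.
apply: measurable_cmod => /=; first exact: (measurable_funTS measurable_fst).
exact: (measurable_funTS measurable_snd).
Qed.

Lemma measurable_radial : measurable_fun disc (fun p : T2 => omega (cmod (toC p))).
Proof.
rewrite (_ : (fun p => _) = omega \o (fun p : T2 => cmod (toC p)))//.
apply: (@measurable_comp _ _ _ _ _ _ (`[0, 1[%classic : set R)).
- exact: measurable_itv.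
- by move=> _ [p Dp <-]; rewrite /= in_itv /= cmod_ge0.
- exact: measurable_omega.
- exact: measurable_cmodT.
Qed.

Lemma measurable_true : measurable [set true].
Proof. by []. Qed.

(* On [sector] the map x -> sqrt (x^2 + y^2) has derivative at least 1/2 in modulus along
   horizontal chords, which reduces the area integral of a radial function to a line integral. *)
Definition sector (s : R) : set T2 :=
  [set p | `|p.2| <= `|p.1| /\ cmod (toC p) <= s].

Definition sectorT (s : R) : set T2 :=
  [set p | `|p.1| <= `|p.2| /\ cmod (toC p) <= s].

Lemma measurable_sector s : measurable (sector s) /\ measurable (sectorT s).
Proof.
have m1 : measurable_fun [set: T2] (fun p : T2 => `|p.1|).
  by apply: measurableT_comp; [exact: normr_measurable|exact: measurable_fst].
have m2 : measurable_fun [set: T2] (fun p : T2 => `|p.2|).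
  by apply: measurableT_comp; [exact: normr_measurable|exact: measurable_snd].
have m3 : measurable [set p : T2 | cmod (toC p) <= s].
  have := @measurable_cmodT setT measurableT _ (measurable_itv `]-oo, s]).
  by rewrite setTI; congr measurable; apply/seteqP; split => p /=; rewrite in_itv.
split.
  rewrite (_ : sector s = [set p | `|p.2| <= `|p.1|] `&` [set p : T2 | cmod (toC p) <= s])//.
  apply: measurableI => //; have := measurable_fun_ler m2 m1 measurableT measurable_true.
  by rewrite setTI; apply.
rewrite (_ : sectorT s = [set p | `|p.1| <= `|p.2|] `&` [set p : T2 | cmod (toC p) <= s])//.
apply: measurableI => //; have := measurable_fun_ler m1 m2 measurableT measurable_true.
by rewrite setTI; apply.
Qed.

Lemma sector_disc s : s < 1 -> sector s `<=` disc /\ sectorT s `<=` disc.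
Proof. by move=> s1; split => p [_ ps]; rewrite /disc /Dset /=; exact: le_lt_trans s1. Qed.

Definition chord_dist (y x : R) : R := Num.sqrt (x ^+ 2 + `|y| ^+ 2).
Definition chord_set (s y : R) : set R :=
  [set x | `|y| <= `|x| /\ chord_dist y x <= s].

Lemma section_integral (s y : R) : s < 1 ->
  (\int[mu]_(x in chord_set s y) (omega (chord_dist y x))%:E <= (4%:E * om_mass omega))%E.
Proof.
move=> s1; rewrite /chord_dist; set c := `|y|; set S := chord_set s y.
have c0 : 0 <= c by exact: normr_ge0.
have Fx (x : R) : 0 <= Num.sqrt (x ^+ 2 + c ^+ 2) by exact: sqrtr_ge0.
have W0 := om_mass_ge0 om_adm.
have [S0|/set0P[x1 Sx1]] := eqVneq S set0.
  by rewrite S0 integral_set0 mule_ge0// lee_fin.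
have key x : S x -> c <= `|x| /\ x ^+ 2 + c ^+ 2 <= s ^+ 2.
  move=> [h1 h2]; split => //; rewrite -(@ler_sqrt _ _ (s ^+ 2)) ?sqr_ge0// sqrtr_sqr.
  by apply: le_trans h2 _; exact: ler_norm.
(* The section lies in two symmetric intervals between [c] and [X] in modulus; each contributes at
   most twice the mass of the weight. *)
pose X := Num.sqrt (s ^+ 2 - c ^+ 2).
have s0 : 0 <= s by case: Sx1 => _ h; exact: le_trans (Fx x1) h.
have hX x : S x -> `|x| <= X.
  by move=> /key[_ h]; rewrite -[`|x|]sqrtr_sqr ler_wsqrtr// lerBrDr.
have cX : c <= X by have [h _] := key _ Sx1; exact: le_trans h (hX _ Sx1).
have sc : 0 <= s ^+ 2 - c ^+ 2.
  by have [_ h] := key _ Sx1; rewrite subr_ge0; apply: le_trans h; rewrite lerDr sqr_ge0.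
have Xc : X ^+ 2 + c ^+ 2 < 1 by rewrite sqr_sqrtr// subrK expr_lt1.
have sub : S `<=` `[- X, - c]%classic `|` `[c, X]%classic.
  move=> x Sx; have h1 := hX _ Sx; have [h2 _] := key _ Sx; rewrite /= !in_itv /=.
  by have [x0|x0] := leP 0 x; [right; rewrite ger0_norm in h1 h2|
     left; rewrite ltr0_norm in h1 h2]; lra.
have inX (A : set R) x : A `<=` [set x | `|x| <= X] -> A x -> (0 <= (omega (Num.sqrt (x ^+ 2 + c ^+ 2)))%:E)%E.
  by move=> AX /AX xX; rewrite lee_fin; apply/ltW/om_gt0/(chord_itv c0 cX Xc).
have mW (A : set R) : measurable A -> A `<=` [set x | `|x| <= X] ->
    measurable_fun A (fun x => (omega (Num.sqrt (x ^+ 2 + c ^+ 2)))%:E).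
  move=> mA AX; apply/measurable_EFinP; apply: subspace_continuous_measurable_fun => //.
  exact: (chord_within om_adm c0 cX Xc).
have B1 : `[- X, - c]%classic `<=` [set x : R | `|x| <= X].
  by move=> x /=; rewrite in_itv /= => ?; rewrite ler_norml; lra.
have B2 : `[c, X]%classic `<=` [set x : R | `|x| <= X].
  by move=> x /=; rewrite in_itv /= => ?; rewrite ler_norml; lra.
have B12 : `[- X, - c]%classic `|` `[c, X]%classic `<=` [set x : R | `|x| <= X].
  by move=> x [/B1|/B2].
have mS : measurable S.
  have mF : measurable_fun [set: R] (fun x => Num.sqrt (x ^+ 2 + c ^+ 2)).
    by apply: continuous_measurable_fun => x; exact: chord_cont.
  have mN : measurable_fun [set: R] (fun x : R => `|x|) by exact: normr_measurable.
  rewrite (_ : S = [set x | c <= `|x|] `&` [set x | Num.sqrt (x ^+ 2 + c ^+ 2) <= s])//.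
  apply: measurableI.
    by have := measurable_fun_ler (measurable_cst c) mN measurableT measurable_true; rewrite setTI; apply.
  by have := measurable_fun_ler mF (measurable_cst s) measurableT measurable_true; rewrite setTI; apply.
pose A : set (measurableTypeR R) := `[- X, - c]%classic `|` `[c, X]%classic.
pose f (x : R) := (omega (Num.sqrt (x ^+ 2 + c ^+ 2)))%:E.
apply: (@le_trans _ _ (\int[mu]_(x in A) f x)%E).
  apply: ge0_subset_integral => //.
  - exact: measurableU.
  - by apply: mW => //; exact: measurableU.
  - by move=> x; exact: inX.
have H1 := chord_integral om_adm c0 cX Xc.
pose I1 : interval R := `[- X, - c].
have H2 : (\int[mu]_(x in [set` I1]) f x <= 2%:E * om_mass omega)%E.
  rewrite /I1 /f (integration_by_substitution_oppr cX (chord_within om_adm c0 cX Xc B1)).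
  apply: le_trans H1; rewrite le_eqVlt; apply/orP; left; apply/eqP.
  by apply: eq_integral => x _ /=; rewrite sqrrN.
rewrite /A -(setDUK (@subsetUl _ `[- X, - c]%classic `[c, X]%classic)) ge0_integral_setU//.
- have -> : (4%:E * om_mass omega = 2%:E * om_mass omega + 2%:E * om_mass omega)%E.
    by rewrite -ge0_muleDl ?lee_fin// -EFinD -natrD.
  apply: leeD => //; apply: le_trans H1; apply: ge0_subset_integral => //.
  + by apply: measurableD => //; exact: measurableU.
  + exact: mW.
  + by move=> x; exact: inX.
  + by move=> x [[]].
- by apply: measurableD => //; exact: measurableU.
- by apply: mW; rewrite setDUK//; exact: measurableU.
- by move=> x; rewrite setDUK//; exact: inX.
- by rewrite disj_set2E; apply/eqP/seteqP; split => x // [? []].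
Qed.

Lemma sector_integral s : s < 1 ->
  (\int[@area R]_(p in sector s) (omega (cmod (toC p)))%:E <= 8%:E * om_mass omega)%E /\
  (\int[@area R]_(p in sectorT s) (omega (cmod (toC p)))%:E <= 8%:E * om_mass omega)%E.
Proof.
move=> s1; have [mS mT] := measurable_sector s; have [sD tD] := sector_disc s1.
have W0 := om_mass_ge0 om_adm.
have mf (A : set T2) : measurable A -> A `<=` disc ->
    measurable_fun [set: T2] ((fun p : T2 => (omega (cmod (toC p)))%:E) \_ A).
  move=> mA AD; apply/(measurable_restrictT _ mA); apply/measurable_EFinP.
  exact: measurable_funS measurable_disc AD measurable_radial.
have f0 (A : set T2) p : A `<=` disc -> (0 <= ((fun p : T2 => (omega (cmod (toC p)))%:E) \_ A) p)%E.
  move=> AD; apply: erestrict_ge0 => q /AD Dq; rewrite lee_fin ltW// om_gt0// cmod_ge0 /=.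
  exact: Dq.
have mI : measurable (`[-1, 1]%classic : set (measurableTypeR R)) by exact: measurable_itv.
(* Slices are empty beyond |y| = 1, so the constant 8 is the length 2 of [-1, 1] times the slice
   bound 4. *)
have bound (h : R -> \bar R) : measurable_fun [set: measurableTypeR R] h ->
    (forall y, 0 <= h y)%E -> (forall y, h y <= 4%:E * om_mass omega)%E ->
    (forall y, 1 < `|y| -> h y = 0%E) -> (\int[mu]_y h y <= 8%:E * om_mass omega)%E.
  move=> mh h0 h4 hz.
  have -> : (\int[mu]_y h y = \int[mu]_(y in `[(-1)%R, 1%R]) h y)%E.
    rewrite [RHS]integral_mkcond; apply: eq_integral => y _.
    rewrite patchE; case: ifPn => // /negP yI; apply: hz; rewrite ltNge; apply/negP => y1.
    by apply: yI; rewrite inE /= in_itv /= -ler_norml.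
  apply: (@le_trans _ _ (\int[mu]_(y in `[(-1)%R, 1%R]) cst (4%:E * om_mass omega) y)%E).
    apply: ge0_le_integral => //.
    exact: measurable_funS mh.
  rewrite integral_cst//= lebesgue_measure_itv /= lte_fin ifT; last lra.
  rewrite (_ : (1%:E - (-1)%:E)%E = 2%:E); last by rewrite -EFinB; congr EFin; ring.
  by rewrite muleAC -EFinM -natrM.
have sy (x y : R) : cmod (toC (x, y)) = chord_dist y x.
  by rewrite /cmod /chord_dist /= real_normK ?num_real.
have sx (x y : R) : cmod (toC (x, y)) = chord_dist x y.
  by rewrite /cmod /chord_dist /= real_normK ?num_real// addrC.
have large y (S : set R) (h : R -> \bar R) : 1 < `|y| ->
    S `<=` chord_set s y ->
    (\int[mu]_(x in S) h x = 0)%E.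
  move=> y1 SS; rewrite (_ : S = set0) ?integral_set0//.
  apply/seteqP; split => // x /SS[_ h1].
  have : `|y| <= chord_dist y x.
    by rewrite -[leLHS]ger0_norm// -sqrtr_sqr ler_wsqrtr// lerDr sqr_ge0.
  by move: y1 h1 s1; move: (chord_dist y x) (`|y|) => q z; clear => *; lra.
split.
- rewrite integral_mkcond (fubini_tonelli2 _ (mf _ mS sD)); last by move=> p; exact: f0.
  have E y : fubini_G mu ((fun p : T2 => (omega (cmod (toC p)))%:E) \_ (sector s)) y =
    (\int[mu]_(x in chord_set s y) (omega (chord_dist y x))%:E)%E.
    rewrite [RHS]integral_mkcond; apply: eq_integral => x _ /=.
    by rewrite !patchE -sy; congr (if _ then _ else _); apply/idP/idP; rewrite !inE /sector /= sy.
  apply: bound.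
  + exact: (measurable_fun_fubini_tonelli_G _ (mf _ mS sD) (fun p => f0 _ p sD)).
  + by move=> y; apply: integral_ge0 => x _; exact: f0.
  + by move=> y; rewrite E; exact: section_integral.
  + by move=> y y1; rewrite E; exact: (large _ _ _ y1 (@subset_refl _ _)).
- rewrite integral_mkcond (fubini_tonelli1 _ (mf _ mT tD)); last by move=> p; exact: f0.
  have E y : fubini_F mu ((fun p : T2 => (omega (cmod (toC p)))%:E) \_ (sectorT s)) y =
    (\int[mu]_(x in chord_set s y) (omega (chord_dist y x))%:E)%E.
    rewrite [RHS]integral_mkcond; apply: eq_integral => x _ /=.
    by rewrite !patchE -sx; congr (if _ then _ else _); apply/idP/idP; rewrite !inE /sectorT /= sx.
  apply: bound.
  + exact: (measurable_fun_fubini_tonelli_F _ (mf _ mT tD) (fun p => f0 _ p tD)).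
  + by move=> y; apply: integral_ge0 => x _; exact: f0.
  + by move=> y; rewrite E; exact: section_integral.
  + by move=> y y1; rewrite E; exact: (large _ _ _ y1 (@subset_refl _ _)).
Qed.

(** On discs of radius 1 - 1/(n + 1) the two sectors give the uniform bound 16 times the mass, and
    monotone convergence passes to the unit disc. Finiteness puts the identity, and hence [phi],
    into [H]. *)
Lemma disc_integral_lty :
  (\int[@area R]_(p in disc) (omega (cmod (toC p)))%:E < +oo)%E.
Proof.
pose sn (n : nat) : R := 1 - n.+1%:R^-1.
have sn1 n : sn n < 1 by rewrite /sn ltrBlDr ltrDl invr_gt0.
pose F n := sector (sn n) `|` sectorT (sn n).
have mF n : measurable (F n).
  by have [? ?] := measurable_sector (sn n); exact: measurableU.
have FD n : F n `<=` disc.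
  by have [h1 h2] := sector_disc (sn1 n); move=> p [/h1|/h2].
have FE n : F n = [set p | cmod (toC p) <= sn n].
  apply/seteqP; split => p; first by move=> [[]|[]].
  by move=> /= ps; have [h|/ltW h] := leP `|p.2| `|p.1|; [left|right].
have f0 p : disc p -> (0 <= (omega (cmod (toC p)))%:E)%E.
  by move=> Dp; rewrite lee_fin ltW// om_gt0// cmod_ge0.
have mf (A : set T2) : A `<=` disc -> measurable_fun A (fun p : T2 => (omega (cmod (toC p)))%:E).
  move=> AD; apply/measurable_EFinP.
  exact: measurable_funS measurable_disc AD measurable_radial.
have UD : \bigcup_n F n = disc.
  apply/seteqP; split => [p [n _ /FD]//|p Dp].
  have e0 : 0 < 1 - cmod (toC p) by rewrite subr_gt0.
  have [L hL] := inv_lt_eventually e0.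
  exists L => //; rewrite FE /= /sn; have := hL L (leqnn L).
  by move: (L.+1%:R^-1) => q; lra.
have W0 := om_mass_ge0 om_adm.
have bnd n : (\int[@area R]_(p in F n) (omega (cmod (toC p)))%:E <= 16%:E * om_mass omega)%E.
  have [mS mT] := measurable_sector (sn n); have [h1 h2] := sector_integral (sn1 n).
  have [sD tD] := sector_disc (sn1 n).
  rewrite /F -(setDUK (@subsetUl _ (sector (sn n)) (sectorT (sn n)))) ge0_integral_setU//.
  - have -> : (16%:E * om_mass omega = 8%:E * om_mass omega + 8%:E * om_mass omega)%E.
      by rewrite -ge0_muleDl ?lee_fin// -EFinD -natrD.
    apply: leeD => //; apply: le_trans h2; apply: ge0_subset_integral => //.
    + by apply: measurableD => //; exact: measurableU.
    + exact: mf.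
    + by move=> p /tD; exact: f0.
    + by move=> p [[]].
  - by apply: measurableD => //; exact: measurableU.
  - by apply: mf; rewrite setDUK//; exact: FD.
  - by move=> p; rewrite setDUK// => /FD; exact: f0.
  - by rewrite disj_set2E; apply/eqP/seteqP; split => p // [? []].
have nd : nondecreasing_seq F.
  apply/nondecreasing_seqP => n; rewrite subsetEset !FE => p /= /le_trans; apply.
  by rewrite /sn lerD2l lerN2 lef_pV2 ?posrE// ler_nat.
have := @ge0_nondecreasing_set_cvg_integral _ _ _ F
  (fun p : T2 => (omega (cmod (toC p)))%:E) (@area R) nd mF (fun n => mf _ (@FD n))
  (fun n p Fp => f0 p (@FD n p Fp)).
rewrite UD => cv; apply: (@le_lt_trans _ _ (16%:E * om_mass omega)%E); last first.
  by rewrite lte_mul_pinfty// ?lee_fin// om_mass_lty.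
rewrite -(cvg_lim _ cv)//; apply: lime_le; first by apply/cvg_ex; eexists; exact: cv.
by near=> n; exact: bnd.
Unshelve. all: by end_near. Qed.

End DiscIntegral.

Section Dirichlet.
Variable R : realType.
Local Notation C := R[i].
Local Notation mu := (@lebesgue_measure R).
Local Notation T2 := (measurableTypeR R * measurableTypeR R)%type.
Local Notation disc := (@disc R).
Implicit Types (f g h : C -> C) (z w : C).

Definition grid (n : nat) (x : R) : R := (dyad n x)%:R / 2 ^+ n - 1.

Lemma grid_close n (x : R) : -1 <= x -> `|grid n x - x| <= (2 ^+ n)^-1.
Proof.
move=> x1; have p : 0 < 2 ^+ n :> R by rewrite exprn_gt0.
have x0 : 0 <= 2 ^+ n * (x + 1) by apply: mulr_ge0; [exact: ltW|lra].
have := truncn_itv x0; rewrite -/(dyad n x) -[(dyad n x).+1%:R]natr1.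
have -> : (dyad n x)%:R = 2 ^+ n * (grid n x + 1) :> R.
  by rewrite /grid subrK mulrC divfK// gt_eqF.
move: (grid n x) => g h; rewrite -(ler_pM2l p) divff ?gt_eqF// -(ger0_norm (ltW p)) -normrM.
move: h; rewrite ler_norml mulrBr !mulrDr mulr1 => h; lra.
Qed.

Lemma measurable_grid n (k : R -> R -> R) :
  measurable_fun disc (fun p : T2 => k (grid n p.1) (grid n p.2)).
Proof.
move=> mD Y mY; have p0 : 0 < 2 ^+ n :> R by rewrite exprn_gt0.
pose cl (i : nat) : set R := `[i%:R / 2 ^+ n - 1, i.+1%:R / 2 ^+ n - 1[%classic.
have clP i (x : R) : -1 < x -> cl i x <-> dyad n x = i.
  move=> x1; have x0 : 0 <= 2 ^+ n * (x + 1) by apply: mulr_ge0; [exact: ltW|lra].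
  rewrite /cl /= in_itv /= lerBlDr ltrBrDr ler_pdivrMr// ltr_pdivlMr// [_ * 2 ^+ n]mulrC.
  by rewrite -truncn_eq//; split => [/eqP|/eqP].
have D1 (p : T2) : disc p -> -1 < p.1 /\ -1 < p.2.
  move=> Dp; have := Re_lt1 Dp; have := Im_lt1 Dp; rewrite /= !ltr_norml.
  by move=> /andP[-> _] /andP[-> _].
rewrite (_ : _ `&` _ = \bigcup_i \bigcup_(j in [set j : nat |
    Y (k (i%:R / 2 ^+ n - 1) (j%:R / 2 ^+ n - 1))]) (disc `&` (cl i `*` cl j))).
  apply: bigcup_measurable => i _; apply: bigcup_measurable => j _.
  by apply: measurableI => //; apply: measurableX; exact: measurable_itv.
apply/seteqP; split => p /=.
  move=> [Dp Yp]; exists (dyad n p.1) => //; exists (dyad n p.2) => //.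
  by have [h1 h2] := D1 _ Dp; split => //; split; apply/clP.
move=> [i _ [j Yj [Dp [ci cj]]]]; have [h1 h2] := D1 _ Dp; split => //.
by rewrite /grid (proj1 (clP _ _ h1) ci) (proj1 (clP _ _ h2) cj).
Qed.

(** Continuity is known only at points of the disc, so the function is written as a limit of its
    values at dyadic grid points, which form step functions. *)
Lemma measurable_ccont (g : C -> R) :
  (forall z, Dset z -> forall e : R, 0 < e -> exists2 d : R, 0 < d &
     forall w, cmod (w - z) < d -> `|g w - g z| < e) ->
  measurable_fun disc (fun p : T2 => g (toC p)).
Proof.
move=> cg; apply: (measurable_fun_cvg (fun n => @measurable_grid n (fun x y => g (Complex x y)))).
move=> p Dp; apply/cvgrPdist_lt => e e0; have [d d0 hd] := cg _ Dp e e0.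
have d2 : 0 < d / 2 by rewrite divr_gt0.
have [L hL] := inv_lt_eventually d2; exists L => // n /= Ln.
rewrite distrC; apply: hd.
have D1 : -1 <= p.1 /\ -1 <= p.2.
  have := Re_lt1 Dp; have := Im_lt1 Dp; rewrite /= !ltr_norml.
  by move=> /andP[/ltW -> _] /andP[/ltW -> _].
apply: le_lt_trans (cmod_le_ReIm _) _; rewrite cReB cImB /=.
have sm : (2 ^+ n)^-1 < d / 2 :> R.
  apply: le_lt_trans (hL n Ln); rewrite lef_pV2 ?posrE ?exprn_gt0//.
  by rewrite -natrX ler_nat ltn_expl.
have := grid_close n D1.1; have := grid_close n D1.2.
move: sm; move: ((2 ^+ n)^-1) (`|_|) (`|_|) => q a b sm ha hb.
by rewrite [ltRHS]splitr; apply: ltrD; exact: le_lt_trans sm.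
Qed.

Lemma ccont_cmod g z : ccont g z -> forall e : R, 0 < e -> exists2 d : R, 0 < d &
  forall w, cmod (w - z) < d -> `|cmod (g w) - cmod (g z)| < e.
Proof.
move=> cg e e0; have [d d0 hd] := cg e e0; exists d => // w /hd.
have := cmodBD (g w) (g z - g w); have := cmodBD (g z) (g w - g z).
rewrite !subrKC (cmodB (g z)) ltr_norml => h1 h2 h3; apply/andP; split; lra.
Qed.

Definition dfun f z : C := @derive1 _ (C^o) f z.

Lemma dfunP f z : analytic_on_D f -> Dset z -> cder f z (dfun f z).
Proof. exact: analytic_cder. Qed.

Lemma dfunE f z l : cder f z l -> dfun f z = l.
Proof. by move=> /cder_derivable[]. Qed.

Lemma analytic_anD f : analytic_on_D f <-> anD f.
Proof.
split=> [af z Dz|af z Dz]; first by exists (dfun f z); exact: dfunP.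
by have [l /cder_derivable[]] := af z Dz.
Qed.

Lemma anD_dfun f : analytic_on_D f -> anD (dfun f).
Proof.
move=> af z Dz; apply: (cdiff_deriv (Dset_rad Dz)) => w wi.
by apply: dfunP => //; exact: insq_Dset wi.
Qed.

Lemma measurable_dfun f : analytic_on_D f ->
  measurable_fun disc (fun p : T2 => cmod (dfun f (toC p))).
Proof.
move=> af; apply: (@measurable_ccont (fun z => cmod (dfun f z))) => z Dz.
exact/ccont_cmod/cdiff_cont/anD_dfun.
Qed.

Section Weight.
Variable omega : R -> R.
Hypothesis om_adm : admissible_weight omega.

Let om_gt0 (x : R) : 0 <= x < 1 -> 0 < omega x. Proof. by case: om_adm => _ [h _]; exact: h. Qed.

Lemma om_disc_gt0 p : disc p -> 0 < omega (cmod (toC p)).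
Proof. by move=> Dp; apply: om_gt0; rewrite cmod_ge0. Qed.

Definition dens f (p : T2) : \bar R := (cmod (dfun f (toC p)) ^+ 2 * omega (cmod (toC p)))%:E.

Lemma dirichletE f : dirichlet omega f = (\int[@area R]_(p in disc) dens f p)%E.
Proof. by []. Qed.

Lemma measurable_dens f : analytic_on_D f -> measurable_fun disc (dens f).
Proof.
move=> af; apply/measurable_EFinP; apply: measurable_funM; last exact: measurable_radial.
by apply: measurable_funX; exact: measurable_dfun.
Qed.

Lemma dens_ge0 f p : disc p -> (0 <= dens f p)%E.
Proof. by move=> Dp; rewrite lee_fin mulr_ge0 ?sqr_ge0// ltW// om_disc_gt0. Qed.

Lemma dirichlet_ge0 f : (0 <= dirichlet omega f)%E.
Proof. by rewrite dirichletE; apply: integral_ge0 => p; exact: dens_ge0. Qed.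

Lemma dirichlet_le2 f g1 g2 (A B : R) : analytic_on_D f -> analytic_on_D g1 ->
  analytic_on_D g2 -> 0 <= A -> 0 <= B ->
  (forall z, Dset z -> cmod (dfun f z) ^+ 2 <=
     A * cmod (dfun g1 z) ^+ 2 + B * cmod (dfun g2 z) ^+ 2) ->
  (dirichlet omega f <= A%:E * dirichlet omega g1 + B%:E * dirichlet omega g2)%E.
Proof.
move=> af a1 a2 A0 B0 le; rewrite !dirichletE.
have mD := @measurable_disc R.
rewrite -ge0_integralZl ?lee_fin//; [|exact: measurable_dens|exact: dens_ge0].
rewrite -ge0_integralZl ?lee_fin//; [|exact: measurable_dens|exact: dens_ge0].
rewrite -ge0_integralD//; first last.
- by apply: measurable_funeM; exact: measurable_dens.
- by move=> p Dp; apply: mule_ge0; [rewrite lee_fin|exact: dens_ge0].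
- by apply: measurable_funeM; exact: measurable_dens.
- by move=> p Dp; apply: mule_ge0; [rewrite lee_fin|exact: dens_ge0].
apply: ge0_le_integral => //.
- exact: dens_ge0.
- exact: measurable_dens.
- by apply: emeasurable_funD; apply: measurable_funeM; exact: measurable_dens.
move=> p Dp; rewrite /dens -!EFinM -EFinD lee_fin (mulrA A) (mulrA B) -mulrDl.
by apply: ler_wpM2r; [exact/ltW/om_disc_gt0|exact: le].
Qed.

Lemma dirichlet_le f g (A : R) : analytic_on_D f -> analytic_on_D g -> 0 <= A ->
  (forall z, Dset z -> cmod (dfun f z) <= A * cmod (dfun g z)) ->
  (dirichlet omega f <= (A ^+ 2)%:E * dirichlet omega g)%E.
Proof.
move=> af ag A0 le; have A2 : 0 <= A ^+ 2 by exact: sqr_ge0.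
have := @dirichlet_le2 f g g (A ^+ 2) 0 af ag ag A2 (lexx 0).
rewrite mul0e adde0; apply => z Dz; rewrite mul0r addr0 -exprMn.
by rewrite lerXn2r ?nnegrE ?mulr_ge0 ?cmod_ge0// le.
Qed.

Lemma analytic_lin f g (a b : C) : analytic_on_D f -> analytic_on_D g ->
  forall z, Dset z -> cder (fun w => a * f w + b * g w) z (a * dfun f z + b * dfun g z).
Proof.
move=> af ag z Dz.
suff <- : 0 * f z + a * dfun f z + (0 * g z + b * dfun g z) = a * dfun f z + b * dfun g z.
  exact: (cderD (cderM (cder_cst a z) (dfunP af Dz)) (cderM (cder_cst b z) (dfunP ag Dz))).
by move: (dfun f z) (dfun g z) => x y; ring.
Qed.

Lemma cmodD_sqr (u v : C) : cmod (u + v) ^+ 2 <= 2 * cmod u ^+ 2 + 2 * cmod v ^+ 2.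
Proof.
have h := cmodD u v; have h2 : cmod (u + v) ^+ 2 <= (cmod u + cmod v) ^+ 2.
  by rewrite lerXn2r ?nnegrE ?addr_ge0 ?cmod_ge0.
apply: le_trans h2 _; move: (cmod u) (cmod v) => x y.
by have := sqr_ge0 (x - y); rewrite !expr2; lra.
Qed.

Lemma inH_lin f g (a b : C) : inH omega f -> inH omega g ->
  inH omega (fun w => a * f w + b * g w).
Proof.
move=> [af df] [ag dg].
have c0 (x : C) : 0 <= 2 * cmod x ^+ 2 by rewrite mulr_ge0// sqr_ge0.
have al := analytic_lin a b af ag.
have aa : analytic_on_D (fun w => a * f w + b * g w) by exact: cder_analytic al.
split; first exact: aa.
apply: (@le_lt_trans _ _ ((2 * cmod a ^+ 2)%:E * dirichlet omega f +
   (2 * cmod b ^+ 2)%:E * dirichlet omega g)%E).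
  apply: dirichlet_le2 => // z Dz.
  have q (x y : C) : 2 * cmod x ^+ 2 * cmod y ^+ 2 = 2 * cmod (x * y) ^+ 2.
    by rewrite cmodM; ring.
  rewrite (dfunE (al z Dz)) (q a) (q b).
  exact: cmodD_sqr.
have fin (x : C) h : (dirichlet omega h < +oo -> (2 * cmod x ^+ 2)%:E * dirichlet omega h < +oo)%E.
  by move=> dh; apply: lte_mul_pinfty; [rewrite lee_fin; exact: c0| |exact: dh].
by apply: lte_add_pinfty; apply: fin; [exact: df|exact: dg].
Qed.

Lemma inH_cst (a : C) : inH omega (fun=> a).
Proof.
have ac : analytic_on_D (fun _ : C => a) by apply: (@cder_analytic _ _ (fun=> 0)) => z _; exact: cder_cst.
split; first exact: ac. rewrite dirichletE (_ : (\int[_]_(p in _) _)%E = 0%E) ?ltry//.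
apply: integral0_eq => p Dp; rewrite /dens (dfunE (cder_cst a (toC p))) cmod0 expr0n mul0r//.
Qed.

Lemma inH_id : inH omega id.
Proof.
have ai : analytic_on_D (@id C) by apply: (@cder_analytic _ _ (fun=> 1)) => z _; exact: cder_id.
split; first exact: ai. rewrite dirichletE; apply: le_lt_trans (disc_integral_lty om_adm).
rewrite le_eqVlt; apply/orP; left; apply/eqP; apply: eq_integral => p _.
by rewrite /dens (dfunE (cder_id (toC p))) cmod1 expr1n mul1r.
Qed.

Lemma cder_exp n z : cder (fun w => w ^+ n) z (n%:R * z ^+ n.-1).
Proof.
elim: n => [|n IH].
  by rewrite mul0r; have := cder_cst 1 z; apply: (cder_near ltr01) => w _; rewrite expr0.
have := cderM (cder_id z) IH.
rewrite (_ : 1 * z ^+ n + z * (n%:R * z ^+ n.-1) = n.+1%:R * z ^+ n).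
  by apply: (cder_near ltr01) => w _; rewrite exprS.
by rewrite mul1r mulrCA; case: n {IH} => [|n] /=; rewrite -?exprS -natr1; ring.
Qed.

Lemma inH_exp n : inH omega (fun w => w ^+ n).
Proof.
have an : analytic_on_D (fun w : C => w ^+ n).
  by apply: (@cder_analytic _ _ (fun z => n%:R * z ^+ n.-1)) => z _; exact: cder_exp.
split; first exact: an. have [ai di] := inH_id.
apply: (@le_lt_trans _ _ ((n%:R ^+ 2)%:E * dirichlet omega id)%E).
  apply: dirichlet_le => // z Dz.
  rewrite (dfunE (cder_exp n z)) (dfunE (cder_id z)) cmodM cmod_nat cmod1 mulr1.
  by rewrite ler_piMr// cmodX exprn_ile1 ?cmod_ge0// ltW.
by apply: lte_mul_pinfty; [rewrite lee_fin; exact: sqr_ge0| |exact: di].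
Qed.

Lemma inH_sum n (c : 'I_n -> C) (g : 'I_n -> C -> C) : (forall i, inH omega (g i)) ->
  inH omega (fun w => \sum_i c i * g i w).
Proof.
move=> hg; elim: n c g hg => [|n IH] c g hg.
  by under eq_fun do rewrite big_ord0; exact: inH_cst.
under eq_fun do rewrite big_ord_recl.
have h := IH (fun i => c (lift ord0 i)) (fun i => g (lift ord0 i)) (fun i => hg _).
have := inH_lin (c ord0) 1 (hg ord0) h.
by congr inH; apply/funext => w; rewrite mul1r.
Qed.

End Weight.

End Dirichlet.

(** * Point evaluations *)

Section PointEvaluation.
Variable R : realType.
Local Notation C := R[i].
Local Notation mu := (@lebesgue_measure R).
Local Notation T2 := (measurableTypeR R * measurableTypeR R)%type.
Local Notation disc := (@disc R).
Implicit Types (f g h : C -> C) (z w a : C).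

(** Averaging: if all slices over an interval of length [d] exceeded K / d, Tonelli's theorem would
    make the whole integral at least [K]. *)
Lemma slice_small (h : T2 -> \bar R) (K al d : R) : measurable_fun setT h ->
  (forall p, 0 <= h p)%E -> (\int[@area R]_p h p < K%:E)%E -> 0 < d ->
  (exists2 u : R, al <= u <= al + d & (\int[mu]_y h (u, y) <= (K / d)%:E)%E) /\
  (exists2 u : R, al <= u <= al + d & (\int[mu]_x h (x, u) <= (K / d)%:E)%E).
Proof.
move=> mh h0 hK d0.
have gen (G : R -> \bar R) : measurable_fun [set: measurableTypeR R] G -> (forall u, 0 <= G u)%E ->
    (\int[mu]_u G u < K%:E)%E -> exists2 u : R, al <= u <= al + d & (G u <= (K / d)%:E)%E.
  move=> mG G0 GK; apply: contrapT => no.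
  have big u : al <= u <= al + d -> ((K / d)%:E <= G u)%E.
    move=> hu; rewrite leNgt; apply/negP => /ltW le; apply: no; by exists u.
  have : (K%:E <= \int[mu]_u G u)%E; last by rewrite leNgt GK.
  pose I : set (measurableTypeR R) := `[al, al + d]%classic.
  have mI : measurable I by exact: measurable_itv.
  have muI : mu I = d%:E.
    by rewrite /I lebesgue_measure_itv /= lte_fin ltrDl d0 -EFinD addrAC subrr add0r.
  apply: (@le_trans _ _ (\int[mu]_(u in I) (cst (K / d)%:E u))%E).
    by rewrite integral_cst//; rewrite [X in (_ * X)%E]muI -EFinM divfK// gt_eqF.
  apply: (@le_trans _ _ (\int[mu]_(u in I) G u)%E); last first.
    by apply: ge0_subset_integral => //.
  apply: ge0_le_integral => //.
  - have K0 : 0 <= K by rewrite -lee_fin; apply: le_trans (ltW GK); apply: integral_ge0.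
    by move=> u _; rewrite lee_fin divr_ge0// ltW.
  - exact: measurable_funTS.
split; apply: gen.
- exact: (measurable_fun_fubini_tonelli_F _ mh h0).
- by move=> u; apply: integral_ge0.
- by have := fubini_tonelli1 h mh h0; rewrite /fubini_F => <-.
- exact: (measurable_fun_fubini_tonelli_G _ mh h0).
- by move=> u; apply: integral_ge0.
- by have := fubini_tonelli2 h mh h0; rewrite /fubini_G => <-.
Qed.

Lemma pcont_on_cmod (a b : R) (u : R -> C) : pcont_on a b u ->
  mu.-integrable `[a, b] (EFin \o (fun s => cmod (u s))).
Proof.
move=> cu; apply: cont_itv_integrable => t /cu ct; apply/cvgrPdist_lt => e e0.
have [d d0 h] := ct e e0.
near=> s; have : cmod (u s - u t) < e.
  by apply: h; near: s; apply/nbhs_ballP; exists d => //= s; rewrite /ball /= distrC.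
have := cmodBD (u s) (u t - u s); have := cmodBD (u t) (u s - u t).
rewrite !subrKC (cmodB (u t)) ltr_norml => h1 h2 h3; apply/andP; split; lra.
Unshelve. all: by end_near. Qed.

Lemma cint_le_int (a b : R) (u : R -> C) (M : R) : pcont_on a b u ->
  (\int[mu]_(t in `[a, b]) (cmod (u t))%:E <= M%:E)%E -> cmod (cint a b u) <= 2 * M.
Proof.
move=> cu uM; apply: le_trans (cmod_le_ReIm _) _ => /=.
have -> : 2 * M = M + M by ring.
have mI : measurable (`[a, b]%classic : set (measurableTypeR R)) by exact: measurable_itv.
have ic := pcont_on_cmod cu.
have key (v : R -> R) : mu.-integrable `[a, b] (EFin \o v) ->
   (forall t, `|v t| <= cmod (u t)) -> `|\int[mu]_(x in `[a, b]) v x| <= M.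
  move=> iv vu; apply: le_trans (le_normr_Rintegral _ iv) _ => //.
  rewrite -lee_fin; apply: le_trans uM; rewrite fineK; last first.
    by apply: integrable_fin_num => //; have := integrable_norm iv.
  apply: ge0_le_integral => //.
  - by have /integrableP[] := integrable_norm iv.
  - by have /integrableP[] := ic.
  - by move=> t _; rewrite lee_fin.
apply: lerD; apply: key.
- exact: pcont_on_Re.
- by move=> t; exact: normr_Re_le.
- exact: pcont_on_Im.
- by move=> t; exact: normr_Im_le.
Qed.

Lemma cintB_le_int (a b : R) (u v : R -> C) (M : R) : pcont_on a b u -> pcont_on a b v ->
  (\int[mu]_(t in `[a, b]) (cmod (u t))%:E <= M%:E)%E ->
  (\int[mu]_(t in `[a, b]) (cmod (v t))%:E <= M%:E)%E ->
  cmod (cint a b (fun t => u t - v t)) <= 4 * M.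
Proof.
move=> cu cv uM vM; have cv' : pcont_on a b (fun t => - v t) by move=> t /cv/pcontN.
rewrite cintD//; apply: le_trans (cmodD _ _) _.
have -> : 4 * M = 2 * M + 2 * M by ring.
apply: lerD; apply: cint_le_int => //.
by under eq_integral do rewrite cmodN.
Qed.

Definition box a (t : R) : set T2 := [set p | insq a t (toC p)].

Lemma measurable_box a t : measurable (box a t).
Proof.
rewrite (_ : box a t = `[Re a - t, Re a + t]%classic `*` `[Im a - t, Im a + t]%classic).
  by apply: measurableX; exact: measurable_itv.
by apply/seteqP; split => p; rewrite /box /insq /inrect /= !in_itv /= => /andP.
Qed.

(* By Tonelli the sides of a rectangle around [a] can be moved, each independently,
   to positions where the line integral of |F| is at most [K / d]. *)
Lemma mean_bound (F : C -> C) a (d K : R) : 0 < d ->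
  (forall z, insq a (2 * d) z -> cdiff_at F z) ->
  measurable_fun (box a (2 * d)) (fun p : T2 => cmod (F (toC p))) ->
  (\int[@area R]_(p in box a (2 * d)) (cmod (F (toC p)))%:E < K%:E)%E ->
  cmod (F a) <= 2 * K / d ^+ 2.
Proof.
move=> d0 dF mF FK; set Q := box a (2 * d) in mF FK.
have mQ : measurable Q by exact: measurable_box.
pose h := (fun p : T2 => (cmod (F (toC p)))%:E) \_ Q.
have h0 p : (0 <= h p)%E by rewrite /h patchE; case: ifP => // _; rewrite lee_fin cmod_ge0.
have mh : measurable_fun [set: T2] h.
  by apply/(measurable_restrictT _ mQ)/measurable_EFinP.
have hK : (\int[@area R]_p h p < K%:E)%E by rewrite /h -integral_mkcond.
(* Each side is placed at distance between [d] and 2 d from the centre: the contour remains in the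
   box and the kernel 1/|z - a| is at most 1/d on it. *)
have [[u1 hu1 iu1] _] := slice_small (Re a - 2 * d) mh h0 hK d0.
have [[u2 hu2 iu2] _] := slice_small (Re a + d) mh h0 hK d0.
have [_ [w1 hw1 iw1]] := slice_small (Im a - 2 * d) mh h0 hK d0.
have [_ [w2 hw2 iw2]] := slice_small (Im a + d) mh h0 hK d0.
pose g z := F z * (z - a)^-1.
have rQ z : inrect u1 u2 w1 w2 z -> insq a (2 * d) z.
  by rewrite /insq /inrect; lra.
have dg z : inrect u1 u2 w1 w2 z -> z != a -> cdiff_at g z.
  by move=> zi za; apply: cdiffM; [exact/dF/rQ|exact: cdiff_inv_sub].
have uu : u1 <= u2 by lra.
have ww : w1 <= w2 by lra.
have bd z : bdry u1 u2 w1 w2 z -> d <= cmod (z - a).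
  move=> /andP[_ /or4P[] /eqP e];
  [apply: le_trans (normr_Re_le _)|apply: le_trans (normr_Re_le _)
  |apply: le_trans (normr_Im_le _)|apply: le_trans (normr_Im_le _)];
  rewrite ?cReB ?cImB e ler_normr; apply/orP; first [by left; lra|by right; lra].
have na z : bdry u1 u2 w1 w2 z -> z != a.
  by move=> /bd; apply: contraTneq => ->; rewrite subrr cmod0 -ltNge.
have cg : cont_bdry g u1 u2 w1 w2.
  by move=> z zb; apply: cdiff_cont; apply: dg; [case/andP: zb|exact: na].
have [g1 g2] := cont_bdry_h ww cg; have [g3 g4] := cont_bdry_v uu cg.
have E : rect g u1 u2 w1 w2 = F a * kerI a d.
  rewrite (@rect_cut _ _ _ _ _ _ a d)//; [|lra|lra|lra|lra].
  apply: cauchy_formula; first by rewrite subrr cmod0.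
  by move=> z zi; apply: dF; move: zi; rewrite /insq /inrect; lra.
have gle z : bdry u1 u2 w1 w2 z -> cmod (g z) <= d^-1 * cmod (F z).
  move=> zb; rewrite cmodM cmodV mulrC; apply: ler_wpM2r; first exact: cmod_ge0.
  by rewrite lef_pV2 ?posrE//; [exact: bd|exact: lt_le_trans (bd _ zb)].
have side (s1 s2 : R) (l : R -> T2) : 
    (forall x, s1 <= x <= s2 -> bdry u1 u2 w1 w2 (toC (l x))) ->
    pcont_on s1 s2 (fun x => g (toC (l x))) ->
    measurable_fun [set: measurableTypeR R] (fun x => h (l x)) ->
    (\int[mu]_x h (l x) <= (K / d)%:E)%E ->
    (\int[mu]_(x in `[s1, s2]) (cmod (g (toC (l x))))%:E <= (K / d ^+ 2)%:E)%E.
  move=> lb cgl ml hl.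
  have -> : (K / d ^+ 2)%:E = ((d^-1)%:E * (K / d)%:E)%E.
    by rewrite -EFinM; congr EFin; field; rewrite gt_eqF.
  apply: (@le_trans _ _ ((d^-1)%:E * \int[mu]_x h (l x))%E); last first.
    by apply: lee_wpmul2l => //; rewrite lee_fin invr_ge0 ltW.
  rewrite -ge0_integralZl//; last by rewrite lee_fin invr_ge0 ltW.
  rewrite [leLHS]integral_mkcond; apply: ge0_le_integral => //.
  - by move=> x _; rewrite patchE; case: ifP => // _; rewrite lee_fin cmod_ge0.
  - apply/(measurable_restrictT _ (measurable_itv _)).
    by have /integrableP[] := pcont_on_cmod cgl.
  - exact: measurable_funeM.
  move=> x _; rewrite patchE; case: ifPn => [|_]; last first.
    by rewrite mule_ge0// lee_fin invr_ge0 ltW.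
  rewrite inE /= in_itv /= => /lb xb.
  have -> : h (l x) = (cmod (F (toC (l x))))%:E.
    by rewrite /h patchE ifT// inE; apply: rQ; case/andP: xb.
  by rewrite -EFinM lee_fin; exact: gle.
have b1 (c : R) : (c == w1) || (c == w2) -> forall x, u1 <= x <= u2 -> bdry u1 u2 w1 w2 (toC (x, c)).
  move=> hc x hx; rewrite /bdry /inrect /= hx.
  by case/orP: hc => /eqP ->; rewrite !lexx ww eqxx ?orbT.
have b2 (c : R) : (c == u1) || (c == u2) -> forall y, w1 <= y <= w2 -> bdry u1 u2 w1 w2 (toC (c, y)).
  move=> hc x hx; rewrite /bdry /inrect /= hx.
  by case/orP: hc => /eqP ->; rewrite !lexx uu eqxx ?orbT.
have m1 (c : R) : measurable_fun [set: measurableTypeR R] (fun x => h (x, c)).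
  by apply: (measurableT_comp mh); exact: measurable_pair2.
have m2 (c : R) : measurable_fun [set: measurableTypeR R] (fun y => h (c, y)).
  by apply: (measurableT_comp mh); exact: measurable_pair1.
have rle : cmod (rect g u1 u2 w1 w2) <= 8 * (K / d ^+ 2).
  rewrite /rect; apply: le_trans (cmodD _ _) _; rewrite cmodM.
  have -> : cmod (Complex 0 1 : C) = 1 by rewrite /cmod /= expr0n add0r expr1n sqrtr1.
  have -> : 8 * (K / d ^+ 2) = 4 * (K / d ^+ 2) + 4 * (K / d ^+ 2) by ring.
  rewrite mul1r; apply: lerD; apply: cintB_le_int => //.
  - by apply: (@side u1 u2 (fun x => (x, w1))) => //; apply: b1; rewrite eqxx.
  - by apply: (@side u1 u2 (fun x => (x, w2))) => //; apply: b1; rewrite eqxx orbT.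
  - by apply: (@side w1 w2 (fun y => (u2, y))) => //; apply: b2; rewrite eqxx orbT.
  - by apply: (@side w1 w2 (fun y => (u1, y))) => //; apply: b2; rewrite eqxx.
move: rle; rewrite E cmodM => rle.
(* The contour integral is at most 8 K / d^2 in modulus and equals F(a) times a number of modulus at
   least 4. *)
have k4 := kerI_ge a d0.
have := ler_wpM2l (cmod_ge0 (F a)) k4.
have -> : 2 * K / d ^+ 2 = 2 * (K / d ^+ 2) by ring.
by move: rle; move: (K / d ^+ 2) => q; lra.
Qed.

End PointEvaluation.

Section PointwiseBound.
Variable R : realType.
Local Notation C := R[i].
Local Notation mu := (@lebesgue_measure R).
Local Notation T2 := (measurableTypeR R * measurableTypeR R)%type.
Local Notation disc := (@disc R).
Implicit Types (f g h : C -> C) (z w a : C).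

(** A mean value inequality by Cousin's lemma on the degenerate rectangle [0, 1] x {0}. The [+ 1] is
    the tolerance allowed in the local first-order expansion. *)
Lemma segment_lipschitz f z (K : R) : cmod z <= 1 ->
  (forall t : R, 0 <= t <= 1 -> exists2 l, cder f (t%:C%C * z) l & cmod l <= K) ->
  cmod (f z - f 0) <= K + 1.
Proof.
move=> z1 df; have K0 : 0 <= K.
  by have [|l _ h] := df 0; [rewrite lexx ler01|exact: le_trans (cmod_ge0 l) h].
pose P (a b c d : R) := cmod (f (b%:C%C * z) - f (a%:C%C * z)) <= (K + 1) * (b - a).
suff : P 0 1 0 0 by rewrite /P subr0 mulr1 mul0r mul1r.
apply: (@rect_cousin R P 0 1 0 0 ler01 (lexx 0)); rewrite /P.
- move=> a b _ _ ab _ h1 h2 _ _; set m := (a + b) / 2 in h1 h2 *.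
  have := cmodD (f (b%:C%C * z) - f (m%:C%C * z)) (f (m%:C%C * z) - f (a%:C%C * z)).
  rewrite addrA subrK => h; apply: le_trans h _.
  have -> : (K + 1) * (b - a) = (K + 1) * (b - m) + (K + 1) * (m - a) by ring.
  exact: lerD.
move=> w /andP[w01 _]; have [l dl lK] := df _ w01.
have [d d0 hd] := cder_epsE dl ltr01; exists d => // a' b' c' d' _ _ _ _ /andP[wab _] bad _.
have loc (s : R) : a' <= s <= b' ->
    cmod (f (s%:C%C * z) - f ((Re w)%:C%C * z)) <= (K + 1) * `|s - Re w|.
  move=> sab; set x := Re w in wab hd *.
  have e1 : cmod (s%:C%C * z - x%:C%C * z) = `|s - x| * cmod z.
    by rewrite -mulrBl cmodM -cmod_real; congr (cmod _ * _); rewrite rmorphB.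
  have e2 : cmod (s%:C%C * z - x%:C%C * z) <= `|s - x|.
    by rewrite e1 ler_piMr.
  have h : cmod (f (s%:C%C * z) - f (x%:C%C * z) - l * (s%:C%C * z - x%:C%C * z))
      <= 1 * cmod (s%:C%C * z - x%:C%C * z).
    by apply: hd; apply: le_lt_trans e2 _; rewrite ltr_norml; lra.
  set A := f _ - f _ in h *; set B := s%:C%C * z - x%:C%C * z in h e1 e2.
  have -> : A = (A - l * B) + l * B by rewrite subrK.
  apply: le_trans (cmodD _ _) _; rewrite cmodM mulrDl mul1r addrC.
  apply: lerD; last by apply: le_trans h _; rewrite mul1r.
  by apply: ler_pM => //; exact: cmod_ge0.
have := cmodD (f (b'%:C%C * z) - f ((Re w)%:C%C * z)) (f ((Re w)%:C%C * z) - f (a'%:C%C * z)).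
rewrite addrA subrK => h; apply: le_trans h _.
have h1 := loc b'; have h2 := loc a'.
have -> : (K + 1) * (b' - a') = (K + 1) * `|b' - Re w| + (K + 1) * `|a' - Re w|.
  rewrite -mulrDr ger0_norm ?ler0_norm; [|lra|lra].
  by congr (_ * _); ring.
apply: lerD; first by apply: h1; lra.
by rewrite cmodB; apply: h2; lra.
Qed.

Variable omega : R -> R.
Hypothesis om_adm : admissible_weight omega.

Lemma Hnorm_le1 f : inH omega f -> Hnorm omega f <= 1 ->
  cmod (f 0) <= 1 /\ (dirichlet omega f <= (pi : R)%:E)%E.
Proof.
move=> [af df]; rewrite /Hnorm -{1}sqrtr1 ler_sqrt// => h.
have fn : dirichlet omega f \is a fin_num.
  by rewrite ge0_fin_numE//; exact: dirichlet_ge0.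
have d0 : 0 <= fine (dirichlet omega f) by apply: fine_ge0; exact: dirichlet_ge0.
have p0 : 0 < pi :> R by exact: pi_gt0.
have q0 : 0 <= pi^-1 * fine (dirichlet omega f) by rewrite mulr_ge0// invr_ge0 ltW.
split.
  rewrite -(@ler_pXn2r _ 2%N) ?nnegrE ?cmod_ge0// expr1n.
  by apply: le_trans h; rewrite lerDl.
rewrite -(fineK fn) lee_fin.
have : pi^-1 * fine (dirichlet omega f) <= 1 by apply: le_trans h; rewrite lerDr sqr_ge0.
by rewrite mulrC ler_pdivrMr// mul1r.
Qed.

Lemma Hnorm_bound g (A B : R) : 0 <= A -> 0 <= B -> cmod (g 0) <= A ->
  (dirichlet omega g <= B%:E)%E -> Hnorm omega g <= Num.sqrt (A ^+ 2 + pi^-1 * B).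
Proof.
move=> A0 B0 gA gB; have p0 : 0 < pi :> R by exact: pi_gt0.
rewrite /Hnorm ler_wsqrtr// lerD//.
  by rewrite lerXn2r ?nnegrE ?cmod_ge0.
apply: ler_wpM2l; first by rewrite invr_ge0 ltW.
rewrite -lee_fin fineK//.
by rewrite ge0_fin_numE; [exact: le_lt_trans gB (ltry _)|exact: dirichlet_ge0].
Qed.

Lemma omega_lower_bound (r : R) : 0 <= r -> r < 1 ->
  exists2 m : R, 0 < m & forall s : R, 0 <= s <= r -> m <= omega s.
Proof.
move=> r0 r1; have [co [pos _]] := om_adm.
have cr : {within `[0, r], continuous omega}.
  apply: continuous_subspaceW co => s /=; rewrite !in_itv /= => /andP[-> sr].
  exact: le_lt_trans r1.
have [c] := EVT_min r0 cr; rewrite in_itv /= => /andP[c0 cr'] hc.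
exists (omega c); first by apply: pos; rewrite c0 (le_lt_trans cr').
by move=> s hs; apply: hc; rewrite in_itv.
Qed.

(** The L^1 mean of f' over a box controls its value at the centre, and it is bounded by the
    Dirichlet integral because the weight has a positive minimum away from the unit circle. *)
Lemma deriv_bound (r : R) : 0 <= r -> r < 1 -> exists2 K : R, 0 < K &
  forall f, inH omega f -> Hnorm omega f <= 1 ->
  forall a, cmod a <= r -> cmod (dfun f a) <= K.
Proof.
(* Points of a box of half-side 2 d lie within 4 d = (1 - r) / 2 of its centre, hence in the disc of
   radius [r']. *)
move=> r0 r1; pose d := (1 - r) / 8; pose r' := (1 + r) / 2.
have d0 : 0 < d by rewrite /d divr_gt0// subr_gt0.
have r'0 : 0 <= r' by rewrite /r'; lra.
have r'1 : r' < 1 by rewrite /r'; lra.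
have [m m0 hm] := omega_lower_bound r'0 r'1.
have mD := @measurable_disc R.
pose W := fine (\int[@area R]_(p in disc) (omega (cmod (toC p)))%:E)%E.
have om0 p : disc p -> (0 <= (omega (cmod (toC p)))%:E)%E.
  by move=> Dp; rewrite lee_fin ltW// om_disc_gt0.
have I0 : (0 <= \int[@area R]_(p in disc) (omega (cmod (toC p)))%:E)%E.
  by apply: integral_ge0.
have WE : (\int[@area R]_(p in disc) (omega (cmod (toC p)))%:E)%E = W%:E.
  by rewrite fineK// ge0_fin_numE//; exact: disc_integral_lty.
have W0 : 0 <= W by rewrite -lee_fin -WE.
have p0 : 0 < pi :> R by exact: pi_gt0.
(* The pointwise inequality m x <= omega (1 + x^2) with x = |f'| bounds the L^1 norm by the total
   weight [W] plus the Dirichlet integral, at most pi in the unit ball; the [+ 1] makes the bound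
   strict. *)
pose K := m^-1 * (W + pi) + 1.
have K0 : 0 < K by rewrite /K ltr_wpDl// mulr_ge0 ?invr_ge0 ?(ltW m0)// addr_ge0// ltW.
exists (2 * K / d ^+ 2); first by rewrite divr_gt0 ?exprn_gt0// mulr_gt0.
move=> f Hf Nf a ar; have [f01 Df] := Hnorm_le1 Hf Nf; have af := Hf.1.
have boxr z : insq a (2 * d) z -> cmod z <= r'.
  move=> /insq_le h; have := cmodD (z - a) a; rewrite subrK => h2; apply: le_trans h2 _.
  apply: le_trans (lerD h ar) _; rewrite /d /r'; lra.
have boxD : box a (2 * d) `<=` disc.
  by move=> p /boxr h; rewrite /disc /Dset /=; exact: le_lt_trans h r'1.
have mB := measurable_box a (2 * d).
have md : measurable_fun (box a (2 * d)) (fun p : T2 => cmod (dfun f (toC p))).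
  exact: measurable_funS mD boxD (measurable_dfun af).
apply: mean_bound => //.
  by move=> z /boxr h; apply: anD_dfun => //; exact: le_lt_trans h r'1.
pose G (p : T2) := ((m^-1)%:E * ((omega (cmod (toC p)))%:E + dens omega f p))%E.
have mo : measurable_fun disc (fun p : T2 => (omega (cmod (toC p)))%:E).
  by apply/measurable_EFinP; exact: measurable_radial.
have mde := measurable_dens om_adm af.
have de0 p : disc p -> (0 <= dens omega f p)%E by exact: dens_ge0.
have mi0 : (0 <= (m^-1)%:E)%E by rewrite lee_fin invr_ge0 ltW.
have mS : measurable_fun disc (fun p => ((omega (cmod (toC p)))%:E + dens omega f p)%E).
  exact: emeasurable_funD.
have mG : measurable_fun disc G by apply: measurable_funeM.
have G0 p : disc p -> (0 <= G p)%E.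
  by move=> Dp; apply: mule_ge0 => //; apply: adde_ge0; [exact: om0|exact: de0].
apply: (@le_lt_trans _ _ (\int[@area R]_(p in disc) G p)%E); last first.
  rewrite /G ge0_integralZl//; last by move=> p Dp; apply: adde_ge0; [exact: om0|exact: de0].
  rewrite ge0_integralD// WE -dirichletE.
  apply: (@le_lt_trans _ _ ((m^-1)%:E * (W%:E + pi%:E))%E).
    by apply: lee_wpmul2l => //; apply: leeD.
  by rewrite -EFinD -EFinM lte_fin /K ltrDl.
apply: (@le_trans _ _ (\int[@area R]_(p in box a (2 * d)) G p)%E); last first.
  by apply: ge0_subset_integral => //.
apply: ge0_le_integral => //.
- by move=> p _; rewrite lee_fin cmod_ge0.
- exact/measurable_EFinP.
- exact: measurable_funS mD boxD mG.
move=> p Bp; rewrite /G /dens -EFinD -EFinM lee_fin ler_pdivlMl//.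
have h : m <= omega (cmod (toC p)) by apply: hm; rewrite cmod_ge0 boxr.
move: h (cmod_ge0 (dfun f (toC p))); move: (omega (cmod (toC p))) (cmod (dfun f (toC p))) => o x h x0.
have : m * x <= o * (1 + x ^+ 2).
  apply: ler_pM => //; [exact: ltW|].
  by have := sqr_ge0 (x - 1); rewrite !expr2; lra.
by rewrite mulrDr mulr1 [_ * o]mulrC.
Qed.

Lemma pointwise_bound (r : R) : 0 <= r -> r < 1 -> exists2 K : R, 0 < K &
  forall f, inH omega f -> Hnorm omega f <= 1 ->
  forall z, cmod z <= r -> cmod (f z) <= K.
Proof.
move=> r0 r1; have [K K0 hK] := deriv_bound r0 r1.
exists (K + 1 + 1); first by rewrite !addr_gt0.
move=> f Hf Nf z zr; have [f01 _] := Hnorm_le1 Hf Nf.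
have z1 : cmod z <= 1 by exact: le_trans zr (ltW r1).
have -> : f z = (f z - f 0) + f 0 by rewrite subrK.
apply: le_trans (cmodD _ _) _; apply: lerD => //.
apply: segment_lipschitz => // t t01.
have tz : cmod (t%:C%C * z) <= r.
  rewrite cmodM cmod_real ger0_norm; last by case/andP: t01.
  apply: le_trans zr; rewrite ler_piMl ?cmod_ge0//; by case/andP: t01.
exists (dfun f (t%:C%C * z)); first by apply: dfunP; [exact: Hf.1|exact: le_lt_trans tz r1].
exact: hK.
Qed.

End PointwiseBound.

(** * Interpolation and approximation numbers *)

Section Auerbach.
Variable R : realType.
Local Notation C := R[i].
Variable omega : R -> R.
Hypothesis om_adm : admissible_weight omega.
Implicit Types (f g h : C -> C).

Definition uball f := inH omega f /\ Hnorm omega f <= 1.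

Lemma uball_scale f : inH omega f -> exists2 c : C, c != 0 & uball (fun w => c * f w).
Proof.
move=> Hf; have [af df] := Hf; have p0 : 0 < pi :> R by exact: pi_gt0.
pose D := fine (dirichlet omega f).
have fn : dirichlet omega f = D%:E by rewrite fineK// ge0_fin_numE//; exact: dirichlet_ge0.
have D0 : 0 <= D by apply: fine_ge0; exact: dirichlet_ge0.
have N0 : 0 <= Hnorm omega f by exact: sqrtr_ge0.
(* The 1 keeps the factor finite and nonzero when the norm vanishes. *)
pose c : R := (1 + Hnorm omega f)^-1.
have c0 : 0 < c by rewrite invr_gt0 ltr_pwDl.
have H : inH omega (fun w => c%:C%C * f w).
  have := inH_lin om_adm (c%:C%C) 0 Hf Hf.
  by congr inH; apply/funext => w; rewrite mul0r addr0.
exists c%:C%C; first by rewrite -cmod_gt0 cmod_real gtr0_norm.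
split=> //.
have cz z : Dset z -> cder (fun w => c%:C%C * f w) z (c%:C%C * dfun f z).
  move=> Dz; have := cderM (cder_cst (c%:C%C) z) (dfunP af Dz).
  by congr cder; move: (dfun f z) => x; ring.
pose cf w := c%:C%C * f w.
have dle : (dirichlet omega cf <= (c ^+ 2 * D)%:E)%E.
  have dz z : Dset z -> cmod (dfun cf z) <= c * cmod (dfun f z).
    by move=> Dz; rewrite (dfunE (cz z Dz)) cmodM cmod_real gtr0_norm.
  by have := dirichlet_le om_adm H.1 af (ltW c0) dz; rewrite fn -EFinM.
have cle : cmod (c%:C%C * f 0) <= c * cmod (f 0) by rewrite cmodM cmod_real gtr0_norm.
have := Hnorm_bound om_adm (mulr_ge0 (ltW c0) (cmod_ge0 _)) (mulr_ge0 (sqr_ge0 c) D0) cle dle.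
move=> h; apply: le_trans h _.
have -> : (c * cmod (f 0)) ^+ 2 + pi^-1 * (c ^+ 2 * D) = c ^+ 2 * (cmod (f 0) ^+ 2 + pi^-1 * D).
  by ring.
rewrite sqrtrM ?sqr_ge0// sqrtr_sqr gtr0_norm// -/(Hnorm omega f).
by rewrite mulrC ler_pdivrMr ?ltr_pwDl// mul1r lerDr ler01.
Qed.

Lemma cmod_det_le n (A : 'M[C]_n) (K : R) : 0 <= K -> (forall i j, cmod (A i j) <= K) ->
  cmod (\det A) <= #|'S_n|%:R * K ^+ n.
Proof.
move=> K0 AK; apply: le_trans (cmod_sum _) _.
apply: (@le_trans _ _ (\sum_(s : 'S_n) K ^+ n)); last first.
  by rewrite sumr_const mulr_natl.
apply: ler_sum => s _; rewrite cmodM cmodX cmodN cmod1 expr1n mul1r cmod_prod.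
rewrite -[X in _ ^+ X]card_ord -prodr_const; apply: ler_prod => i _.
by rewrite cmod_ge0 AK.
Qed.

Section Interpolation.
Variables (N : nat) (z : 'I_N -> C) (r : R).
Hypotheses (z_inj : injective z) (r0 : 0 <= r) (r1 : r < 1).
Hypothesis zr : forall i, cmod (z i) <= r.

Definition evmx (f : 'I_N -> C -> C) : 'M[C]_N := \matrix_(i, j) f i (z j).

(** Scaled monomials give a diagonal matrix times a Vandermonde matrix, nonsingular at distinct
    points; the supremum of the determinants is thus positive. *)
Lemma evmx_monomials : exists2 f : 'I_N -> C -> C, forall i, uball (f i) & \det (evmx f) != 0.
Proof.
have sc (i : 'I_N) : exists c : C, c != 0 /\ uball (fun w => c * w ^+ i).
  by have [c c0 ub] := uball_scale (inH_exp om_adm i); exists c.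
have [c hc] := choice sc; exists (fun i w => c i * w ^+ i); first by move=> i; have [] := hc i.
have -> : evmx (fun i w => c i * w ^+ i) = diag_mx (\row_i c i) *m Vandermonde N (\row_j z j).
  by apply/matrixP => i j; rewrite mul_diag_mx !mxE.
rewrite det_mulmx det_diag det_Vandermonde mulf_eq0 negb_or; apply/andP; split.
  by apply/prodf_neq0 => i _; rewrite mxE; have [] := hc i.
apply/prodf_neq0 => i _; apply/prodf_neq0 => j ij; rewrite !mxE subr_eq0.
by apply: contraTneq ij => /z_inj ->; rewrite ltnn.
Qed.

(** Bounded point evaluations make the determinants bounded, and their supremum is positive; a
    system within a factor 2 of it exists without any compactness of the unit ball. *)
Lemma evmx_extremal : exists f : 'I_N -> C -> C, [/\ forall i, uball (f i), \det (evmx f) != 0 &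
  forall g : 'I_N -> C -> C, (forall i, uball (g i)) -> cmod (\det (evmx g)) <= 2 * cmod (\det (evmx f))].
Proof.
have [K K0 hK] := pointwise_bound om_adm r0 r1.
pose S : set R := [set cmod (\det (evmx f)) | f in [set f : 'I_N -> C -> C | forall i, uball (f i)]].
have [f1 uf1 nz1] := evmx_monomials.
have S1 : S (cmod (\det (evmx f1))) by exists f1.
have ubS : ubound S (#|'S_N|%:R * K ^+ N).
  move=> _ [f uf <-]; apply: cmod_det_le; [exact: ltW|move=> i j; rewrite mxE].
  by have [Hf Nf] := uf i; apply: hK.
have hs : has_sup S by split; [exists (cmod (\det (evmx f1)))|exists (#|'S_N|%:R * K ^+ N)].
have sle x : S x -> x <= sup S by move=> Sx; apply: ub_le_sup => //; case: hs.
have s0 : 0 < sup S by apply: lt_le_trans (sle _ S1); rewrite cmod_gt0.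
have s2 : 0 < sup S / 2 by rewrite divr_gt0.
have [_ [f uf <-] hf] := sup_adherent s2 hs.
have hf' : sup S < 2 * cmod (\det (evmx f)).
  by move: hf; move: (cmod _) => x; lra.
exists f; split => //.
  by rewrite -cmod_gt0; move: hf' s0; move: (cmod _) (sup S) => x y; lra.
by move=> g ug; apply: le_trans (ltW hf'); apply: sle; exists g.
Qed.

(* By Cramer's rule the coefficient [c g i] is the quotient of the determinant with
   row [i] replaced by the values of [g] and the nearly maximal one. *)
Lemma auerbach : exists (f : 'I_N -> C -> C) (c : (C -> C) -> 'I_N -> C),
  [/\ forall i, uball (f i),
      forall g h (a b : C) i, c (fun w => a * g w + b * h w) i = a * c g i + b * c h i,
      forall g j, \sum_i c g i * f i (z j) = g (z j) &
      forall g, uball g -> forall i, cmod (c g i) <= 2].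
Proof.
have [f [uf nz fmax]] := evmx_extremal.
have uA : evmx f \in unitmx by rewrite unitmxE unitfE.
pose v g : 'rV[C]_N := \row_j g (z j).
pose c g i := (v g *m invmx (evmx f)) 0 i.
exists f, c; split => //.
- move=> g h a b i; rewrite /c.
  have -> : v (fun w => a * g w + b * h w) = a *: v g + b *: v h.
    by apply/rowP => j; rewrite !mxE.
  by rewrite mulmxDl -!scalemxAl !mxE.
- move=> g j; have := congr1 (fun M : 'rV[C]_N => M 0 j) (mulmxKV uA (v g)).
  by rewrite !mxE => <-; apply: eq_bigr => i _; rewrite [evmx f i j]mxE.
move=> g ug i; pose f' k := if k == i then g else f k.
have uf' k : uball (f' k) by rewrite /f'; case: ifP => _; [exact: ug|exact: uf].
(* Expansion along row [i]: the cofactors of that row do not see its replacement by the values of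
   [g]. *)
have E : c g i * \det (evmx f) = \det (evmx f').
  rewrite /c /invmx uA -scalemxAr mxE mulrC mulrA divff// mul1r.
  rewrite (expand_det_row _ i) mxE; apply: eq_bigr => j _.
  rewrite !mxE /f' eqxx; congr (_ * (_ * \det _)); apply/matrixP => k l; rewrite !mxE.
  by rewrite eq_sym (negPf (neq_lift _ _)).
have := fmax _ uf'; rewrite -E cmodM ler_pM2r// cmod_gt0//.
Qed.

End Interpolation.
End Auerbach.

Section Approximation.
Variable R : realType.
Local Notation C := R[i].
Variables (omega : R -> R) (phi : C -> C).
Hypothesis om_adm : admissible_weight omega.
Hypothesis sy : symbol omega phi.

Lemma comp_norm_bound (F : C -> C) (M d : R) : 0 <= M -> 0 < d -> anD F ->
  (forall w, nbh (phi @` @Dset R) d w -> Dset w) ->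
  (forall w, nbh (phi @` @Dset R) d w -> cmod (F w) <= M) ->
  Hnorm omega (fun w => F (phi w)) <=
  M * Num.sqrt (1 + pi^-1 * ((12 / d) ^+ 2 * fine (dirichlet omega phi))).
Proof.
move=> M0 d0 aF nD FM; have [aphi [phiD [Hphi _]]] := sy.
(* [phi] is the image of the identity under composition. *)
have [_ dphi] : inH omega phi by have := Hphi _ (inH_id om_adm).
pose D := fine (dirichlet omega phi).
have fn : dirichlet omega phi = D%:E by rewrite fineK// ge0_fin_numE; [exact: dphi|exact: dirichlet_ge0].
have D0 : 0 <= D by apply: fine_ge0; exact: dirichlet_ge0.
have nU x w : Dset x -> cmod (w - phi x) < d -> nbh (phi @` @Dset R) d w.
  by move=> Dx h; exists (phi x) => //; exists x.
have dF x : Dset x -> exists2 l, cder F (phi x) l & cmod l <= 12 / d * M.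
  move=> Dx; have [l dl] := aF _ (phiD _ Dx); exists l => //.
  (* A square of half-side d / 3 stays within 2 d / 3 of its centre, inside the neighbourhood;
     Cauchy's estimate 4 M / (d / 3) yields the constant 12 / d. *)
  have t0 : 0 < d / 3 by rewrite divr_gt0.
  have sqU w : insq (phi x) (d / 3) w -> nbh (phi @` @Dset R) d w.
    by move=> /insq_le h; apply: nU Dx _; apply: le_lt_trans h _; lra.
  have -> : 12 / d * M = 4 * M / (d / 3) by field; rewrite gt_eqF.
  apply: cder_le dl => //; first by move=> w /sqU/nD; exact: aF.
  by move=> w /bdsq_insq/sqU; exact: FM.
have cd x : Dset x -> exists2 l, cder (fun w => F (phi w)) x (l * dfun phi x) & cmod l <= 12 / d * M.
  move=> Dx; have [l dl lM] := dF x Dx; exists l => //.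
  exact: cder_comp (dfunP aphi Dx) dl.
have aFp : analytic_on_D (fun w => F (phi w)).
  by apply/analytic_anD => x /cd[l dl _]; exists (l * dfun phi x).
have k0 : 0 <= 12 / d * M by rewrite mulr_ge0// divr_ge0// ltW.
have dz x : Dset x -> cmod (dfun (fun w => F (phi w)) x) <= 12 / d * M * cmod (dfun phi x).
  by move=> /cd[l dl lM]; rewrite (dfunE dl) cmodM ler_wpM2r// cmod_ge0.
have := dirichlet_le om_adm aFp aphi k0 dz; rewrite fn -EFinM => dle.
have zD : @Dset R 0 by rewrite /Dset /= cmod0.
have c0 : cmod (F (phi 0)) <= M.
  by apply: FM; apply: nU zD _; rewrite subrr cmod0.
have := Hnorm_bound om_adm M0 (mulr_ge0 (sqr_ge0 _) D0) c0 dle.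
move=> h; apply: le_trans h _.
have -> : M ^+ 2 + pi^-1 * ((12 / d * M) ^+ 2 * D) = M ^+ 2 * (1 + pi^-1 * ((12 / d) ^+ 2 * D)).
  by move: (12 / d) => q; ring.
by rewrite sqrtrM ?sqr_ge0// sqrtr_sqr ger0_norm.
Qed.

Lemma opnorm_ge0 S : (0 <= opnorm omega S)%E.
Proof.
have H0 := inH_cst omega (0 : C); have [a0 _] := H0.
apply: (@le_trans _ _ (Hnorm omega (S (fun=> 0)))%:E); first by rewrite lee_fin sqrtr_ge0.
apply: ereal_sup_ubound; exists (fun=> 0) => //; split; first exact: H0.
have d0 : (dirichlet omega (fun _ : C => 0%R) <= 0%:E)%E.
  have k0 : 0 <= 0 :> R by exact: lexx.
  have dz z : @Dset R z -> cmod (dfun (fun _ : C => 0) z) <= 0 * cmod (dfun (fun _ : C => 0) z).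
    by move=> _; rewrite (dfunE (cder_cst 0 z)) cmod0 mulr0.
  by have := dirichlet_le om_adm a0 a0 k0 dz; rewrite expr0n mul0e.
have c0 : cmod (0 : C) <= 0 by rewrite cmod0.
have := Hnorm_bound om_adm (lexx 0) (lexx 0) c0 d0 => h; apply: le_trans h _.
by rewrite mulr0 expr0n addr0 sqrtr0 ler01.
Qed.

(** Nonnegativity is needed for the monotonicity of extended-real powers when roots are taken. *)
Lemma approx_num_ge0 n S : (0 <= approx_num omega n S)%E.
Proof. by apply: le_ereal_inf_tmp => _ [T _ <-]; exact: opnorm_ge0. Qed.

Lemma approx_num_bound (r v kap : R) : r < 1 -> (forall z, Dset z -> cmod (phi z) <= r) ->
  (v%:E < Vgreen (closure_image phi))%E -> 0 < kap < 1 ->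
  exists (L : R) (N0 : nat), 0 < L /\ forall N, (N0 <= N)%N ->
    (approx_num omega N.+1 (compo phi) <= (L * (2 * N%:R + 1) * (expR (- v) / kap) ^+ N)%:E)%E.
Proof.
move=> r1 phir vV kap1; have [aphi [phiD [Hphi _]]] := sy.
have zD : @Dset R 0 by rewrite /Dset /= cmod0.
have r0 : 0 <= r by apply: le_trans (phir _ zD); exact: cmod_ge0.
pose U : set C := phi @` @Dset R.
have Ur w : U w -> cmod w <= r by move=> [x Dx <-]; exact: phir.
have U0 : U (phi 0) by exists 0.
have r01 : 0 <= r < 1 by rewrite r0 r1.
have [d [d0 rd1 [N0 hN]]] := good_points r01 Ur U0 vV.
have rd0 : 0 <= r + d by rewrite addr_ge0// ltW.
have [rho /andP[rrho rho1] blb] := blaschke_bound rd0 rd1 kap1.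
have rho0 : 0 <= rho by exact: le_trans rd0 (ltW rrho).
have [K K0 hK] := pointwise_bound om_adm rho0 rho1.
have nbr w : nbh U d w -> cmod w <= r + d.
  move=> [u /Ur ur wu]; have := cmodD (w - u) u; rewrite subrK => h.
  by apply: le_trans h _; rewrite addrC; apply: lerD => //; exact: ltW.
pose L0 := Num.sqrt (1 + pi^-1 * ((12 / d) ^+ 2 * fine (dirichlet omega phi))).
have L00 : 0 <= L0 by exact: sqrtr_ge0.
exists (2 * K * L0 + 1), N0; split; first by rewrite ltr_wpDl// mulr_ge0// mulr_ge0// ltW.
move=> N N0N; have [z [zi zn zp]] := hN N N0N.
(* The points lie in the neighbourhood and not in [phi(D)], so the radius is r + d here and in the
   Blaschke bound. *)
have [f [c [uf clin cint cle]]] := auerbach om_adm zi rd0 rd1 (fun i => nbr _ (zn i)).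
pose P g w := \sum_i c g i * f i w.
pose Rop g w := P g (phi w).
have HP g : inH omega (P g) by exact: (inH_sum om_adm (c g) (fun i => (uf i).1)).
(* [rank_lt] at [N.+1] admits N spanning functions, here the compositions of the [f i] with [phi];
   this is the shift between N points and the index N + 1. *)
have rk : rank_lt omega N.+1 Rop.
  split; first by [].
  split; first by move=> g _; exact: (Hphi _ (HP g)).
  split.
    move=> g h a b _ _ x _; rewrite /Rop /P !mulr_sumr -big_split /=.
    by apply: eq_bigr => i _; rewrite clin; ring.
  exists (fun i w => f i (phi w)); split; first by move=> i; have [Hf _] := uf i; exact: (Hphi _ Hf).
  by move=> g _; exists (c g) => x _.
apply: le_trans (ereal_inf_lbound _) _; first by exists Rop; [exact: rk|reflexivity].
apply: ge_ereal_sup => _ [g ug <-]; rewrite lee_fin.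
pose F w := g w - P g w.
have [Hg Ng] := ug.
have aF : anD F.
  apply/analytic_anD; have [] := inH_lin om_adm 1 (-1) Hg (HP g).
  by move=> h _; move: h; congr analytic_on_D; apply/funext => w; rewrite mul1r mulN1r.
have [k0 k1] := andP kap1.
(* [g] contributes [K], and the interpolant contributes N terms with coefficient at most 2. *)
pose A := (2 * N%:R + 1) * K.
have A0 : 0 <= A by rewrite mulr_ge0 ?ltW// ltr_wpDl.
have FA w : cmod w <= rho -> cmod (F w) <= A.
  move=> wr; apply: le_trans (cmodD _ _) _; rewrite cmodN /A mulrDl mul1r addrC.
  apply: lerD; last exact: hK.
  apply: le_trans (cmod_sum _) _.
  have -> : 2 * N%:R * K = \sum_(i < N) (2 * K).
    by rewrite sumr_const card_ord -[RHS]mulr_natl; ring.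
  apply: ler_sum => i _; rewrite cmodM; have [Hf Nf] := uf i.
  by apply: ler_pM; rewrite ?cmod_ge0//; [exact: cle|exact: hK].
pose s := [seq z i | i <- enum 'I_N].
have us : uniq s by rewrite map_inj_uniq// enum_uniq.
have sr a : a \in s -> cmod a <= r + d by move=> /mapP[i _ ->]; exact: nbr.
have s0 a : a \in s -> F a = 0 by move=> /mapP[j _ ->]; rewrite /F /P cint subrr.
have ss : size s = N by rewrite size_map size_enum_ord.
have Fb := blb F s A aF us sr s0 FA; rewrite ss in Fb.
pose q := expR (- v) / kap.
pose M := 2 * A * q ^+ N.
have q0 : 0 <= q by rewrite divr_ge0 ?expR_ge0// ltW.
have M0 : 0 <= M by apply: mulr_ge0; [rewrite mulr_ge0|rewrite exprn_ge0].
have FM w : nbh U d w -> cmod (F w) <= M.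
  move=> nw; apply: le_trans (Fb w (le_trans (nbr w nw) (ltW rrho))) _.
  have -> : M = A / kap ^+ N * (2 * expR (- (N%:R * v))).
    rewrite /M /q expr_div_n -mulrN mulr_natl expRM_natl; field.
    by rewrite expf_neq0// gt_eqF.
  apply: ler_wpM2l; first by rewrite divr_ge0// exprn_ge0// ltW.
  by have := zp w nw; rewrite /s big_map big_enum.
have nD w : nbh U d w -> Dset w.
  by move=> /nbr h; exact: le_lt_trans h rd1.
have := comp_norm_bound M0 d0 aF nD FM; rewrite -/L0 => h.
apply: (@le_trans _ _ (M * L0)); first exact: h.
have -> : M * L0 = (2 * K * L0) * (2 * N%:R + 1) * q ^+ N by rewrite /M /A; ring.
rewrite -/q; apply: ler_wpM2r; first by rewrite exprn_ge0.
by apply: ler_wpM2r; [rewrite addr_ge0|rewrite lerDl].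
Qed.

End Approximation.

(** * From geometric decay to n-th roots *)

Section SpectralRadius.
Variable R : realType.
Local Notation C := R[i].

Lemma bernoulli_ineq (x : R) n : 0 <= x -> 1 + n%:R * x <= (1 + x) ^+ n.
Proof.
move=> x0; elim: n => [|n IH]; first by rewrite mul0r addr0 expr0.
rewrite exprS; apply: le_trans (ler_wpM2l _ IH); last by rewrite addr_ge0.
have : 0 <= n%:R * (x * x) by rewrite mulr_ge0// mulr_ge0.
by rewrite -natr1; move: (n%:R) => m h; lra.
Qed.

(** Of the two factors kap^N, one absorbs the linear term, since kap^N (1 + N x) <= 1 by Bernoulli's
    inequality with x = 1/kap - 1; the other tends to 0. *)
Lemma poly_geometric (L kap e : R) : 0 <= L -> 0 < kap < 1 -> 0 < e ->
  exists N0 : nat, forall N, (N0 <= N)%N -> L * (2 * N%:R + 1) * (kap ^+ 2) ^+ N <= e.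
Proof.
move=> L0 /andP[k0 k1] e0; pose x := kap^-1 - 1.
have x0 : 0 < x by rewrite subr_gt0 invf_gt1.
pose B := 2 / x + 1.
have B0 : 0 < B by rewrite ltr_wpDl// divr_ge0// ltW.
exists (Num.truncn (L * B / (e * x))).+1 => N hN.
have N0 : 0 <= N%:R :> R by exact: ler0n.
have h1 : kap ^+ N * (1 + N%:R * x) <= 1.
  apply: le_trans (ler_wpM2l (exprn_ge0 N (ltW k0)) (bernoulli_ineq N (ltW x0))) _.
  by rewrite /x addrC subrK -exprMn divff ?gt_eqF// expr1n.
have kn0 : 0 <= kap ^+ N by rewrite exprn_ge0// ltW.
have h2 : (2 * N%:R + 1) <= B * (1 + N%:R * x).
  have -> : B * (1 + N%:R * x) = 2 / x + 1 + 2 * N%:R + N%:R * x by rewrite /B; field; rewrite gt_eqF.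
  have : 0 <= 2 / x by rewrite divr_ge0// ltW.
  have : 0 <= N%:R * x by rewrite mulr_ge0// ltW.
  by move: (2 / x) (N%:R * x) => a b; lra.
have h3 : L * B <= e * (1 + N%:R * x).
  have : L * B / (e * x) <= N%:R.
    by apply: ltW; rewrite -truncn_lt_nat// divr_ge0 ?mulr_ge0// ltW.
  rewrite ler_pdivrMr ?mulr_gt0// => h; apply: le_trans h _.
  by have -> : e * (1 + N%:R * x) = e + N%:R * (e * x); [ring|rewrite lerDr ltW].
have e1 : (kap ^+ 2) ^+ N = kap ^+ N * kap ^+ N by rewrite -exprM mulnC exprM expr2.
rewrite e1; set k := kap ^+ N in h1 kn0 *; set y := 1 + _ in h1 h2 h3.
apply: (@le_trans _ _ (L * (B * y) * (k * k))).
  apply: ler_wpM2r; first exact: mulr_ge0.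
  exact: ler_wpM2l.
have -> : L * (B * y) * (k * k) = L * B * k * (k * y) by ring.
apply: (@le_trans _ _ (L * B * k)).
  by rewrite ler_piMr// mulr_ge0// mulr_ge0// ltW.
apply: (@le_trans _ _ (e * y * k)); first exact: ler_wpM2r.
by rewrite -mulrA ler_piMr ?(ltW e0)// mulrC.
Qed.

Lemma poweR_root_le (a : \bar R) (q : R) n : (0 < n)%N -> 0 <= q -> (0 <= a)%E ->
  (a <= (q ^+ n)%:E)%E -> (poweR a (n%:R^-1) <= q%:E)%E.
Proof.
move=> n0 q0 a0 aq; have nz : n%:R != 0 :> R by rewrite pnatr_eq0 -lt0n.
have -> : q%:E = poweR (q ^+ n)%:E (n%:R^-1).
  by rewrite poweR_EFin -powR_mulrn// -powRrM mulfV// powRr1.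
apply: gt0_ler_poweR => //.
- by rewrite in_itv /= a0 leey.
- by rewrite in_itv /= leey andbT lee_fin exprn_ge0.
Qed.

Variables (omega : R -> R) (phi : C -> C).

Lemma limsup_approx_num (r t : R) : admissible_weight omega -> symbol omega phi -> r < 1 ->
  (forall z, Dset z -> cmod (phi z) <= r) ->
  ((- t)%:E < Vgreen (closure_image phi))%E ->
  (limn_esup (fun n : nat => poweR (approx_num omega n (compo phi)) (n%:R^-1))
   <= (expR t)%:E)%E.
Proof.
move=> om_adm sy r1 phir tV.
(* A [v] strictly between -t and the energy leaves the gap t + v to be spent on the subexponential
   factors; the energy may be +oo. *)
have [v tv vV] : exists2 v : R, - t < v & (v%:E < Vgreen (closure_image phi))%E.
  move: tV; case: (Vgreen _) => [x| |] //.
    rewrite lte_fin => h; exists ((- t + x) / 2); last rewrite lte_fin; lra.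
  by move=> _; exists (1 - t); [lra|exact: ltry].
(* With a third of the gap, exp(-v) / kap = exp(t) kap^2: one third pays for the Blaschke division,
   the other two leave kap^2 to defeat the factor 2 N + 1. *)
pose eta := (t + v) / 3.
have eta0 : 0 < eta by rewrite /eta divr_gt0//; lra.
pose kap := expR (- eta).
have kap01 : 0 < kap < 1 by rewrite expR_gt0 expR_lt1 oppr_lt0.
have [L [N0 [L0 hN]]] := approx_num_bound om_adm sy r1 phir vV kap01.
(* The target exp(t) is the one extra factor available because the index is N + 1 while the decay
   has exponent N. *)
have [N1 hN1] := poly_geometric (ltW L0) kap01 (expR_gt0 t).
apply: (@limn_esup_ub _ _ _ (maxn N0 N1).+1) => -[//|N]; rewrite ltnS geq_max => /andP[NN0 NN1].
apply: poweR_root_le; [by []|exact: expR_ge0|exact: approx_num_ge0|].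
apply: le_trans (hN _ NN0) _; rewrite lee_fin exprS.
have -> : expR (- v) / kap = expR t * kap ^+ 2.
  by rewrite /kap -expRN -expRM_natl -!expRD /eta; congr expR; field.
rewrite exprMn mulrCA mulrC; apply: ler_wpM2r; first by rewrite exprn_ge0// expR_ge0.
exact: hN1.
Qed.

End SpectralRadius.

Theorem theorem3p7 (R : realType) (omega : R -> R) (phi : R[i] -> R[i]) :
  admissible_weight omega ->
  symbol omega phi ->
  (exists r : R, r < 1 /\ forall z, Dset z -> cmod (phi z) <= r) ->
  (limn_esup (fun n : nat =>
      poweR (approx_num omega n (compo phi)) (n%:R^-1))
   <= expeR (- (Cap (closure_image phi))^-1))%E.
Proof.
move=> om_adm sy [r [r1 phir]]; rewrite /Cap inveK.
have key t := limsup_approx_num om_adm sy r1 phir (t := t).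
(* For energy -oo the right-hand side is +oo. Otherwise every [e > 0] is reached by a suitable [t]:
   the logarithm of exp(-x) + e, or of [e] alone when the energy is +oo and the right-hand side
   0. *)
case E : (Vgreen _) => [x| |]; last by rewrite leey.
- rewrite /= ; apply/lee_addgt0Pr => e e0.
  have y0 : 0 < expR (- x) + e by rewrite addr_gt0 ?expR_gt0.
  rewrite -EFinD -[X in X%:E]lnK ?posrE//; apply: key; rewrite E lte_fin.
  rewrite ltrNl -[ltLHS]expRK ltr_ln ?posrE ?expR_gt0// ltrDl//.
- apply/lee_addgt0Pr => e e0; rewrite /= add0e -[e]lnK ?posrE//.
  by apply: key; rewrite E ltry.
Qed.
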